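(* Let $f:U\to V$ be in the class $\mathcal F$, let $c_1\in U$, let $g=f+c_1$ on $U\setminus\{0\}$ with $g(0)=c_1$, and for each $w\in W:=\mathbb C$ define $G_w(z)=g(z)+(w-c_1)$ and $p(w)=0$. Assume that there exists $q\ge1$ such that $c_n:=g^{n-1}(c_1)\in U$ for all $1\le n<q$ and either $c_q=0$ or $c_q\in\{c_1,\dots,c_{q-1}\}$. Moreover assume $c_n\notin\{0,c_1,\dots,c_{n-1}\}$ for $0<n<q$. Then: - $(g,G,p)_W$ satisfies the lifting property and the transversality property holds; - if $(g,G,p)_W$ is real, then the positively oriented transversality property holds.
   Context: **Class $\mathcal F$.** $\mathcal F$ is the set of holomorphic maps $f:U\to V$ such that (a) $U\subset\mathbb C$ is a bounded open set with $0\in\overline U$; (b) $V\subset\mathbb C$ is a bounded open set; (c) $f:U\setminus\{0\}\to V\setminus\{0\}$ is an unbranched covering; (d) $V\supset B(0;\operatorname{diam}(U))\supset U$. Here $B(x;r)$ is the open disc of radius $r$ about $x$. **Setting.** $g$ is viewed as a marked map with $P_0=\{c_0\}$, $c_0=0$, and $P=\{0,c_1,\dots,c_{q-1}\}$ (so $g(P)\subset P$, $P\setminus P_0\subset U$, and $g$ is holomorphic with nonzero derivative at points of $P\setminus P_0$). $(g,G,p)_W$ is its deformation, with $G_{c_1}=g$. **Transversality.** Near $w=c_1$ put $R(w)=G_w^{q-1}(w)-p(w)$ if $c_q=0$, and $R(w)=G_w^{q-1}(w)-G_w^{l-1}(w)$ if $c_q=c_l$ with $1\le l<q$. The transversality property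 means $R'(c_1)\neq0$. $(g,G,p)_W$ is real if $P\subset\mathbb R$, $U$ is invariant under complex conjugation, $g(\bar z)=\overline{g(z)}$ and $G_{\bar w}(\bar z)=\overline{G_w(z)}$. In the real case the positively oriented transversality property means $R'(c_1)/Dg^{q-1}(c_1)>0$. **Lifting property.** A holomorphic motion of $X\subset\mathbb C$ over $(\Lambda,0)$ ($\Lambda\ni0$ a domain in $\mathbb C$) is a family $h_\lambda:X\to\mathbb C$, $\lambda\in\Lambda$, with $h_0=\mathrm{id}$, each $h_\lambda$ injective, and $\lambda\mapsto h_\lambda(x)$ holomorphic for each $x$. A holomorphic motion $\hat h_\lambda$ of $g(P)$ is a lift of a holomorphic motion $h_\lambda$ of $g(P)$ over $\Lambda_0\ni0$ if for all $\lambda\in\Lambda_0$: $\hat h_\lambda(c_0)=p(h_\lambda(c_1))$ if $c_0\in g(P)$, and $G_{h_\lambda(c_1)}(\hat h_\lambda(x))=h_\lambda(g(x))$ for $x\in g(P)\setminus P_0$. $(g,G,p)_W$ has the lifting property if for each holomorphic motion $h^{(0)}_\lambda$ of $g(P)$ over the unit disc $(\mathbb D,0)$ there exist $\varepsilon>0$, $M>0$ and holomorphic motions $h^{(k)}_\lambda$ ($k\ge1$) of $g(P)$ over $(\mathbb D_\varepsilon,0)$, $\mathbb D_\varepsilon=\{|\lambda|<\varepsilon\}$, such that for every $k\ge0$, $h^{(k+1)}_\lambda$ is a lift of $h^{(k)}_\lambda$ over $\mathbb D_\varepsilon$ and $|h^{(k)}_\lambda(x)|\le M$ for all $x\in g(P)$,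 $\lambda\in\mathbb D_\varepsilon$. *)

(* Defs.v *)
From Stdlib Require Import Reals.
From Coquelicot Require Import Coquelicot.

Local Open Scope C_scope.

(** Subsets of the plane are predicates [C -> Prop].  Maps defined on a subset
    are total functions [C -> C] whose values off the domain are irrelevant:
    [open], [continuous] and [is_derive] below are only ever used at points of
    open sets contained in the domain, so they depend on germs only. *)

Definition C_open (D : C -> Prop) : Prop := @open C_UniformSpace D.

Definition C_continuous (f : C -> C) (z : C) : Prop :=
  @continuous C_UniformSpace C_UniformSpace f z.

Definition C_is_derive (f : C -> C) (z l : C) : Prop :=
  @is_derive C_AbsRing C_NormedModule f z l.

Definition holomorphic_on (D : C -> Prop) (f : C -> C) : Prop :=
  forall z, D z -> exists l, C_is_derive f z l.

Definition disc (r : R) (z : C) : Prop := (Cmod z < r)%R.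

Definition C_bounded (D : C -> Prop) : Prop :=
  exists M : R, forall z, D z -> (Cmod z <= M)%R.

Definition adherent (D : C -> Prop) (a : C) : Prop :=
  forall eps : R, (0 < eps)%R -> exists z, D z /\ (Cmod (z - a) < eps)%R.

(** [Lub_Rbar] takes values in the extended reals; its real part is the supremum
    of the set when [D] is nonempty and bounded. *)
Definition diam (D : C -> Prop) : R :=
  real (Lub_Rbar (fun r => exists x y, D x /\ D y /\ r = Cmod (x - y))).

Definition minus0 (D : C -> Prop) (z : C) : Prop := D z /\ z <> 0.

(** [f] restricts to a homeomorphism from the open set [S] onto the open
    set [N]. *)
Definition homeo_onto (f : C -> C) (S N : C -> Prop) : Prop :=
  (forall z, S z -> N (f z) /\ C_continuous f z) /\
  exists s : C -> C,
    (forall y, N y -> S (s y) /\ f (s y) = y /\ C_continuous s y) /\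
    (forall z, S z -> s (f z) = z).

(** Unbranched covering of the open set [Y] by the open set [X]: a continuous
    surjection for which every point of [Y] has an evenly covered open
    neighbourhood; [S] is the family of sheets over it. *)
Definition covering (f : C -> C) (X Y : C -> Prop) : Prop :=
  (forall x, X x -> Y (f x) /\ C_continuous f x) /\
  (forall y, Y y -> exists x, X x /\ f x = y) /\
  (forall y, Y y ->
     exists N : C -> Prop,
       C_open N /\ N y /\ (forall v, N v -> Y v) /\
       exists (I : Type) (S : I -> C -> Prop),
         (forall i, C_open (S i)) /\
         (forall i j z, S i z -> S j z -> i = j) /\
         (forall z, (X z /\ N (f z)) <-> exists i, S i z) /\
         (forall i, homeo_onto f (S i) N)).

Record class_F (U V : C -> Prop) (f : C -> C) : Prop := {
  F_maps : forall z, U z -> V (f z);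
  F_holomorphic : holomorphic_on U f;
  F_U_open : C_open U;
  F_U_bounded : C_bounded U;
  F_U_zero : adherent U 0;
  F_V_open : C_open V;
  F_V_bounded : C_bounded V;
  F_covering : covering f (minus0 U) (minus0 V);
  F_disc_V : forall z, disc (diam U) z -> V z;
  F_U_disc : forall z, U z -> disc (diam U) z
}.

(** A marked map [g] with [P_0 = {c0}], together with a deformation [(g,G,p)_W].
    [d_dom] is the open set on which [g] and the [G_w] are holomorphic; it
    contains [P \ P_0].  The critical point [c0] is not a point of it, although
    [g c0 = c1] is defined. *)
Record deformation := Deformation {
  d_dom : C -> Prop;
  d_P : C -> Prop;
  d_c0 : C;
  d_c1 : C;
  d_g : C -> C;
  d_W : C -> Prop;
  d_G : C -> C -> C;
  d_p : C -> C
}.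

Definition d_gP (D : deformation) (y : C) : Prop :=
  exists x, d_P D x /\ y = d_g D x.

(** [c_n = g^(n-1)(c_1)], for [n >= 1]. *)
Definition c_ (D : deformation) (n : nat) : C :=
  Nat.iter (n - 1) (d_g D) (d_c1 D).

(** The open set [L] is the parameter domain, based at [0]; it is a disc
    centred at [0] in all uses below. *)
Definition holomorphic_motion (X L : C -> Prop) (h : C -> C -> C) : Prop :=
  (forall x, X x -> h 0 x = x) /\
  (forall l x y, L l -> X x -> X y -> h l x = h l y -> x = y) /\
  (forall x, X x -> holomorphic_on L (fun l => h l x)).

(** [hh] is a lift of [h] over [L].  The conditions [d_W] and [d_dom] say that
    the expression [G_{h_l(c_1)}(hh_l(x))] is meaningful. *)
Definition is_lift (D : deformation) (L : C -> Prop) (h hh : C -> C -> C) : Prop :=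
  forall l, L l ->
    d_W D (h l (d_c1 D)) /\
    (d_gP D (d_c0 D) -> hh l (d_c0 D) = d_p D (h l (d_c1 D))) /\
    (forall x, d_gP D x -> x <> d_c0 D ->
       d_dom D (hh l x) /\ d_G D (h l (d_c1 D)) (hh l x) = h l (d_g D x)).

(** The bound [eps <= 1] is needed because [h0] is only given over the unit
    disc. *)
Definition lifting_property (D : deformation) : Prop :=
  forall h0 : C -> C -> C,
    holomorphic_motion (d_gP D) (disc 1) h0 ->
    exists eps M : R, (0 < eps <= 1)%R /\ (0 < M)%R /\
    exists h : nat -> C -> C -> C,
      h O = h0 /\
      (forall k, (1 <= k)%nat -> holomorphic_motion (d_gP D) (disc eps) (h k)) /\
      (forall k, is_lift D (disc eps) (h k) (h (S k))) /\
      (forall k l x, disc eps l -> d_gP D x -> (Cmod (h k l x) <= M)%R).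

(** [r] is the function whose zeros near [c_1] are the parameters at which the
    critical relation [c_q = c_0] or [c_q = c_l], [1 <= l < q], persists.  If
    [c_0, c_1, ..., c_(q-1)] are distinct there is at most one such [r]. *)
Definition relation_function (D : deformation) (q : nat) (r : C -> C) : Prop :=
  (c_ D q = d_c0 D /\
   r = fun w => Nat.iter (q - 1) (d_G D w) w - d_p D w) \/
  (exists l, (1 <= l < q)%nat /\ c_ D q = c_ D l /\
   r = fun w => Nat.iter (q - 1) (d_G D w) w - Nat.iter (l - 1) (d_G D w) w).

Definition transversality (D : deformation) (q : nat) : Prop :=
  exists r a, relation_function D q r /\ C_is_derive r (d_c1 D) a /\ a <> 0.

Definition positively_oriented_transversality (D : deformation) (q : nat) : Prop :=
  exists r a b, relation_function D q r /\
    C_is_derive r (d_c1 D) a /\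
    C_is_derive (Nat.iter (q - 1) (d_g D)) (d_c1 D) b /\
    b <> 0 /\
    exists t : R, (0 < t)%R /\ a / b = RtoC t.

Definition real_deformation (D : deformation) : Prop :=
  (forall x, d_P D x -> Im x = 0%R) /\
  (forall z, d_dom D z -> d_dom D (Cconj z)) /\
  (forall z, d_dom D z -> d_g D (Cconj z) = Cconj (d_g D z)) /\
  (forall w z, d_W D w -> d_dom D z ->
     d_W D (Cconj w) /\ d_G D (Cconj w) (Cconj z) = Cconj (d_G D w z)).

(** The marked map [g], with [P = {0, c_1, ..., c_(q-1)}], and the family
    [G_w = g + (w - c_1)], [p = 0], over [W = C]. *)
Definition additive_deformation
    (U : C -> Prop) (g : C -> C) (c1 : C) (q : nat) : deformation := {|
  d_dom := minus0 U;
  d_P := fun z =>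
    z = 0 \/ exists n, (1 <= n < q)%nat /\ z = Nat.iter (n - 1) g c1;
  d_c0 := 0;
  d_c1 := c1;
  d_g := g;
  d_W := fun _ => True;
  d_G := fun w z => g z + (w - c1);
  d_p := fun _ => 0
|}.

(* Main.v *)
(** Let [c_0 = 0, c_1, ..., c_N] be the marked points, [delta = diam U], so that
    [f(c_n) = c_next(n) - c_1] with [|f(c_n)| < delta].

    Lifting.  For a motion close to the identity the differences [h(c_next(n)) - h(c_1)] stay in
    the punctured disc of radius [delta], which [V] contains, so they lift through the
    covering [f] to a motion in [U].  Points of [U] differ by less than [delta], hence the
    lift is again of this kind, and the construction can be iterated over the same disc.

    Transversality.  If [R] vanishes at [c_1] to finite order [m >= 2], perturbing the marked
    points along the orbit of [w = c_1 + rho lambda] gives lifts whose coefficients at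
    [lambda^m] grow linearly, against Cauchy's estimates.  If [R] vanishes identically, write
    [z_next(n) - z_1 = delta exp t_n] with [Re t_n < 0] for the moving marked points [z_n].
    The tuples [t] obtained from families moving with [t_1] form a closed set to which a
    Phragmen-Lindelof principle applies, because at its boundary [Re t_1 = 0]: if
    [|z_next(n) - z_1| = delta] then [z_1] cannot be inside [U].  The principle shows first
    that [t_1] is dense in the half-plane, so that two such tuples have opposite values
    of [delta exp t_1]; by the parallelogram law applied at the boundary these satisfy
    [z_1' = z_2], and then two marked points lie further apart than [delta].

    Sign.  In the real case put [v_1 = 1], [v_(n+1) = s f'(c_n) v_n + 1].  A relation
    [v_(N+1) = v_next(N)] with [s > 1] would make a motion whose lifts have derivatives
    growing like [s^k]; so, up to normalisation, the relation is a polynomial in [x = 1/s]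
    equal to [1] at [x = 0] and without zeros on (0, 1]. *)

Require Import Defs.
From Stdlib Require Import Reals.
From Stdlib Require Import Lra Lia ZArith ClassicalEpsilon Classical.
From Coquelicot Require Import Coquelicot.

Local Open Scope C_scope.
Local Open Scope R_scope.

(** A zero of finite order leaves a defect in the last relation that enters every lift afresh, and
    Cauchy's estimates on one common disc forbid its accumulation. A relation that vanishes
    identically leaves no defect: the family is its own lift, motions carry no information, and the
    argument has to become global. Continuing the family in the parameter [w] would meet monodromy,
    because [f] is a covering of a punctured set. Logarithms of the differences remove it: each
    inverse branch becomes one function on a whole half-plane. Analytic continuation is then
    replaced by closedness of a set of tuples that are locally graphs over their first coordinate,
    and each global fact about this set is the maximum principle for one function: a quotient with
    its pole at a point which the first coordinate is supposed to avoid, and arbitrarily large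
    multiples of a quantity that tends to zero at the boundary. The half-planes are unbounded, so
    the principle needs a factor that keeps maximising sequences from escaping to infinity. *)

(** * Continuity and complex derivatives in epsilon-delta form *)

Definition cont_at (f : C -> C) (z : C) : Prop :=
  forall eps, 0 < eps -> exists d, 0 < d /\
    forall w, Cmod (w - z) < d -> Cmod (f w - f z) < eps.

(** Written without a quotient and with a non-strict bound, so that [w = z] is no exception. *)
Definition dC (f : C -> C) (z l : C) : Prop :=
  forall eps, 0 < eps -> exists d, 0 < d /\
    forall w, Cmod (w - z) < d ->
      Cmod (f w - f z - l * (w - z)) <= eps * Cmod (w - z).

Definition holo (D : C -> Prop) (f : C -> C) : Prop :=
  forall z, D z -> exists l, dC f z l.

Definition ball_at (c : C) (r : R) (z : C) : Prop := Cmod (z - c) < r.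

Lemma Cmod_sub_comm (x y : C) : Cmod (x - y) = Cmod (y - x).
Proof. rewrite <- Cmod_opp. f_equal. ring. Qed.

Lemma Cmod_self (x : C) : Cmod (x - x) = 0.
Proof. replace (x - x)%C with (RtoC 0) by ring. apply Cmod_0. Qed.

Lemma Cmod_triangle3 (x y z : C) : Cmod (x - z) <= Cmod (x - y) + Cmod (y - z).
Proof. replace (x - z)%C with ((x - y) + (y - z))%C by ring. apply Cmod_triangle. Qed.

Lemma Cmod_sub_le (x y : C) : Cmod (x - y) <= Cmod x + Cmod y.
Proof. rewrite <- (Cmod_opp y). apply Cmod_triangle. Qed.

Lemma Cmod_rev_triangle (x y : C) : Cmod x - Cmod y <= Cmod (x - y).
Proof.
  assert (H := Cmod_triangle (x - y) y).
  replace (x - y + y)%C with x in H by ring. lra.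
Qed.

Lemma Cmod_sub_neq (x y : C) : x <> y -> 0 < Cmod (x - y).
Proof.
  intros H. apply Cmod_gt_0. intros E. apply H.
  replace x with (x - y + y)%C by ring. rewrite E. ring.
Qed.

Lemma Cmod_small_eq (x y : C) : (forall e, 0 < e -> Cmod (x - y) <= e) -> x = y.
Proof.
  intros H. destruct (Ceq_dec x y) as [E|E]; [exact E|].
  assert (P := Cmod_sub_neq _ _ E).
  specialize (H (Cmod (x - y) / 2)). lra.
Qed.

Lemma ball_at_center (c : C) (r : R) : 0 < r -> ball_at c r c.
Proof. intros H. unfold ball_at. rewrite Cmod_self. exact H. Qed.

Lemma ball_at_sub (c a : C) (r s : R) z :
  Cmod (a - c) + s <= r -> ball_at a s z -> ball_at c r z.
Proof.
  unfold ball_at. intros H Hz. assert (T := Cmod_triangle3 z a c). lra.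
Qed.


Lemma cont_const (a z : C) : cont_at (fun _ => a) z.
Proof. intros e He. exists 1. split; [lra|]. intros w _. rewrite Cmod_self. lra. Qed.

Lemma cont_id (z : C) : cont_at (fun w => w) z.
Proof. intros e He. exists e. split; [lra|]. auto. Qed.

Lemma cont_ext_loc (f g : C -> C) z d :
  0 < d -> (forall w, Cmod (w - z) < d -> f w = g w) -> cont_at f z -> cont_at g z.
Proof.
  intros Hd E H e He. destruct (H e He) as [d' [Hd' H']].
  exists (Rmin d d'). split; [apply Rmin_pos; auto|]. intros w Hw.
  assert (A1 := Rmin_l d d'). assert (A2 := Rmin_r d d').
  rewrite <- !E; [apply H'; lra | rewrite Cmod_self; lra | lra].
Qed.

Lemma cont_plus (f g : C -> C) z :
  cont_at f z -> cont_at g z -> cont_at (fun w => f w + g w)%C z.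
Proof.
  intros Hf Hg e He.
  destruct (Hf (e/2)) as [d1 [P1 H1]]; [lra|].
  destruct (Hg (e/2)) as [d2 [P2 H2]]; [lra|].
  exists (Rmin d1 d2). split; [apply Rmin_pos; auto|]. intros w Hw.
  assert (A1 := Rmin_l d1 d2). assert (A2 := Rmin_r d1 d2).
  replace (f w + g w - (f z + g z))%C with ((f w - f z) + (g w - g z))%C by ring.
  eapply Rle_lt_trans; [apply Cmod_triangle|].
  specialize (H1 w ltac:(lra)). specialize (H2 w ltac:(lra)). lra.
Qed.

Lemma cont_opp (f : C -> C) z : cont_at f z -> cont_at (fun w => - f w)%C z.
Proof.
  intros H e He. destruct (H e He) as [d [P Q]]. exists d. split; auto.
  intros w Hw. replace (- f w - - f z)%C with (- (f w - f z))%C by ring.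
  rewrite Cmod_opp. auto.
Qed.

Lemma cont_minus (f g : C -> C) z :
  cont_at f z -> cont_at g z -> cont_at (fun w => f w - g w)%C z.
Proof. intros Hf Hg. apply (cont_plus f (fun w => - g w)%C); auto. apply cont_opp; auto. Qed.

Lemma cont_mult (f g : C -> C) z :
  cont_at f z -> cont_at g z -> cont_at (fun w => f w * g w)%C z.
Proof.
  intros Hf Hg e He.
  set (A := Cmod (f z) + 1). set (B := Cmod (g z) + 1).
  assert (HA : 0 < A) by (unfold A; assert (Q := Cmod_ge_0 (f z)); lra).
  assert (HB : 0 < B) by (unfold B; assert (Q := Cmod_ge_0 (g z)); lra).
  destruct (Hf (Rmin 1 (e/(2*B)))) as [d1 [P1 H1]].
  { apply Rmin_pos; [lra|]. apply Rdiv_lt_0_compat; lra. }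
  destruct (Hg (e/(2*A))) as [d2 [P2 H2]].
  { apply Rdiv_lt_0_compat; lra. }
  exists (Rmin d1 d2). split; [apply Rmin_pos; auto|]. intros w Hw.
  assert (A1 := Rmin_l d1 d2). assert (A2 := Rmin_r d1 d2).
  specialize (H1 w ltac:(lra)). specialize (H2 w ltac:(lra)).
  assert (B1 := Rmin_l 1 (e/(2*B))). assert (B2 := Rmin_r 1 (e/(2*B))).
  replace (f w * g w - f z * g z)%C with (f w * (g w - g z) + (f w - f z) * g z)%C by ring.
  eapply Rle_lt_trans; [apply Cmod_triangle|]. rewrite !Cmod_mult.
  assert (Hfw : Cmod (f w) <= A).
  { assert (T := Cmod_triangle (f w - f z) (f z)).
    replace (f w - f z + f z)%C with (f w) in T by ring. unfold A. lra. }
  assert (C1 : Cmod (f w) * Cmod (g w - g z) <= A * Cmod (g w - g z)).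
  { apply Rmult_le_compat_r; [apply Cmod_ge_0|auto]. }
  assert (C2 : A * Cmod (g w - g z) < A * (e / (2*A))) by (apply Rmult_lt_compat_l; auto).
  replace (A * (e / (2*A))) with (e/2) in C2 by (field; lra).
  assert (C3 : Cmod (f w - f z) * Cmod (g z) <= (e/(2*B)) * B).
  { apply Rmult_le_compat; try apply Cmod_ge_0; [lra| unfold B; lra]. }
  replace (e / (2*B) * B) with (e/2) in C3 by (field; lra). lra.
Qed.

Lemma cont_comp (f g : C -> C) z :
  cont_at g z -> cont_at f (g z) -> cont_at (fun w => f (g w)) z.
Proof.
  intros Hg Hf e He. destruct (Hf e He) as [d [P Q]].
  destruct (Hg d P) as [d' [P' Q']]. exists d'. split; auto.
Qed.

Lemma cont_inv_id (z : C) : z <> RtoC 0 -> cont_at (fun w => / w)%C z.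
Proof.
  intros Hz e He. assert (P := proj1 (Cmod_gt_0 z) Hz).
  (* The first bound keeps [Cmod w] above [Cmod z / 2]; the second absorbs the factor
     [1 / (Cmod w * Cmod z)], which is then at most [2 / Cmod z ^ 2]. *)
  exists (Rmin (Cmod z / 2) (e * (Cmod z * Cmod z) / 2)).
  assert (PP : 0 < Cmod z * Cmod z) by nra.
  split. { apply Rmin_pos; [lra|]. assert (0 < e * (Cmod z * Cmod z)) by nra. lra. }
  intros w Hw.
  assert (A1 := Rmin_l (Cmod z / 2) (e * (Cmod z * Cmod z) / 2)).
  assert (A2 := Rmin_r (Cmod z / 2) (e * (Cmod z * Cmod z) / 2)).
  assert (T := Cmod_rev_triangle z w). rewrite Cmod_sub_comm in T.
  assert (W : Cmod z / 2 < Cmod w) by lra.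
  assert (Hw0 : w <> RtoC 0) by (apply Cmod_gt_0; lra).
  replace (/ w - / z)%C with ((z - w) / (w * z))%C by (field; auto).
  rewrite Cmod_div by (apply Cmult_neq_0; auto).
  rewrite Cmod_mult, (Cmod_sub_comm z w).
  apply Rmult_lt_reg_r with (Cmod w * Cmod z); [nra|].
  assert (M : 0 < Cmod w * Cmod z) by nra.
  unfold Rdiv. rewrite Rmult_assoc, Rinv_l, Rmult_1_r by lra.
  assert (Cmod z / 2 * Cmod z <= Cmod w * Cmod z) by (apply Rmult_le_compat_r; lra).
  assert (e * (Cmod z / 2 * Cmod z) <= e * (Cmod w * Cmod z)) by (apply Rmult_le_compat_l; lra).
  lra.
Qed.

Lemma cont_inv (f : C -> C) z :
  f z <> RtoC 0 -> cont_at f z -> cont_at (fun w => / f w)%C z.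
Proof. intros N H. apply (cont_comp (fun w => / w)%C f); auto. apply cont_inv_id; auto. Qed.

Lemma cont_div (f g : C -> C) z :
  g z <> RtoC 0 -> cont_at f z -> cont_at g z -> cont_at (fun w => f w / g w)%C z.
Proof. intros N Hf Hg. apply (cont_mult f (fun w => / g w)%C); auto. apply cont_inv; auto. Qed.

Lemma cont_neq (f : C -> C) z a : cont_at f z -> f z <> a ->
  exists d, 0 < d /\ forall w, Cmod (w - z) < d -> f w <> a.
Proof.
  intros H N. destruct (H (Cmod (f z - a)) (Cmod_sub_neq _ _ N)) as [d [P Q]].
  exists d. split; auto. intros w Hw E. specialize (Q w Hw). rewrite E, Cmod_sub_comm in Q. lra.
Qed.


(* Caratheodory's characterisation, from which the algebra of derivatives follows. *)
Lemma dC_slope (f : C -> C) z l :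
  dC f z l <-> exists s, cont_at s z /\ s z = l /\ forall w, f w = (f z + s w * (w - z))%C.
Proof.
  split.
  - intros H.
    exists (fun w => if Ceq_dec w z then l else ((f w - f z) / (w - z))%C).
    destruct (Ceq_dec z z) as [_|n]; [|congruence].
    split; [|split].
    + intros e He. destruct (H (e/2)) as [d [P Q]]; [lra|]. exists d. split; auto.
      intros w Hw. destruct (Ceq_dec z z) as [_|n]; [|congruence].
      destruct (Ceq_dec w z) as [E|E]. { rewrite Cmod_self; lra. }
      assert (W := Cmod_sub_neq _ _ E).
      assert (N : (w - z)%C <> RtoC 0) by (apply Cmod_gt_0; auto).
      replace ((f w - f z) / (w - z) - l)%C with ((f w - f z - l * (w - z)) / (w - z))%C
        by (field; auto).
      rewrite Cmod_div by auto. specialize (Q w Hw).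
      apply Rle_lt_trans with (e/2); [|lra].
      apply Rmult_le_reg_r with (Cmod (w - z)); auto.
      unfold Rdiv at 1. rewrite Rmult_assoc, Rinv_l by lra. lra.
    + reflexivity.
    + intros w. destruct (Ceq_dec w z) as [E|E]. { subst. ring. }
      assert (W := Cmod_sub_neq _ _ E). field. apply Cmod_gt_0; auto.
  - intros [s [Hs [E F]]] e He. destruct (Hs e He) as [d [P Q]]. exists d. split; auto.
    intros w Hw. rewrite (F w). rewrite <- E.
    replace (f z + s w * (w - z) - f z - s z * (w - z))%C with ((s w - s z) * (w - z))%C by ring.
    rewrite Cmod_mult. apply Rmult_le_compat_r; [apply Cmod_ge_0|]. left; auto.
Qed.

Lemma dC_cont (f : C -> C) z l : dC f z l -> cont_at f z.
Proof.
  intros H. apply dC_slope in H. destruct H as [s [Hs [_ F]]].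
  apply (cont_ext_loc (fun w => f z + s w * (w - z))%C f z 1); [lra| auto|].
  apply cont_plus; [apply cont_const|]. apply cont_mult; auto.
  apply cont_minus; [apply cont_id|apply cont_const].
Qed.

Lemma dC_ext_loc (f g : C -> C) z l d :
  0 < d -> (forall w, Cmod (w - z) < d -> f w = g w) -> dC f z l -> dC g z l.
Proof.
  intros Hd E H e He. destruct (H e He) as [d' [Hd' H']].
  exists (Rmin d d'). split; [apply Rmin_pos; auto|]. intros w Hw.
  assert (A1 := Rmin_l d d'). assert (A2 := Rmin_r d d').
  rewrite <- !E; [apply H'; lra | rewrite Cmod_self; lra | lra].
Qed.

Lemma dC_ext (f g : C -> C) z l : (forall w, f w = g w) -> dC f z l -> dC g z l.
Proof. intros E. apply (dC_ext_loc f g z l 1); auto; lra. Qed.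

Lemma dC_unique (f : C -> C) z l l' : dC f z l -> dC f z l' -> l = l'.
Proof.
  intros H H'. apply Cmod_small_eq. intros e He.
  destruct (H (e/2)) as [d [P Q]]; [lra|]. destruct (H' (e/2)) as [d' [P' Q']]; [lra|].
  set (m := Rmin d d' / 2).
  assert (A1 := Rmin_l d d'). assert (A2 := Rmin_r d d').
  assert (Hm : 0 < m) by (unfold m; assert (0 < Rmin d d') by (apply Rmin_pos; auto); lra).
  assert (W : Cmod (z + RtoC m - z) = m).
  { replace (z + RtoC m - z)%C with (RtoC m) by ring. rewrite Cmod_R, Rabs_pos_eq; lra. }
  specialize (Q (z + RtoC m)%C). specialize (Q' (z + RtoC m)%C). rewrite W in Q, Q'.
  specialize (Q ltac:(unfold m; lra)). specialize (Q' ltac:(unfold m; lra)).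
  set (w := (z + RtoC m)%C) in *.
  assert (T := Cmod_sub_le (f w - f z - l' * (w - z)) (f w - f z - l * (w - z))).
  replace (f w - f z - l' * (w - z) - (f w - f z - l * (w - z)))%C
    with ((l - l') * (w - z))%C in T by ring.
  rewrite Cmod_mult, W in T.
  apply Rmult_le_reg_r with m; auto. lra.
Qed.

Lemma dC_const (a z : C) : dC (fun _ => a) z (RtoC 0).
Proof.
  apply dC_slope. exists (fun _ => RtoC 0). split; [apply cont_const|split; auto].
  intros; ring.
Qed.

Lemma dC_id (z : C) : dC (fun w => w) z (RtoC 1).
Proof.
  apply dC_slope. exists (fun _ => RtoC 1). split; [apply cont_const|split; auto].
  intros; ring.
Qed.

Lemma dC_plus (f g : C -> C) z a b :
  dC f z a -> dC g z b -> dC (fun w => f w + g w)%C z (a + b)%C.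
Proof.
  intros Hf Hg. apply dC_slope in Hf, Hg.
  destruct Hf as [s [A1 [A2 A3]]]. destruct Hg as [t [B1 [B2 B3]]].
  apply dC_slope. exists (fun w => s w + t w)%C. split; [apply cont_plus; auto|].
  split; [congruence|]. intros w. rewrite (A3 w), (B3 w). ring.
Qed.

Lemma dC_mult (f g : C -> C) z a b :
  dC f z a -> dC g z b -> dC (fun w => f w * g w)%C z (a * g z + f z * b)%C.
Proof.
  intros Hf Hg. assert (Cg := dC_cont _ _ _ Hg). apply dC_slope in Hf, Hg.
  destruct Hf as [s [A1 [A2 A3]]]. destruct Hg as [t [B1 [B2 B3]]].
  apply dC_slope. exists (fun w => s w * g w + f z * t w)%C. split; [|split].
  - apply cont_plus; apply cont_mult; auto. apply cont_const.
  - congruence.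
  - intros w. rewrite (A3 w), (B3 w). ring.
Qed.

Lemma dC_scal (f : C -> C) z a k : dC f z a -> dC (fun w => k * f w)%C z (k * a)%C.
Proof.
  intros H. replace (k * a)%C with (RtoC 0 * f z + k * a)%C by ring.
  apply (dC_mult (fun _ => k) f); auto. apply dC_const.
Qed.

Lemma dC_minus (f g : C -> C) z a b :
  dC f z a -> dC g z b -> dC (fun w => f w - g w)%C z (a - b)%C.
Proof.
  intros Hf Hg. replace (a - b)%C with (a + RtoC (-1) * b)%C by ring.
  apply (dC_ext (fun w => f w + RtoC (-1) * g w)%C). { intros; ring. }
  apply dC_plus; auto. apply dC_scal; auto.
Qed.

Lemma dC_comp (f g : C -> C) z a b :
  dC g z b -> dC f (g z) a -> dC (fun w => f (g w)) z (a * b)%C.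
Proof.
  intros Hg Hf. assert (Cg := dC_cont _ _ _ Hg). apply dC_slope in Hf, Hg.
  destruct Hf as [s [A1 [A2 A3]]]. destruct Hg as [t [B1 [B2 B3]]].
  apply dC_slope. exists (fun w => s (g w) * t w)%C. split; [|split].
  - apply cont_mult; auto. apply (cont_comp s g); auto.
  - congruence.
  - intros w. rewrite (A3 (g w)). rewrite (B3 w) at 2. ring.
Qed.

Lemma dC_inv (f : C -> C) z a :
  f z <> RtoC 0 -> dC f z a -> dC (fun w => / f w)%C z (- a / (f z * f z))%C.
Proof.
  intros N Hf. assert (Cf := dC_cont _ _ _ Hf).
  destruct (cont_neq f z _ Cf N) as [d [P Q]].
  apply dC_slope in Hf. destruct Hf as [s [A1 [A2 A3]]].
  apply (dC_ext_loc (fun w => / f z + (- s w / (f w * f z)) * (w - z))%C _ z _ d); auto.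
  - intros w Hw. specialize (Q w Hw).
    replace (s w * (w - z))%C with (f w - f z)%C in * by (rewrite (A3 w) at 1; ring).
    assert (E : (s w * (w - z) = f w - f z)%C) by (rewrite (A3 w); ring).
    replace (- s w / (f w * f z) * (w - z))%C with (- (s w * (w - z)) / (f w * f z))%C by (field; auto).
    rewrite E. field; auto.
  - apply dC_slope. exists (fun w => - s w / (f w * f z))%C. split; [|split].
    + apply (cont_div (fun w => - s w)%C (fun w => f w * f z)%C).
      * apply Cmult_neq_0; auto.
      * apply cont_opp; auto.
      * apply cont_mult; auto. apply cont_const.
    + rewrite A2. reflexivity.
    + intros w. ring.
Qed.

Lemma dC_div (f g : C -> C) z a b :
  g z <> RtoC 0 -> dC f z a -> dC g z b ->
  dC (fun w => f w / g w)%C z ((a * g z - f z * b) / (g z * g z))%C.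
Proof.
  intros N Hf Hg.
  replace ((a * g z - f z * b) / (g z * g z))%C
    with (a * / g z + f z * (- b / (g z * g z)))%C by (field; auto).
  apply (dC_mult f (fun w => / g w)%C); auto. apply dC_inv; auto.
Qed.

Lemma holo_cont D f z : holo D f -> D z -> cont_at f z.
Proof. intros H Hz. destruct (H z Hz) as [l Hl]. eapply dC_cont; eauto. Qed.

Lemma holo_sub (D E : C -> Prop) f : (forall z, E z -> D z) -> holo D f -> holo E f.
Proof. intros S H z Hz. apply H; auto. Qed.

Lemma holo_plus D f g : holo D f -> holo D g -> holo D (fun z => f z + g z)%C.
Proof.
  intros Hf Hg z Hz. destruct (Hf z Hz) as [a Ha], (Hg z Hz) as [b Hb].
  eexists. apply dC_plus; eauto.
Qed.

Lemma holo_minus D f g : holo D f -> holo D g -> holo D (fun z => f z - g z)%C.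
Proof.
  intros Hf Hg z Hz. destruct (Hf z Hz) as [a Ha], (Hg z Hz) as [b Hb].
  eexists. apply dC_minus; eauto.
Qed.

Lemma holo_mult D f g : holo D f -> holo D g -> holo D (fun z => f z * g z)%C.
Proof.
  intros Hf Hg z Hz. destruct (Hf z Hz) as [a Ha], (Hg z Hz) as [b Hb].
  eexists. apply dC_mult; eauto.
Qed.

Lemma holo_const D a : holo D (fun _ => a).
Proof. intros z _. eexists. apply dC_const. Qed.

Lemma holo_id D : holo D (fun z => z).
Proof. intros z _. eexists. apply dC_id. Qed.

Lemma holo_div D f g : (forall z, D z -> g z <> RtoC 0) ->
  holo D f -> holo D g -> holo D (fun z => f z / g z)%C.
Proof.
  intros N Hf Hg z Hz. destruct (Hf z Hz) as [a Ha], (Hg z Hz) as [b Hb].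
  eexists. apply dC_div; eauto.
Qed.

Lemma holo_comp D E f g : (forall z, D z -> E (g z)) ->
  holo D g -> holo E f -> holo D (fun z => f (g z)).
Proof.
  intros M Hg Hf z Hz. destruct (Hg z Hz) as [b Hb], (Hf (g z) (M z Hz)) as [a Ha].
  eexists. apply dC_comp; eauto.
Qed.

Lemma holo_pow D f n : holo D f -> holo D (fun z => f z ^ n)%C.
Proof.
  intros H. induction n; simpl; [apply holo_const|]. apply holo_mult; auto.
Qed.


(** * Agreement with the filter-based notions of the statement *)

Lemma locally_C_ball (z : C) (P : C -> Prop) :
  @locally C_UniformSpace z P <->
  exists d, 0 < d /\ forall w, Cmod (w - z) < d -> P w.
Proof.
  split.
  - intros [e He]. exists e. split; [apply cond_pos|]. intros w Hw. apply He.
    apply C_NormedModule_mixin_compat1. exact Hw.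
  - intros [d [P0 H]].
    (* Balls of the uniform structure on [C] are squares, hence the factor [sqrt 2] against
       [Cmod]. *)
    assert (S2 : 0 < sqrt 2) by (apply sqrt_lt_R0; lra).
    assert (Q : 0 < d / sqrt 2) by (apply Rdiv_lt_0_compat; auto).
    exists (mkposreal _ Q). intros w Hw. apply H.
    assert (T := C_NormedModule_mixin_compat2 z w (mkposreal _ Q) Hw). simpl in T.
    replace (sqrt 2 * (d / sqrt 2)) with d in T by (field; lra). exact T.
Qed.

Lemma C_open_ball (D : C -> Prop) :
  C_open D <-> forall z, D z -> exists d, 0 < d /\ forall w, Cmod (w - z) < d -> D w.
Proof.
  unfold C_open, open. split; intros H z Hz.
  - apply locally_C_ball. auto.
  - apply locally_C_ball. auto.
Qed.

Lemma C_continuous_cont_at (f : C -> C) z : C_continuous f z <-> cont_at f z.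
Proof.
  unfold C_continuous, continuous. split.
  - intros H e He.
    assert (L : @locally C_UniformSpace (f z) (fun w => Cmod (w - f z) < e)).
    { apply locally_C_ball. exists e. auto. }
    apply H in L. unfold filtermap in L. apply locally_C_ball in L. exact L.
  - intros H P L. apply locally_C_ball in L. destruct L as [d [P0 L]].
    unfold filtermap. apply locally_C_ball. destruct (H d P0) as [d' [P' Q]].
    exists d'. split; auto.
Qed.

Lemma C_is_derive_dC (f : C -> C) z l : C_is_derive f z l <-> dC f z l.
Proof.
  unfold C_is_derive, is_derive, filterdiff. split.
  - intros [_ H] e He. specialize (H z (fun P HP => HP) (mkposreal e He)).
    apply locally_C in H. apply locally_C_ball in H.
    destruct H as [d [P Q]]. exists d. split; auto. intros w Hw. specialize (Q w Hw).
    simpl in Q.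
    change (Cmod (f w - f z - (w - z) * l) <= e * Cmod (w - z)) in Q.
    rewrite (Cmult_comm l). exact Q.
  - intros H. split; [apply is_linear_scal_l|]. intros x Hx e.
    assert (E : z = x) by exact (@is_filter_lim_locally_unique C_AbsRing (AbsRing_NormedModule C_AbsRing) z x Hx). subst x.
    apply locally_C. apply locally_C_ball.
    destruct (H e (cond_pos e)) as [d [P Q]]. exists d. split; auto. intros w Hw.
    specialize (Q w Hw).
    change (Cmod (f w - f z - (w - z) * l) <= e * Cmod (w - z)).
    rewrite (Cmult_comm _ l). exact Q.
Qed.

Lemma holomorphic_on_holo D f : holomorphic_on D f <-> holo D f.
Proof.
  unfold holomorphic_on, holo.
  split; intros H z Hz; destruct (H z Hz) as [l Hl]; exists l; apply C_is_derive_dC; auto.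
Qed.

(** * Integration along segments *)

Definition pt (a b : C) (t : R) : C := (a + RtoC t * (b - a))%C.

Definition cont_seg (f : C -> C) (a b : C) : Prop :=
  forall t, 0 <= t <= 1 -> cont_at f (pt a b t).

(** The integral against [dz], whose velocity [b - a] is constant on the segment. [RInt] has a
    meaningful value only for integrable functions, hence the [cont_seg] hypotheses below. *)
Definition seg (f : C -> C) (a b : C) : C :=
  ((b - a) * RInt (V := C_R_CompleteNormedModule) (fun t => f (pt a b t)) 0 1)%C.

Lemma pt0 a b : pt a b 0 = a. Proof. unfold pt. ring. Qed.
Lemma pt1 a b : pt a b 1 = b. Proof. unfold pt. ring. Qed.

Lemma pt_dist a b s t : Cmod (pt a b s - pt a b t) = Rabs (s - t) * Cmod (b - a).
Proof.
  unfold pt. replace (a + s * (b - a) - (a + t * (b - a)))%C with (RtoC (s - t) * (b - a))%C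
    by (rewrite RtoC_minus; ring).
  rewrite Cmod_mult, Cmod_R. reflexivity.
Qed.

Lemma pt_continuous (f : C -> C) a b t : cont_at f (pt a b t) ->
  @continuous R_UniformSpace C_R_NormedModule (fun s => f (pt a b s)) t.
Proof.
  intros H P L. apply (locally_C_ball (f (pt a b t)) P) in L. destruct L as [e [He L]].
  destruct (H e He) as [d [Hd Q]].
  (* Adding [1] keeps the divisor positive when [a = b]. *)
  assert (M : 0 < Cmod (b - a) + 1) by (assert (T := Cmod_ge_0 (b - a)); lra).
  assert (K : 0 < d / (Cmod (b - a) + 1)) by (apply Rdiv_lt_0_compat; auto).
  exists (mkposreal _ K). intros s Hs. apply L. apply Q. rewrite pt_dist.
  assert (Hs' : Rabs (s - t) < d / (Cmod (b - a) + 1)) by exact Hs.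
  assert (T := Cmod_ge_0 (b - a)). assert (T' := Rabs_pos (s - t)).
  apply Rle_lt_trans with (Rabs (s - t) * (Cmod (b - a) + 1)); [nra|].
  apply Rmult_lt_reg_r with (/ (Cmod (b - a) + 1)); [apply Rinv_0_lt_compat; auto|].
  rewrite Rmult_assoc, Rinv_r by lra. rewrite Rmult_1_r. exact Hs'.
Qed.

Lemma seg_is_RInt (f : C -> C) a b : cont_seg f a b ->
  forall s t, 0 <= s <= 1 -> 0 <= t <= 1 ->
  @is_RInt C_R_NormedModule (fun t => f (pt a b t)) s t
    (RInt (V := C_R_CompleteNormedModule) (fun t => f (pt a b t)) s t).
Proof.
  intros H s t Hs Ht.
  apply (@RInt_correct C_R_CompleteNormedModule).
  apply (@ex_RInt_continuous C_R_CompleteNormedModule).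
  intros z Hz. apply pt_continuous, H.
  assert (A := Rmin_glb s t 0). assert (B := Rmax_lub s t 1). lra.
Qed.

Lemma seg_unique (f : C -> C) a b (l : C) :
  @is_RInt C_R_NormedModule (fun t => f (pt a b t)) 0 1 l -> seg f a b = ((b - a) * l)%C.
Proof.
  intros H. unfold seg. f_equal.
  exact (@is_RInt_unique C_R_CompleteNormedModule _ 0 1 l H).
Qed.

(** The integral lives in a real module, where a complex factor is not a scalar; the product is
    therefore split into its real and imaginary parts. *)
Lemma is_RInt_Cscal (k : C) (g : R -> C) a b (l : C) :
  @is_RInt C_R_NormedModule g a b l ->
  @is_RInt C_R_NormedModule (fun t => k * g t)%C a b (k * l)%C.
Proof.
  intros H.
  assert (H1 := @is_RInt_fct_extend_fst R_NormedModule R_NormedModule g a b l H).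
  assert (H2 := @is_RInt_fct_extend_snd R_NormedModule R_NormedModule g a b l H).
  apply (@is_RInt_fct_extend_pair R_NormedModule R_NormedModule).
  - apply (@is_RInt_minus R_NormedModule (fun t => fst k * fst (g t)) (fun t => snd k * snd (g t))).
    + apply (@is_RInt_scal R_NormedModule (fun t => fst (g t))); auto.
    + apply (@is_RInt_scal R_NormedModule (fun t => snd (g t))); auto.
  - apply (@is_RInt_plus R_NormedModule (fun t => fst k * snd (g t)) (fun t => snd k * fst (g t))).
    + apply (@is_RInt_scal R_NormedModule (fun t => snd (g t))); auto.
    + apply (@is_RInt_scal R_NormedModule (fun t => fst (g t))); auto.
Qed.

Lemma seg_plus f g a b : cont_seg f a b -> cont_seg g a b ->
  seg (fun z => f z + g z)%C a b = (seg f a b + seg g a b)%C.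
Proof.
  intros Hf Hg.
  rewrite (seg_unique (fun z => f z + g z)%C a b
    (RInt (V := C_R_CompleteNormedModule) (fun t => f (pt a b t)) 0 1 +
     RInt (V := C_R_CompleteNormedModule) (fun t => g (pt a b t)) 0 1)%C).
  - unfold seg. ring.
  - apply (@is_RInt_plus C_R_NormedModule (fun t => f (pt a b t)) (fun t => g (pt a b t)));
      apply seg_is_RInt; auto; lra.
Qed.

Lemma seg_scal k f a b : cont_seg f a b ->
  seg (fun z => k * f z)%C a b = (k * seg f a b)%C.
Proof.
  intros Hf.
  rewrite (seg_unique (fun z => k * f z)%C a b
    (k * RInt (V := C_R_CompleteNormedModule) (fun t => f (pt a b t)) 0 1)%C).
  - unfold seg. ring.
  - apply is_RInt_Cscal. apply seg_is_RInt; auto; lra.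
Qed.

Lemma seg_ext f g a b : (forall t, 0 <= t <= 1 -> f (pt a b t) = g (pt a b t)) ->
  seg f a b = seg g a b.
Proof.
  intros E. unfold seg. f_equal. apply (@RInt_ext C_R_CompleteNormedModule).
  intros t Ht. rewrite Rmin_left, Rmax_right in Ht by lra. apply E; lra.
Qed.

Lemma seg_minus f g a b : cont_seg f a b -> cont_seg g a b ->
  seg (fun z => f z - g z)%C a b = (seg f a b - seg g a b)%C.
Proof.
  intros Hf Hg.
  rewrite (seg_ext _ (fun z => f z + RtoC (-1) * g z)%C) by (intros; ring).
  rewrite seg_plus, seg_scal; auto. { ring. }
  intros t Ht. apply cont_mult; [apply cont_const|]. auto.
Qed.

Lemma seg_bound f a b M : cont_seg f a b ->
  (forall t, 0 <= t <= 1 -> Cmod (f (pt a b t)) <= M) ->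
  Cmod (seg f a b) <= M * Cmod (b - a).
Proof.
  intros Hf HM. unfold seg. rewrite Cmod_mult.
  rewrite Rmult_comm. apply Rmult_le_compat_r; [apply Cmod_ge_0|].
  set (I := RInt _ _ _).
  assert (H := @norm_RInt_le_const C_R_NormedModule (fun t => f (pt a b t)) 0 1 I M).
  rewrite Cmod_norm.
  replace M with ((1 - 0) * M) by ring. apply H; [lra| |].
  - intros t Ht. rewrite <- Cmod_norm. auto.
  - apply seg_is_RInt; auto; lra.
Qed.

Lemma seg_FTC (F f : C -> C) a b :
  (forall t, 0 <= t <= 1 -> dC F (pt a b t) (f (pt a b t))) -> cont_seg f a b ->
  seg f a b = (F b - F a)%C.
Proof.
  intros HF Hf.
  assert (D : forall t, 0 <= t <= 1 ->
    @is_derive R_AbsRing C_R_NormedModule (fun s => F (pt a b s)) t ((b - a) * f (pt a b t))%C).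
  { intros t Ht. split; [apply is_linear_scal_l|]. intros x Hx e.
    assert (E : t = x) by exact (@is_filter_lim_locally_unique R_AbsRing R_NormedModule t x Hx).
    subst x. clear Hx.
    assert (M : 0 < Cmod (b - a) + 1) by (assert (T := Cmod_ge_0 (b - a)); lra).
    assert (K : 0 < e / (Cmod (b - a) + 1)) by (apply Rdiv_lt_0_compat; [apply cond_pos|auto]).
    destruct (HF t Ht _ K) as [d [Hd Q]].
    assert (K' : 0 < d / (Cmod (b - a) + 1)) by (apply Rdiv_lt_0_compat; auto).
    exists (mkposreal _ K'). intros s Hs.
    assert (Hs' : Rabs (s - t) < d / (Cmod (b - a) + 1)) by exact Hs. clear Hs.
    assert (T := Cmod_ge_0 (b - a)). assert (T' := Rabs_pos (s - t)).
    specialize (Q (pt a b s)). rewrite pt_dist in Q.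
    assert (Y : Rabs (s - t) * (Cmod (b - a) + 1) < d).
    { apply Rmult_lt_reg_r with (/ (Cmod (b - a) + 1)); [apply Rinv_0_lt_compat; auto|].
      rewrite Rmult_assoc, Rinv_r by lra. rewrite Rmult_1_r. exact Hs'. }
    specialize (Q ltac:(nra)).
    change (@norm R_AbsRing C_R_NormedModule (@minus C_R_NormedModule
      (@minus C_R_NormedModule (F (pt a b s)) (F (pt a b t)))
      (@scal R_AbsRing C_R_NormedModule (s - t) ((b - a) * f (pt a b t))%C)) <= e * Rabs (s - t)).
    rewrite <- Cmod_norm.
    replace (@minus C_R_NormedModule (@minus C_R_NormedModule (F (pt a b s)) (F (pt a b t)))
      (@scal R_AbsRing C_R_NormedModule (s - t) ((b - a) * f (pt a b t))%C))
    with (F (pt a b s) - F (pt a b t) - f (pt a b t) * (pt a b s - pt a b t))%C.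
    - eapply Rle_trans; [exact Q|].
      replace (e / (Cmod (b - a) + 1) * (Rabs (s - t) * Cmod (b - a)))
        with (e * Rabs (s - t) * (Cmod (b - a) / (Cmod (b - a) + 1))) by (field; lra).
      rewrite <- (Rmult_1_r (e * Rabs (s - t))) at 2. apply Rmult_le_compat_l.
      + apply Rmult_le_pos; auto. left; apply cond_pos.
      + apply Rmult_le_reg_r with (Cmod (b - a) + 1); auto.
        unfold Rdiv. rewrite Rmult_assoc, Rinv_l by lra. lra.
    - unfold pt at 4 5. 
      transitivity (F (pt a b s) - F (pt a b t) - RtoC (s - t) * ((b - a) * f (pt a b t)))%C.
      { rewrite RtoC_minus. ring. }
      set (u := ((b - a) * f (pt a b t))%C).
      unfold minus, plus, opp, scal; simpl. unfold prod_plus, prod_opp, prod_scal; simpl.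
      unfold plus, opp, scal; simpl. unfold mult; simpl.
      unfold Cminus, Cplus, Copp, Cmult; simpl. f_equal; ring. }
  assert (I := @is_RInt_derive C_R_CompleteNormedModule (fun s => F (pt a b s))
    (fun t => (b - a) * f (pt a b t))%C 0 1).
  rewrite Rmin_left, Rmax_right in I by lra.
  specialize (I D).
  assert (I2 : @is_RInt C_R_NormedModule (fun t => (b - a) * f (pt a b t))%C 0 1 (seg f a b)).
  { apply is_RInt_Cscal. apply seg_is_RInt; auto; lra. }
  apply (@is_RInt_unique C_R_CompleteNormedModule) in I2.
  rewrite <- I2.
  rewrite (@is_RInt_unique C_R_CompleteNormedModule _ _ _ _ (I ltac:(
    intros t Ht; apply (pt_continuous (fun z => (b - a) * f z)%C);
    apply cont_mult; [apply cont_const| auto]))).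
  rewrite pt0, pt1. reflexivity.
Qed.

Lemma scal_C_R (s : R) (z : C) : @scal R_AbsRing C_R_NormedModule s z = (RtoC s * z)%C.
Proof.
  unfold scal; simpl. unfold prod_scal; simpl. unfold scal; simpl. unfold mult; simpl.
  unfold Cmult; simpl. f_equal; ring.
Qed.

Lemma seg_split f a b s : 0 <= s <= 1 -> cont_seg f a b ->
  seg f a b = (seg f a (pt a b s) + seg f (pt a b s) b)%C.
Proof.
  intros Hs Hf.
  set (J := fun u v => RInt (V := C_R_CompleteNormedModule) (fun t => f (pt a b t)) u v : C).
  assert (HJ : forall u v, 0 <= u <= 1 -> 0 <= v <= 1 ->
    @is_RInt C_R_NormedModule (fun t => f (pt a b t)) u v (J u v)).
  { intros. apply seg_is_RInt; auto. }
  assert (E1 : seg f a (pt a b s) = ((b - a) * J 0 s)%C).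
  { assert (K := @is_RInt_comp_lin C_R_NormedModule (fun t => f (pt a b t)) s 0 0 1 (J 0 s)).
    replace (s * 0 + 0) with 0 in K by ring. replace (s * 1 + 0) with s in K by ring.
    specialize (K (HJ 0 s ltac:(lra) Hs)).
    unfold seg.
    replace (pt a b s - a)%C with ((b - a) * RtoC s)%C by (unfold pt; ring).
    rewrite <- Cmult_assoc. f_equal.
    rewrite <- (@is_RInt_unique C_R_CompleteNormedModule _ _ _ _ K).
    symmetry. apply (@is_RInt_unique C_R_CompleteNormedModule).
    apply (@is_RInt_ext C_R_NormedModule (fun t => RtoC s * f (pt a (pt a b s) t))%C).
    - intros t _. rewrite scal_C_R. f_equal. f_equal. unfold pt.
      rewrite Rplus_0_r, RtoC_mult. ring.
    - apply is_RInt_Cscal. apply seg_is_RInt; try lra.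
      intros t Ht. replace (pt a (pt a b s) t) with (pt a b (s * t)); [apply Hf; nra|].
      unfold pt. rewrite RtoC_mult. ring. }
  assert (E2 : seg f (pt a b s) b = ((b - a) * J s 1)%C).
  { assert (K := @is_RInt_comp_lin C_R_NormedModule (fun t => f (pt a b t)) (1 - s) s 0 1 (J s 1)).
    replace ((1 - s) * 0 + s) with s in K by ring. replace ((1 - s) * 1 + s) with 1 in K by ring.
    specialize (K (HJ s 1 Hs ltac:(lra))).
    unfold seg.
    replace (b - pt a b s)%C with ((b - a) * RtoC (1 - s))%C by (unfold pt; rewrite RtoC_minus; ring).
    rewrite <- Cmult_assoc. f_equal.
    rewrite <- (@is_RInt_unique C_R_CompleteNormedModule _ _ _ _ K).
    symmetry. apply (@is_RInt_unique C_R_CompleteNormedModule).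
    apply (@is_RInt_ext C_R_NormedModule (fun t => RtoC (1 - s) * f (pt (pt a b s) b t))%C).
    - intros t _. rewrite scal_C_R. f_equal. f_equal. unfold pt.
      rewrite RtoC_plus, RtoC_mult, RtoC_minus. ring.
    - apply is_RInt_Cscal. apply seg_is_RInt; try lra.
      intros t Ht. replace (pt (pt a b s) b t) with (pt a b ((1 - s) * t + s)); [apply Hf; nra|].
      unfold pt. rewrite RtoC_plus, RtoC_mult, RtoC_minus. ring. }
  rewrite E1, E2. rewrite <- Cmult_plus_distr_l. unfold seg. f_equal.
  assert (Ch := @is_RInt_Chasles C_R_NormedModule _ 0 s 1 _ _ (HJ 0 s ltac:(lra) Hs) (HJ s 1 Hs ltac:(lra))).
  exact (@is_RInt_unique C_R_CompleteNormedModule _ _ _ _ Ch).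
Qed.

Lemma pt_rev a b t : pt b a t = pt a b (1 - t).
Proof. unfold pt. rewrite RtoC_minus. ring. Qed.

Lemma seg_rev f a b : cont_seg f a b -> seg f b a = (- seg f a b)%C.
Proof.
  intros Hf.
  assert (H0 := seg_is_RInt f a b Hf 1 0 ltac:(lra) ltac:(lra)).
  assert (K := @is_RInt_comp_lin C_R_NormedModule (fun t => f (pt a b t)) (-1) 1 0 1).
  replace (-1 * 0 + 1) with 1 in K by ring. replace (-1 * 1 + 1) with 0 in K by ring.
  assert (H1 := @is_RInt_swap C_R_NormedModule _ _ _ _ (seg_is_RInt f a b Hf 0 1 ltac:(lra) ltac:(lra))).
  specialize (K _ H1).
  assert (H2 : @is_RInt C_R_NormedModule (fun t => f (pt b a t)) 0 1
    (RtoC (-1) * opp (RInt (V := C_R_CompleteNormedModule) (fun t => f (pt a b t)) 0 1))%C).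
  { apply (@is_RInt_ext C_R_NormedModule
      (fun t => RtoC (-1) * (@scal R_AbsRing C_R_NormedModule (-1) (f (pt a b (-1 * t + 1)))))%C).
    - intros t _. rewrite scal_C_R, (pt_rev a b t). replace (-1 * t + 1) with (1 - t) by ring.
      rewrite Cmult_assoc, <- RtoC_mult. replace (-1 * -1) with 1 by ring. apply Cmult_1_l.
    - apply is_RInt_Cscal. exact K. }
  rewrite (seg_unique _ _ _ _ H2). unfold seg.
  set (I := RInt _ _ _). change (opp I) with (- I)%C. ring.
Qed.

(** * Nested sequences and Goursat's theorem *)

Lemma dependent_choice {A : Type} (P : A -> Prop) (Q : A -> A -> Prop) (x0 : A) :
  P x0 -> (forall x, P x -> exists y, P y /\ Q x y) ->
  exists s : nat -> A, s O = x0 /\ forall n, P (s n) /\ Q (s n) (s (S n)).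
Proof.
  intros H0 H.
  assert (H' : forall x : {x | P x}, {y : {y | P y} | Q (proj1_sig x) (proj1_sig y)}).
  { intros [x Hx]. apply constructive_indefinite_description.
    destruct (H x Hx) as [y [Py Qy]]. exists (exist _ y Py). exact Qy. }
  set (s := fix s n : {x | P x} :=
    match n with O => exist _ x0 H0 | S m => proj1_sig (H' (s m)) end).
  exists (fun n => proj1_sig (s n)). split; [reflexivity|].
  intros n. split; [exact (proj2_sig (s n))|]. simpl. exact (proj2_sig (H' (s n))).
Qed.

(** Completeness of the plane for geometrically small increments, with the explicit tail that
    locates the limit relative to the nested triangles. *)
Lemma geometric_limit (u : nat -> C) (L : R) :
  (forall n, Cmod (u (S n) - u n) <= L / 2 ^ n) ->
  exists l, forall n, Cmod (u n - l) <= 2 * L / 2 ^ n.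
Proof.
  intros H.
  assert (P2 : forall n, 0 < 2 ^ n) by (intros; apply pow_lt; lra).
  assert (L0 : 0 <= L).
  { assert (T := H O). assert (T' := Cmod_ge_0 (u 1%nat - u O)). simpl in T. lra. }
  (* Keeping the exact telescoped remainder is what lets the induction on [k] close. *)
  assert (A : forall n k, Cmod (u (n + k)%nat - u n) <= 2 * L / 2 ^ n - 2 * L / 2 ^ (n + k)).
  { intros n k. induction k.
    - rewrite Nat.add_0_r, Cmod_self. lra.
    - rewrite Nat.add_succ_r. eapply Rle_trans; [apply (Cmod_triangle3 _ (u (n + k)%nat))|].
      specialize (H (n + k)%nat). simpl pow.
      replace (2 * L / (2 * 2 ^ (n + k))) with (L / 2 ^ (n + k))
        by (field; apply Rgt_not_eq, P2).
      replace (2 * L / 2 ^ (n + k)) with (2 * (L / 2 ^ (n + k))) in IHk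
        by (field; apply Rgt_not_eq, P2). lra. }
  assert (B : forall n m, (n <= m)%nat -> Cmod (u m - u n) <= 2 * L / 2 ^ n).
  { intros n m Hm. replace m with (n + (m - n))%nat by lia.
    assert (T := A n (m - n)%nat).
    assert (0 <= 2 * L / 2 ^ (n + (m - n))).
    { apply Rmult_le_pos; [lra|]. left. apply Rinv_0_lt_compat, P2. } lra. }
  assert (S0 : forall e, 0 < e -> exists N, forall n, (N <= n)%nat -> 2 * L / 2 ^ n < e).
  { intros e He.
    destruct (pow_lt_1_zero (/2) ltac:(rewrite Rabs_pos_eq; lra) (e / (2 * L + 1)))
      as [N HN]; [apply Rdiv_lt_0_compat; lra|].
    exists N. intros n Hn. specialize (HN n Hn).
    rewrite Rabs_pos_eq in HN by (apply pow_le; lra). rewrite pow_inv in HN.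
    assert (I := Rinv_0_lt_compat _ (P2 n)).
    apply Rle_lt_trans with ((2 * L + 1) * / 2 ^ n); [unfold Rdiv; nra|].
    apply Rmult_lt_reg_l with (/ (2 * L + 1)); [apply Rinv_0_lt_compat; lra|].
    rewrite <- Rmult_assoc, Rinv_l by lra. unfold Rdiv in HN. lra. }
  assert (CV : forall p : C -> R, (forall x y, Rabs (p x - p y) <= Cmod (x - y)) ->
    exists l, Un_cv (fun n => p (u n)) l).
  { intros p Hp. cut (Cauchy_crit (fun n => p (u n))).
    { intros Cc. destruct (Rcomplete.R_complete _ Cc) as [l Hl]. exists l; exact Hl. }
    intros e He. destruct (S0 e He) as [N HN]. exists N. intros n m Hn Hm.
    unfold Rdist. eapply Rle_lt_trans; [apply Hp|].
    destruct (Nat.le_ge_cases n m) as [G|G].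
    - rewrite Cmod_sub_comm. eapply Rle_lt_trans; [apply B; exact G|]. auto.
    - eapply Rle_lt_trans; [apply B; exact G|]. auto. }
  destruct (CV fst) as [x Hx].
  { intros z w. assert (T := re_le_Cmod (z - w)). exact T. }
  destruct (CV snd) as [y Hy].
  { intros z w. assert (T := Rmax_Cmod (z - w)%C). eapply Rle_trans; [|exact T]. apply Rmax_r. }
  exists (x, y). intros n. apply le_epsilon. intros e He.
  destruct (Hx (e/2)) as [N1 H1]; [lra|]. destruct (Hy (e/2)) as [N2 H2]; [lra|].
  set (m := (n + N1 + N2)%nat).
  specialize (H1 m ltac:(unfold m; lia)). specialize (H2 m ltac:(unfold m; lia)).
  unfold Rdist in *.
  assert (E : Cmod (u m - (x, y)) <= e).
  { assert (T := Cmod_2Rmax (u m - (x, y))). simpl in T.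
    assert (M : Rmax (Rabs (fst (u m) + - x)) (Rabs (snd (u m) + - y)) <= e/2).
    { apply Rmax_lub; left; assumption. }
    assert (Q : sqrt 2 <= 2).
    { rewrite <- (sqrt_pow2 2) at 2 by lra. apply sqrt_le_1; lra. }
    assert (Q0 := sqrt_pos 2).
    assert (0 <= Rmax (Rabs (fst (u m) + - x)) (Rabs (snd (u m) + - y))).
    { eapply Rle_trans; [apply Rabs_pos|apply Rmax_l]. }
    nra. }
  assert (T := Cmod_triangle3 (u n) (u m) (x, y)).
  rewrite (Cmod_sub_comm (u n) (u m)) in T.
  assert (T' := B n m ltac:(unfold m; lia)). lra.
Qed.

Lemma RtoC_neq0 (x : R) : x <> 0 -> RtoC x <> RtoC 0.
Proof. intros H E. apply H. exact (f_equal fst E). Qed.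

Definition convex (K : C -> Prop) : Prop :=
  forall a b t, K a -> K b -> 0 <= t <= 1 -> K (pt a b t).

Definition closed_set (K : C -> Prop) : Prop :=
  forall z, (forall e, 0 < e -> exists w, K w /\ Cmod (w - z) < e) -> K z.

Definition tri (f : C -> C) (a b c : C) : C := (seg f a b + seg f b c + seg f c a)%C.

Definition perim (a b c : C) : R := Cmod (b - a) + Cmod (c - b) + Cmod (a - c).

Lemma holo_cont_seg K f a b : convex K -> holo K f -> K a -> K b -> cont_seg f a b.
Proof. intros HK Hf Ha Hb t Ht. eapply holo_cont; eauto. Qed.

Lemma pt_mid_l a b : (pt a b (1/2) - a)%C = (RtoC (1/2) * (b - a))%C.
Proof. unfold pt. ring. Qed.

Lemma pt_mid_r a b : (b - pt a b (1/2))%C = (RtoC (1/2) * (b - a))%C.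
Proof.
  unfold pt. replace (b - (a + RtoC (1/2) * (b - a)))%C with ((RtoC 1 - RtoC (1/2)) * (b - a))%C by ring.
  rewrite <- RtoC_minus. do 2 f_equal. lra.
Qed.

Lemma pt_mid_mid a b c : (pt b c (1/2) - pt a b (1/2))%C = (RtoC (1/2) * (c - a))%C.
Proof.
  assert (E : RtoC 1 = (RtoC (1/2) + RtoC (1/2))%C) by (rewrite <- RtoC_plus; f_equal; lra).
  unfold pt.
  replace (b + RtoC (1/2) * (c - b) - (a + RtoC (1/2) * (b - a)))%C
    with (RtoC 1 * (b - a) + RtoC (1/2) * (c - b) - RtoC (1/2) * (b - a))%C by ring.
  rewrite E. ring.
Qed.

Lemma Cmod_half z : Cmod (RtoC (1/2) * z) = Cmod z / 2.
Proof. rewrite Cmod_mult, Cmod_R, Rabs_pos_eq; lra. Qed.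

(** Subdivision at the midpoints: the inner edges cancel in pairs, so one of the four triangles
    carries at least a quarter of the integral. The bound on [a' - a] makes the first vertices of
    iterated triangles a Cauchy sequence. *)
Lemma tri_quarter (K : C -> Prop) f a b c : convex K -> holo K f -> K a -> K b -> K c ->
  exists a' b' c', (K a' /\ K b' /\ K c') /\
    Cmod (tri f a b c) <= 4 * Cmod (tri f a' b' c') /\
    perim a' b' c' = perim a b c / 2 /\ Cmod (a' - a) <= perim a b c.
Proof.
  intros HK Hf Ha Hb Hc.
  assert (Hh : 0 <= 1/2 <= 1) by lra.
  set (m := pt a b (1/2)). set (n := pt b c (1/2)). set (p := pt c a (1/2)).
  assert (Km : K m) by (apply HK; auto). assert (Kn : K n) by (apply HK; auto).
  assert (Kp : K p) by (apply HK; auto).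
  assert (CS : forall x y, K x -> K y -> cont_seg f x y) by (intros; eapply holo_cont_seg; eauto).
  assert (E : tri f a b c =
    (tri f a m p + tri f m b n + tri f p n c + tri f m n p)%C).
  { unfold tri. rewrite (seg_split f a b (1/2)), (seg_split f b c (1/2)), (seg_split f c a (1/2)) by auto.
    fold m n p. rewrite (seg_rev f m p), (seg_rev f m n), (seg_rev f n p) by auto. ring. }
  assert (Q0 := Cmod_ge_0 (b - a)). assert (Q1 := Cmod_ge_0 (c - b)). assert (Q2 := Cmod_ge_0 (a - c)).
  assert (D1 : Cmod (m - a) = Cmod (b - a) / 2) by (unfold m; rewrite pt_mid_l, Cmod_half; auto).
  assert (D1' : Cmod (b - m) = Cmod (b - a) / 2) by (unfold m; rewrite pt_mid_r, Cmod_half; auto).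
  assert (D2 : Cmod (n - b) = Cmod (c - b) / 2) by (unfold n; rewrite pt_mid_l, Cmod_half; auto).
  assert (D2' : Cmod (c - n) = Cmod (c - b) / 2) by (unfold n; rewrite pt_mid_r, Cmod_half; auto).
  assert (D3 : Cmod (p - c) = Cmod (a - c) / 2) by (unfold p; rewrite pt_mid_l, Cmod_half; auto).
  assert (D3' : Cmod (a - p) = Cmod (a - c) / 2) by (unfold p; rewrite pt_mid_r, Cmod_half; auto).
  assert (D4 : Cmod (n - m) = Cmod (a - c) / 2).
  { unfold n, m. rewrite pt_mid_mid, Cmod_half, Cmod_sub_comm. auto. }
  assert (D5 : Cmod (p - n) = Cmod (b - a) / 2).
  { unfold n, p. rewrite pt_mid_mid, Cmod_half, Cmod_sub_comm. auto. }
  assert (D6 : Cmod (m - p) = Cmod (c - b) / 2).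
  { unfold m, p. rewrite pt_mid_mid, Cmod_half, Cmod_sub_comm. auto. }
  assert (T : Cmod (tri f a b c) <= Cmod (tri f a m p) + Cmod (tri f m b n) + Cmod (tri f p n c) + Cmod (tri f m n p)).
  { rewrite E. eapply Rle_trans; [apply Cmod_triangle|]. apply Rplus_le_compat_r.
    eapply Rle_trans; [apply Cmod_triangle|]. apply Rplus_le_compat_r. apply Cmod_triangle. }
  set (I := Cmod (tri f a b c)) in *.
  destruct (Rle_lt_dec I (4 * Cmod (tri f a m p))) as [G1|G1].
  { exists a, m, p. unfold perim. rewrite Cmod_self. repeat split; auto; try lra.
    rewrite (Cmod_sub_comm p m). lra. }
  destruct (Rle_lt_dec I (4 * Cmod (tri f m b n))) as [G2|G2].
  { exists m, b, n. unfold perim. repeat split; auto; try lra.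
    rewrite (Cmod_sub_comm m n). lra. }
  destruct (Rle_lt_dec I (4 * Cmod (tri f p n c))) as [G3|G3].
  { exists p, n, c. unfold perim. rewrite (Cmod_sub_comm p a), (Cmod_sub_comm n p). repeat split; auto; lra. }
  exists m, n, p. unfold perim. repeat split; auto; lra.
Qed.

Lemma seg_affine (k l a b : C) :
  seg (fun w => k + l * w)%C a b = (k * (b - a) + l * (b * b - a * a) / RtoC 2)%C.
Proof.
  assert (N2 : RtoC 2 <> RtoC 0) by (apply RtoC_neq0; lra).
  rewrite (seg_FTC (fun w => k * w + l / RtoC 2 * (w * w))%C).
  - field; auto.
  - intros t _. set (z := pt a b t).
    replace (k + l * z)%C with (k * RtoC 1 + l / RtoC 2 * (RtoC 1 * z + z * RtoC 1))%C
      by (field; auto).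
    apply dC_plus; apply dC_scal; [apply dC_id|]. apply (dC_mult (fun w => w) (fun w => w)); apply dC_id.
  - intros t _. apply cont_plus; [apply cont_const|].
    apply cont_mult; [apply cont_const|apply cont_id].
Qed.

(** The affine part of [f] at [z] has a primitive, so its integral around the triangle vanishes and
    only the remainder of the differentiation contributes. *)
Lemma tri_small (f : C -> C) z l e r a b c (K : C -> Prop) :
  convex K -> holo K f -> K a -> K b -> K c -> 0 <= e ->
  (forall w, Cmod (w - z) <= r -> Cmod (f w - f z - l * (w - z)) <= e * Cmod (w - z)) ->
  Cmod (a - z) + perim a b c <= r -> Cmod (tri f a b c) <= e * r * perim a b c.
Proof.
  intros HK Hf Ha Hb Hc He H Hr.
  set (g := fun w => (f w - (f z - l * z + l * w))%C).
  assert (Ck : forall x y, cont_seg (fun w => f z - l * z + l * w)%C x y).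
  { intros x y t _. apply cont_plus; [apply cont_const|].
    apply cont_mult; [apply cont_const|apply cont_id]. }
  assert (E : forall x y, K x -> K y -> seg f x y =
    (seg g x y + ((f z - l * z) * (y - x) + l * (y * y - x * x) / RtoC 2))%C).
  { intros x y Hx Hy. unfold g. rewrite seg_minus; auto.
    - rewrite seg_affine. ring.
    - eapply holo_cont_seg; eauto. }
  assert (ET : tri f a b c = (seg g a b + seg g b c + seg g c a)%C).
  { unfold tri. rewrite !E by auto. assert (N2 : RtoC 2 <> RtoC 0) by (apply RtoC_neq0; lra). field; auto. }
  assert (Q0 := Cmod_ge_0 (b - a)). assert (Q1 := Cmod_ge_0 (c - b)). assert (Q2 := Cmod_ge_0 (a - c)).
  assert (Bd : forall x y, K x -> K y -> Cmod (x - z) + Cmod (y - x) <= r ->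
    Cmod (seg g x y) <= e * r * Cmod (y - x)).
  { intros x y Hx Hy Hxy. apply seg_bound.
    - intros t Ht. unfold g. apply cont_minus; [|apply (Ck x y t Ht)].
      eapply holo_cont_seg; eauto.
    - intros t Ht. unfold g. set (w := pt x y t).
      replace (f w - (f z - l * z + l * w))%C with (f w - f z - l * (w - z))%C by ring.
      assert (W : Cmod (w - z) <= r).
      { assert (T := Cmod_triangle3 w x z).
        assert (T' := pt_dist x y t 0). rewrite pt0, Rminus_0_r, Rabs_pos_eq in T' by lra.
        fold w in T'. assert (Q := Cmod_ge_0 (y - x)). nra. }
      eapply Rle_trans; [apply H; exact W|]. apply Rmult_le_compat_l; auto. }
  unfold perim in *.
  assert (B1 := Bd a b Ha Hb ltac:(lra)).
  assert (Tb := Cmod_triangle3 b a z). assert (B2 := Bd b c Hb Hc ltac:(lra)).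
  assert (Tc := Cmod_triangle3 c a z). rewrite (Cmod_sub_comm c a) in Tc.
  assert (Q3 := Cmod_triangle3 a b c). rewrite (Cmod_sub_comm a b), (Cmod_sub_comm b c) in Q3.
  assert (Tc' := Cmod_triangle3 c b z).
  assert (B3 : Cmod (seg g c a) <= e * r * Cmod (a - c)).
  { rewrite (seg_rev g a c).
    - rewrite Cmod_opp, (Cmod_sub_comm a c). apply Bd; auto. rewrite (Cmod_sub_comm c a). lra.
    - intros t Ht. unfold g. apply cont_minus; [|apply (Ck a c t Ht)].
      eapply holo_cont_seg; eauto. }
  rewrite ET. eapply Rle_trans; [apply Cmod_triangle|].
  assert (T := Cmod_triangle (seg g a b) (seg g b c)). lra.
Qed.

Lemma goursat (K : C -> Prop) f a b c : convex K -> closed_set K -> holo K f ->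
  K a -> K b -> K c -> tri f a b c = RtoC 0.
Proof.
  intros HK Hcl Hf Ha Hb Hc.
  set (L := perim a b c).
  assert (HL : 0 <= L).
  { unfold L, perim. assert (Q0 := Cmod_ge_0 (b - a)). assert (Q1 := Cmod_ge_0 (c - b)).
    assert (Q2 := Cmod_ge_0 (a - c)). lra. }
  destruct (dependent_choice
    (fun t : C * C * C => K (fst (fst t)) /\ K (snd (fst t)) /\ K (snd t))
    (fun t t' => Cmod (tri f (fst (fst t)) (snd (fst t)) (snd t)) <=
        4 * Cmod (tri f (fst (fst t')) (snd (fst t')) (snd t')) /\
      perim (fst (fst t')) (snd (fst t')) (snd t') = perim (fst (fst t)) (snd (fst t)) (snd t) / 2 /\
      Cmod (fst (fst t') - fst (fst t)) <= perim (fst (fst t)) (snd (fst t)) (snd t))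
    (a, b, c)) as [s [s0 Hs]].
  { simpl. auto. }
  { intros [[x y] z] [Hx [Hy Hz]]. simpl in *.
    destruct (tri_quarter K f x y z HK Hf Hx Hy Hz) as [x' [y' [z' [P Q]]]].
    exists (x', y', z'). simpl. auto. }
  set (A := fun n => fst (fst (s n))). set (B := fun n => snd (fst (s n))). set (D := fun n => snd (s n)).
  assert (P2 : forall n, 0 < 2 ^ n) by (intros; apply pow_lt; lra).
  assert (PL : forall n, perim (A n) (B n) (D n) = L / 2 ^ n).
  { induction n.
    - unfold A, B, D. rewrite s0. simpl. fold L. lra.
    - destruct (Hs n) as [_ [_ [E _]]]. fold (A n) (B n) (D n) (A (S n)) (B (S n)) (D (S n)) in E.
      rewrite E, IHn. simpl. field. apply Rgt_not_eq, P2. }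
  assert (TI : forall n, Cmod (tri f a b c) <= 4 ^ n * Cmod (tri f (A n) (B n) (D n))).
  { induction n.
    - unfold A, B, D. rewrite s0. simpl. lra.
    - destruct (Hs n) as [_ [E _]]. fold (A n) (B n) (D n) (A (S n)) (B (S n)) (D (S n)) in E.
      assert (0 < 4 ^ n) by (apply pow_lt; lra). simpl. nra. }
  destruct (geometric_limit A L) as [z Hz].
  { intros n. destruct (Hs n) as [_ [_ [_ E]]].
    fold (A n) (B n) (D n) (A (S n)) in E. rewrite PL in E. exact E. }
  assert (Kz : K z).
  { apply Hcl. intros e He.
    destruct (pow_lt_1_zero (/2) ltac:(rewrite Rabs_pos_eq; lra) (e / (2 * L + 1))) as [N HN];
      [apply Rdiv_lt_0_compat; lra|].
    exists (A N). split; [exact (proj1 (proj1 (Hs N)))|].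
    specialize (HN N (le_n _)). rewrite Rabs_pos_eq in HN by (apply pow_le; lra).
    rewrite pow_inv in HN. assert (I := Rinv_0_lt_compat _ (P2 N)).
    eapply Rle_lt_trans; [apply Hz|].
    apply Rle_lt_trans with ((2 * L + 1) * / 2 ^ N); [unfold Rdiv; nra|].
    apply Rmult_lt_reg_l with (/ (2 * L + 1)); [apply Rinv_0_lt_compat; lra|].
    rewrite <- Rmult_assoc, Rinv_l by lra. unfold Rdiv in HN. lra. }
  destruct (Hf z Kz) as [l Hl].
  replace (tri f a b c) with (tri f a b c - RtoC 0)%C by ring.
  apply Cmod_small_eq. intros e He. replace (tri f a b c - RtoC 0 - RtoC 0)%C with (tri f a b c) by ring.
  (* The growth [4 ^ N] is cancelled by perimeter [L / 2 ^ N] times radius [3 * L / 2 ^ N]; the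
     constant [3 * L * L] that remains is divided out here. *)
  assert (He' : 0 < e / (3 * L * L + 1)) by (apply Rdiv_lt_0_compat; nra).
  destruct (Hl _ He') as [d [Hd Q]].
  destruct (pow_lt_1_zero (/2) ltac:(rewrite Rabs_pos_eq; lra) (d / (3 * L + 1))) as [N HN];
      [apply Rdiv_lt_0_compat; lra|].
  specialize (HN N (le_n _)). rewrite Rabs_pos_eq in HN by (apply pow_le; lra).
  rewrite pow_inv in HN. assert (I := Rinv_0_lt_compat _ (P2 N)).
  (* The first vertex is within [2 * L / 2 ^ N] of the limit point, and the perimeter adds
     [L / 2 ^ N]. *)
  assert (Hr : 3 * L / 2 ^ N < d).
  { apply Rle_lt_trans with ((3 * L + 1) * / 2 ^ N); [unfold Rdiv; nra|].
    apply Rmult_lt_reg_l with (/ (3 * L + 1)); [apply Rinv_0_lt_compat; lra|].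
    rewrite <- Rmult_assoc, Rinv_l by lra. unfold Rdiv in HN. lra. }
  destruct (Hs N) as [[KA [KB KD]] _]. fold (A N) in KA. fold (B N) in KB. fold (D N) in KD.
  assert (TS := tri_small f z l (e / (3 * L * L + 1)) (3 * L / 2 ^ N) (A N) (B N) (D N) K HK Hf KA KB KD
    ltac:(lra)).
  rewrite PL in TS.
  specialize (TS ltac:(intros w Hw; apply Q; lra)).
  assert (HzN := Hz N).
  specialize (TS ltac:(unfold Rdiv in *; lra)).
  eapply Rle_trans; [apply TI|].
  apply Rle_trans with (4 ^ N * (e / (3 * L * L + 1) * (3 * L / 2 ^ N) * (L / 2 ^ N))).
  { apply Rmult_le_compat_l; auto. apply pow_le; lra. }
  replace (4 ^ N) with (2 ^ N * 2 ^ N) by (rewrite <- Rpow_mult_distr; f_equal; lra).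
  replace (2 ^ N * 2 ^ N * (e / (3 * L * L + 1) * (3 * L / 2 ^ N) * (L / 2 ^ N)))
    with (e * (3 * L * L) / (3 * L * L + 1)) by (field; split; [apply Rgt_not_eq, P2|nra]).
  apply Rmult_le_reg_r with (3 * L * L + 1); [nra|].
  unfold Rdiv. rewrite Rmult_assoc, Rinv_l by nra. nra.
Qed.

(** * Primitives on a disc with one exceptional point *)

Lemma pt_sub a b t c : (pt a b t - c)%C = (RtoC (1 - t) * (a - c) + RtoC t * (b - c))%C.
Proof. unfold pt. rewrite RtoC_minus. ring. Qed.

Lemma Cmod_pt a b t c : 0 <= t <= 1 ->
  Cmod (pt a b t - c) <= (1 - t) * Cmod (a - c) + t * Cmod (b - c).
Proof.
  intros Ht. rewrite pt_sub. eapply Rle_trans; [apply Cmod_triangle|].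
  rewrite !Cmod_mult, !Cmod_R, !Rabs_pos_eq by lra. lra.
Qed.

Lemma ball_convex c r : convex (ball_at c r).
Proof.
  intros a b t Ha Hb Ht. unfold ball_at in *. eapply Rle_lt_trans; [apply Cmod_pt; auto|].
  destruct (Req_dec t 0) as [E|E]; [subst; lra|].
  assert (t * Cmod (b - c) < t * r) by (apply Rmult_lt_compat_l; lra).
  assert ((1 - t) * Cmod (a - c) <= (1 - t) * r) by (apply Rmult_le_compat_l; lra). lra.
Qed.

Definition dot (a b : C) : R := fst a * fst b + snd a * snd b.

Lemma dot_self a : dot a a = Cmod a * Cmod a.
Proof.
  assert (T := Cmod2_alt a). unfold Re, Im in T. unfold dot.
  replace (Cmod a * Cmod a) with (Cmod a ^ 2) by ring. rewrite T. ring.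
Qed.

Lemma dot_le a b : Rabs (dot a b) <= Cmod a * Cmod b.
Proof.
  assert (Ha := Cmod_ge_0 a). assert (Hb := Cmod_ge_0 b).
  rewrite <- (Rabs_pos_eq (Cmod a * Cmod b)) by nra.
  apply Rsqr_le_abs_0. unfold Rsqr.
  replace (Cmod a * Cmod b * (Cmod a * Cmod b)) with (Cmod a * Cmod a * (Cmod b * Cmod b)) by ring.
  rewrite <- !dot_self. unfold dot.
  assert (T := Rle_0_sqr (fst a * snd b - snd a * fst b)). unfold Rsqr in T. lra.
Qed.

Lemma seg_point f a : seg f a a = RtoC 0.
Proof. unfold seg. replace (a - a)%C with (RtoC 0) by ring. ring. Qed.

Section Primitive.
Variables (c z0 : C) (R0 : R) (f : C -> C).
Hypothesis Hz0 : ball_at c R0 z0.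
Hypothesis Hcont : forall z, ball_at c R0 z -> cont_at f z.
Hypothesis Hholo : forall z, ball_at c R0 z -> z <> z0 -> exists l, dC f z l.

Let cs : forall a b, ball_at c R0 a -> ball_at c R0 b -> cont_seg f a b.
Proof. intros a b Ha Hb t Ht. apply Hcont. apply ball_convex; auto. Qed.

(* Away from the exceptional vertex [z0] the cut triangles lie in a closed half-plane
   omitting [z0], where Goursat applies. *)
Lemma tri_cut z w eta : ball_at c R0 z -> ball_at c R0 w -> z <> z0 ->
  Cmod (w - z) <= Cmod (z - z0) / 2 -> 0 < eta < 1 ->
  tri f z0 z w = tri f z0 (pt z0 z eta) (pt z0 w eta).
Proof.
  intros Hz Hw Nz Hzw He.
  set (b := pt z0 z eta). set (d := pt z0 w eta).
  assert (Hb : ball_at c R0 b) by (apply ball_convex; auto; lra).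
  assert (Hd : ball_at c R0 d) by (apply ball_convex; auto; lra).
  set (rho := Rmax (Cmod (z - c)) (Rmax (Cmod (w - c)) (Cmod (z0 - c)))).
  assert (Hrho : rho < R0) by (unfold rho; repeat apply Rmax_lub_lt; auto).
  assert (R1 : Cmod (z - c) <= rho) by (unfold rho; apply Rmax_l).
  assert (R2 : Cmod (w - c) <= rho).
  { unfold rho. eapply Rle_trans; [|apply Rmax_r]. apply Rmax_l. }
  assert (R3 : Cmod (z0 - c) <= rho).
  { unfold rho. eapply Rle_trans; [|apply Rmax_r]. apply Rmax_r. }
  set (v := (z - z0)%C) in *.
  assert (Pv : 0 < Cmod v) by (apply Cmod_sub_neq; auto).
  (* [dot (_ - z0) v] is at least [Cmod v ^ 2 / 2] at [z] and [w], and scales by [eta] at the cut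
     points; so it is at least [kap] at all four corners of the quadrilateral that is cut off. *)
  set (kap := eta * (Cmod v * Cmod v) / 2).
  assert (Pvv : 0 < Cmod v * Cmod v) by nra.
  assert (Hk : 0 < kap) by (unfold kap; nra).
  set (K := fun x => Cmod (x - c) <= rho /\ kap <= dot (x - z0) v).
  assert (Kconv : convex K).
  { intros x y t [Hx1 Hx2] [Hy1 Hy2] Ht. split.
    - eapply Rle_trans; [apply Cmod_pt; auto|]. nra.
    - rewrite pt_sub. unfold dot in *. simpl. unfold Rminus in *.
      set (x1 := fst x + - fst z0) in *. set (x2 := snd x + - snd z0) in *.
      set (y1 := fst y + - fst z0) in *. set (y2 := snd y + - snd z0) in *.
      simpl in Hx2, Hy2. fold x1 x2 in Hx2. fold y1 y2 in Hy2. nra. }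
  assert (Kcl : closed_set K).
  { intros x Hx. split.
    - apply le_epsilon. intros e Pe. destruct (Hx e Pe) as [y [[Hy _] Hxy]].
      assert (T := Cmod_triangle3 x y c). rewrite (Cmod_sub_comm x y) in T. lra.
    - apply le_epsilon. intros e Pe. destruct (Hx (e / Cmod v)) as [y [[_ Hy] Hxy]].
      { apply Rdiv_lt_0_compat; auto. }
      assert (T := dot_le (y - x) v).
      assert (E : dot (y - z0) v = dot (x - z0) v + dot (y - x) v) by (unfold dot; simpl; ring).
      assert (T' := Rle_abs (dot (y - x) v)).
      assert (Cmod (y - x) * Cmod v < e / Cmod v * Cmod v) by (apply Rmult_lt_compat_r; auto).
      unfold Rdiv in H. rewrite Rmult_assoc, Rinv_l in H by lra. lra. }
  assert (Kh : holo K f).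
  { intros x [Hx1 Hx2]. apply Hholo.
    - unfold ball_at. lra.
    - intros E. subst x. unfold dot in Hx2. simpl in Hx2.
      replace (fst z0 + - fst z0) with 0 in Hx2 by ring.
      replace (snd z0 + - snd z0) with 0 in Hx2 by ring. lra. }
  assert (dv : dot v v = Cmod v * Cmod v) by apply dot_self.
  assert (dw : Cmod v * Cmod v / 2 <= dot (w - z0) v).
  { assert (E : dot (w - z0) v = dot v v + dot (w - z) v) by (unfold dot, v; simpl; ring).
    assert (T := dot_le (w - z) v). assert (T' := Rle_abs (- dot (w - z) v)).
    rewrite Rabs_Ropp in T'.
    assert (Cmod (w - z) * Cmod v <= Cmod v / 2 * Cmod v) by (apply Rmult_le_compat_r; lra). lra. }
  assert (Kz : K z).
  { split; auto. fold v. rewrite dv. unfold kap. nra. }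
  assert (Kw : K w). { split; auto. unfold kap. nra. }
  assert (Sc : forall y, (pt z0 y eta - z0)%C = (RtoC eta * (y - z0))%C) by (intros; unfold pt; ring).
  assert (Db : forall y, dot (pt z0 y eta - z0) v = eta * dot (y - z0) v).
  { intros y. rewrite Sc. unfold dot. simpl. ring. }
  assert (Kb : K b).
  { split.
    - eapply Rle_trans; [apply Cmod_pt; lra|]. nra.
    - unfold b. rewrite Db. fold v. rewrite dv. unfold kap. nra. }
  assert (Kd : K d).
  { split.
    - eapply Rle_trans; [apply Cmod_pt; lra|]. nra.
    - unfold d. rewrite Db. unfold kap. nra. }
  assert (G1 := goursat K f b z w Kconv Kcl Kh Kb Kz Kw).
  assert (G2 := goursat K f b w d Kconv Kcl Kh Kb Kw Kd).
  unfold tri in *.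
  rewrite (seg_split f z0 z eta) by (auto; lra).
  rewrite (seg_rev f z0 w) by auto. rewrite (seg_split f z0 w eta) by (auto; lra).
  fold b d. rewrite (seg_rev f z0 d) by auto.
  rewrite (seg_rev f b w) in G1 by auto.
  rewrite (seg_rev f d w), (seg_rev f b d) in G2 by auto.
  set (A := seg f b z) in *. set (B := seg f z w) in *. set (D := seg f b w) in *.
  set (E := seg f d w) in *. set (F := seg f b d) in *.
  transitivity (seg f z0 b + F - seg f z0 d + (A + B + - D) + (D + - E + - F))%C; [ring|].
  rewrite G1, G2. ring.
Qed.

(** After cutting, only a triangle of size [eta] at [z0] remains. Continuity bounds [f] there, so
    the integral is at most a constant times [eta] for every small [eta]. *)
Lemma tri_vertex z w : ball_at c R0 z -> ball_at c R0 w -> z <> z0 ->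
  Cmod (w - z) <= Cmod (z - z0) / 2 -> tri f z0 z w = RtoC 0.
Proof.
  intros Hz Hw Nz Hzw.
  destruct (Hcont z0 Hz0 1 ltac:(lra)) as [d [Pd Hd]].
  set (M := Cmod (f z0) + 1).
  assert (HM : forall x, Cmod (x - z0) < d -> Cmod (f x) <= M).
  { intros x Hx. specialize (Hd x Hx). assert (T := Cmod_rev_triangle (f x) (f z0)). unfold M. lra. }
  assert (PM : 0 < M) by (unfold M; assert (T := Cmod_ge_0 (f z0)); lra).
  set (P := Cmod (z - z0) + Cmod (w - z) + Cmod (w - z0)).
  assert (Pz := Cmod_sub_neq _ _ Nz). assert (Q1 := Cmod_ge_0 (w - z)). assert (Q2 := Cmod_ge_0 (w - z0)).
  assert (PP : 0 < P) by (unfold P; lra).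
  apply Cmod_small_eq. intros e He. replace (tri f z0 z w - 0)%C with (tri f z0 z w) by ring.
  set (eta := Rmin (1/2) (Rmin (d / (2 * P)) (e / (M * P)))).
  assert (E0 : 0 < eta).
  { unfold eta. repeat apply Rmin_pos; try lra; apply Rdiv_lt_0_compat; try lra; nra. }
  assert (E1 : eta <= 1/2) by (unfold eta; apply Rmin_l).
  assert (E2 : eta <= d / (2 * P)).
  { unfold eta. eapply Rle_trans; [apply Rmin_r|apply Rmin_l]. }
  assert (E3 : eta <= e / (M * P)).
  { unfold eta. eapply Rle_trans; [apply Rmin_r|apply Rmin_r]. }
  assert (E2' : eta * P < d).
  { apply Rle_lt_trans with (d / (2 * P) * P); [apply Rmult_le_compat_r; lra|].
    replace (d / (2 * P) * P) with (d / 2) by (field; lra). lra. }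
  assert (E3' : M * (eta * P) <= e).
  { apply Rle_trans with (M * (e / (M * P) * P)).
    - apply Rmult_le_compat_l; [lra|]. apply Rmult_le_compat_r; lra.
    - right. field. split; lra. }
  rewrite (tri_cut z w eta Hz Hw Nz Hzw ltac:(lra)).
  set (b := pt z0 z eta). set (x := pt z0 w eta).
  assert (Hb : ball_at c R0 b) by (apply ball_convex; auto; lra).
  assert (Hx : ball_at c R0 x) by (apply ball_convex; auto; lra).
  assert (Lb : Cmod (b - z0) = eta * Cmod (z - z0)).
  { unfold b, pt. replace (z0 + eta * (z - z0) - z0)%C with (RtoC eta * (z - z0))%C by ring.
    rewrite Cmod_mult, Cmod_R, Rabs_pos_eq; lra. }
  assert (Lx : Cmod (x - z0) = eta * Cmod (w - z0)).
  { unfold x, pt. replace (z0 + eta * (w - z0) - z0)%C with (RtoC eta * (w - z0))%C by ring.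
    rewrite Cmod_mult, Cmod_R, Rabs_pos_eq; lra. }
  assert (Lbx : Cmod (x - b) = eta * Cmod (w - z)).
  { unfold x, b, pt. replace (z0 + eta * (w - z0) - (z0 + eta * (z - z0)))%C with (RtoC eta * (w - z))%C by ring.
    rewrite Cmod_mult, Cmod_R, Rabs_pos_eq; lra. }
  assert (Sm : forall y, Cmod (y - z0) <= eta * P -> Cmod (f y) <= M) by (intros; apply HM; lra).
  assert (Nb : Cmod (b - z0) <= eta * P) by (rewrite Lb; unfold P; nra).
  assert (Nx : Cmod (x - z0) <= eta * P) by (rewrite Lx; unfold P; nra).
  assert (N0 : Cmod (z0 - z0) <= eta * P) by (rewrite Cmod_self; nra).
  assert (SB : forall p q, ball_at c R0 p -> ball_at c R0 q -> Cmod (p - z0) <= eta * P ->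
    Cmod (q - z0) <= eta * P -> Cmod (seg f p q) <= M * Cmod (q - p)).
  { intros p q Hp Hq Np Nq. apply seg_bound; auto. intros t Ht. apply Sm.
    eapply Rle_trans; [apply Cmod_pt; auto|]. nra. }
  unfold tri. eapply Rle_trans; [apply Cmod_triangle|].
  assert (T := Cmod_triangle (seg f z0 b) (seg f b x)).
  assert (S1 := SB z0 b Hz0 Hb N0 Nb). assert (S2 := SB b x Hb Hx Nb Nx).
  assert (S3 := SB x z0 Hx Hz0 Nx N0). rewrite (Cmod_sub_comm z0 x) in S3.
  rewrite Lb in S1. rewrite Lbx in S2. rewrite Lx in S3.
  replace (M * (eta * P)) with (M * (eta * Cmod (z - z0)) + M * (eta * Cmod (w - z)) + M * (eta * Cmod (w - z0)))
    in E3' by (unfold P; ring). lra.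
Qed.

(** Only continuity is asked at [z0], because Cauchy's formula applies this to a difference quotient
    centred at [z0]. Taking [z0] also as the starting point of the integrals makes it a vertex of
    every triangle involved. *)
Lemma primitive_exists : exists F, forall z, ball_at c R0 z -> dC F z (f z).
Proof.
  exists (fun z => seg f z0 z). intros z Hz e He.
  destruct (Hcont z Hz e He) as [d [Pd Hd]].
  assert (Hb : 0 < R0 - Cmod (z - c)) by (unfold ball_at in Hz; lra).
  (* For [z <> z0] this is the closeness that [tri_vertex] demands; for [z = z0] the triangle is
     degenerate and any radius will do. *)
  set (g := if Ceq_dec z z0 then d else Cmod (z - z0) / 2).
  assert (Pg : 0 < g).
  { unfold g. destruct (Ceq_dec z z0) as [E|E]; auto. assert (T := Cmod_sub_neq _ _ E). lra. }
  exists (Rmin g (Rmin d (R0 - Cmod (z - c)))).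
  split. { repeat apply Rmin_pos; auto. }
  intros w Hw.
  assert (W1 : Cmod (w - z) < g) by (eapply Rlt_le_trans; [exact Hw|apply Rmin_l]).
  assert (W2 : Cmod (w - z) < d).
  { eapply Rlt_le_trans; [exact Hw|]. eapply Rle_trans; [apply Rmin_r|apply Rmin_l]. }
  assert (W3 : Cmod (w - z) < R0 - Cmod (z - c)).
  { eapply Rlt_le_trans; [exact Hw|]. eapply Rle_trans; [apply Rmin_r|apply Rmin_r]. }
  assert (Hwb : ball_at c R0 w).
  { unfold ball_at. assert (T := Cmod_triangle3 w z c). lra. }
  assert (E : (seg f z0 w - seg f z0 z)%C = seg f z w).
  { unfold g in W1. destruct (Ceq_dec z z0) as [E|E].
    - subst z. rewrite seg_point. ring.
    - assert (T := tri_vertex z w Hz Hwb E ltac:(lra)). unfold tri in T.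
      rewrite (seg_rev f z0 w) in T by auto.
      replace (seg f z w) with (seg f z0 w - seg f z0 z + (seg f z0 z + seg f z w + - seg f z0 w))%C by ring.
      rewrite T. ring. }
  rewrite E.
  assert (E2 : (seg f z w - f z * (w - z))%C = seg (fun x => f x - f z)%C z w).
  { rewrite seg_minus; auto; [|intros t _; apply cont_const].
    f_equal. rewrite (seg_ext (fun _ => f z) (fun x => f z + RtoC 0 * x)%C) by (intros; ring).
    rewrite seg_affine. field; apply RtoC_neq0; lra. }
  rewrite E2. apply seg_bound.
  - intros t Ht. apply cont_minus; [apply cs; auto|apply cont_const].
  - intros t Ht. left. apply Hd. assert (T := pt_dist z w t 0). rewrite pt0, Rminus_0_r in T.
    rewrite T, Rabs_pos_eq by lra. assert (Q := Cmod_ge_0 (w - z)). nra.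
Qed.
End Primitive.

(** * The exponential function *)

Definition Cexp (z : C) : C := (exp (fst z) * cos (snd z), exp (fst z) * sin (snd z)).

Lemma Cexp_add z w : Cexp (z + w) = (Cexp z * Cexp w)%C.
Proof.
  unfold Cexp, Cmult. simpl. rewrite exp_plus, cos_plus, sin_plus. f_equal; ring.
Qed.

Lemma Cexp_0 : Cexp (RtoC 0) = RtoC 1.
Proof. unfold Cexp, RtoC. simpl. rewrite exp_0, cos_0, sin_0. f_equal; ring. Qed.

Lemma Cmod_Cexp z : Cmod (Cexp z) = exp (fst z).
Proof.
  unfold Cmod, Cexp. simpl.
  replace (exp (fst z) * cos (snd z) * (exp (fst z) * cos (snd z) * 1) +
   exp (fst z) * sin (snd z) * (exp (fst z) * sin (snd z) * 1))
  with (exp (fst z) * exp (fst z) * (Rsqr (sin (snd z)) + Rsqr (cos (snd z)))) by (unfold Rsqr; ring).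
  rewrite sin2_cos2, Rmult_1_r. apply sqrt_square. left. apply exp_pos.
Qed.

Lemma Cexp_neq0 z : Cexp z <> RtoC 0.
Proof. apply Cmod_gt_0. rewrite Cmod_Cexp. apply exp_pos. Qed.

Lemma derivable_pt_lim_le f l e : derivable_pt_lim f 0 l -> 0 < e ->
  exists d, 0 < d /\ forall h, Rabs h < d -> Rabs (f h - f 0 - l * h) <= e * Rabs h.
Proof.
  intros H He. destruct (H e He) as [d Hd]. exists d. split; [apply cond_pos|].
  intros h Hh. destruct (Req_dec h 0) as [E|E].
  - subst. replace (f 0 - f 0 - l * 0) with 0 by ring. rewrite Rabs_R0. lra.
  - specialize (Hd h E Hh). rewrite Rplus_0_l in Hd.
    replace (f h - f 0 - l * h) with (((f h - f 0) / h - l) * h) by (field; auto).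
    rewrite Rabs_mult. apply Rmult_le_compat_r; [apply Rabs_pos|]. lra.
Qed.

Lemma Cmod_le_sum z : Cmod z <= Rabs (fst z) + Rabs (snd z).
Proof.
  destruct z as [x y]. replace (x, y) with (RtoC x + RtoC y * Ci)%C.
  - eapply Rle_trans; [apply Cmod_triangle|]. rewrite Cmod_mult, Cmod_Ci, !Cmod_R. simpl.
    rewrite !Rmult_0_l, !Rmult_0_r, !Rmult_1_r. unfold Rminus.
    replace (x + (0 + - 0)) with x by ring. replace (0 + (y + 0)) with y by ring. lra.
  - unfold RtoC, Ci, Cplus, Cmult. simpl. f_equal; ring.
Qed.

Lemma dC_Cexp_0 : dC Cexp (RtoC 0) (RtoC 1).
Proof.
  intros e He. set (e' := Rmin (e / 8) 1).
  assert (He' : 0 < e') by (apply Rmin_pos; lra).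
  assert (He1 : e' <= 1) by apply Rmin_r. assert (He8 : e' <= e / 8) by apply Rmin_l.
  destruct (derivable_pt_lim_le exp 1 e') as [d1 [P1 H1]]; auto.
  { assert (T := derivable_pt_lim_exp 0). rewrite exp_0 in T. exact T. }
  destruct (derivable_pt_lim_le cos 0 e') as [d2 [P2 H2]]; auto.
  { assert (T := derivable_pt_lim_cos 0). rewrite sin_0, Ropp_0 in T. exact T. }
  destruct (derivable_pt_lim_le sin 1 e') as [d3 [P3 H3]]; auto.
  { assert (T := derivable_pt_lim_sin 0). rewrite cos_0 in T. exact T. }
  rewrite exp_0 in H1. rewrite cos_0 in H2. rewrite sin_0 in H3.
  exists (Rmin d1 (Rmin d2 (Rmin d3 (e' / 2)))). split; [repeat apply Rmin_pos; lra|].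
  intros w Hw. rewrite Cexp_0. replace (w - 0)%C with w in * by ring.
  assert (W1 : Cmod w < d1) by (eapply Rlt_le_trans; [exact Hw|apply Rmin_l]).
  assert (W2 : Cmod w < d2).
  { eapply Rlt_le_trans; [exact Hw|]. eapply Rle_trans; [apply Rmin_r|apply Rmin_l]. }
  assert (W3 : Cmod w < d3).
  { eapply Rlt_le_trans; [exact Hw|]. eapply Rle_trans; [apply Rmin_r|].
    eapply Rle_trans; [apply Rmin_r|apply Rmin_l]. }
  assert (W4 : Cmod w < e' / 2).
  { eapply Rlt_le_trans; [exact Hw|]. eapply Rle_trans; [apply Rmin_r|].
    eapply Rle_trans; [apply Rmin_r|apply Rmin_r]. }
  destruct w as [x y].
  assert (B := Rmax_Cmod (x, y)). simpl in B.
  assert (Bx := Rle_trans _ _ _ (Rmax_l _ _) B). assert (By := Rle_trans _ _ _ (Rmax_r _ _) B).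
  set (m := Cmod (x, y)) in *.
  specialize (H1 x ltac:(lra)). specialize (H2 y ltac:(lra)). specialize (H3 y ltac:(lra)).
  assert (X1 : Rabs (exp x - 1) <= e').
  { replace (exp x - 1) with ((exp x - 1 - 1 * x) + x) by ring.
    eapply Rle_trans; [apply Rabs_triang|]. assert (T := Rabs_pos x). nra. }
  assert (X2 : exp x <= 2) by (assert (T := Rle_abs (exp x - 1)); lra).
  assert (X0 := exp_pos x).
  eapply Rle_trans; [apply Cmod_le_sum|].
  unfold Cexp, RtoC, Cminus, Cplus, Copp, Cmult. simpl.
  replace (exp x * cos y + - (1) + - (1 * x - 0 * y))
    with ((exp x - 1 - 1 * x) + exp x * (cos y - 1 - 0 * y)) by ring.
  replace (exp x * sin y + - 0 + - (1 * y + 0 * x))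
    with (exp x * (sin y - 0 - 1 * y) + (exp x - 1) * y) by ring.
  assert (T1 := Rabs_triang (exp x - 1 - 1 * x) (exp x * (cos y - 1 - 0 * y))).
  assert (T2 := Rabs_triang (exp x * (sin y - 0 - 1 * y)) ((exp x - 1) * y)).
  rewrite !Rabs_mult in T1, T2. rewrite (Rabs_mult (exp x - 1) y) in T2. rewrite (Rabs_pos_eq (exp x)) in T1, T2 by lra.
  assert (Q1 := Rabs_pos x). assert (Q2 := Rabs_pos y).
  assert (U1 : exp x * Rabs (cos y - 1 - 0 * y) <= 2 * (e' * Rabs y)).
  { apply Rmult_le_compat; try lra. apply Rabs_pos. }
  assert (U2 : exp x * Rabs (sin y - 0 - 1 * y) <= 2 * (e' * Rabs y)).
  { apply Rmult_le_compat; try lra. apply Rabs_pos. }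
  assert (U3 : Rabs (exp x - 1) * Rabs y <= e' * Rabs y) by (apply Rmult_le_compat_r; auto).
  assert (V1 : e' * Rabs x <= e' * m) by (apply Rmult_le_compat_l; lra).
  assert (V2 : e' * Rabs y <= e' * m) by (apply Rmult_le_compat_l; lra).
  assert (V3 : e' * m <= e / 8 * m) by (apply Rmult_le_compat_r; lra).
  assert (V4 : 0 <= e * m) by (apply Rmult_le_pos; lra). lra.
Qed.

Lemma dC_Cexp z : dC Cexp z (Cexp z).
Proof.
  apply (dC_ext (fun w => Cexp z * Cexp (w - z))%C).
  { intros w. rewrite <- Cexp_add. f_equal. ring. }
  assert (K : dC (fun w => Cexp z * Cexp (w - z))%C z (Cexp z * (RtoC 1 * RtoC 1))%C).
  { apply (dC_scal (fun w => Cexp (w - z))). apply (dC_comp Cexp (fun w => w - z)%C).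
    - replace (RtoC 1) with (RtoC 1 - RtoC 0)%C by ring. apply dC_minus; [apply dC_id|apply dC_const].
    - replace (z - z)%C with (RtoC 0) by ring. apply dC_Cexp_0. }
  rewrite !Cmult_1_r in K. exact K.
Qed.

Lemma cont_Cexp z : cont_at Cexp z.
Proof. eapply dC_cont. apply dC_Cexp. Qed.

Lemma Cexp_2PI : Cexp (0, 2 * PI) = RtoC 1.
Proof. unfold Cexp. simpl. rewrite exp_0, cos_2PI, sin_2PI. unfold RtoC. f_equal; ring. Qed.

Lemma Cexp_PI : Cexp (0, PI) = RtoC (-1).
Proof. unfold Cexp. simpl. rewrite exp_0, cos_PI, sin_PI. unfold RtoC. f_equal; ring. Qed.

(** The modulus fixes the real part; the imaginary part of the difference lies in (-1, 1), inside
    (-PI, PI), where the sine vanishes only at [0]. *)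
Lemma Cexp_small_inj z w : Cmod (z - w) < 1 -> Cexp z = Cexp w -> z = w.
Proof.
  intros H E.
  assert (E1 : Cexp (z - w) = RtoC 1).
  { replace z with ((z - w) + w)%C in E by ring. rewrite Cexp_add in E.
    assert (N := Cexp_neq0 w).
    replace (Cexp (z - w)) with (Cexp (z - w) * Cexp w / Cexp w)%C by (field; auto).
    rewrite E. field; auto. }
  replace z with ((z - w) + w)%C by ring. generalize dependent (z - w)%C. clear E. intros u H E1.
  assert (Er := Cmod_Cexp u). rewrite E1, Cmod_1 in Er.
  assert (Ur : fst u = 0).
  { apply exp_inv. rewrite <- Er, exp_0. reflexivity. }
  assert (B := Rmax_Cmod u). assert (By := Rle_trans _ _ _ (Rmax_r _ _) B).
  assert (S : sin (snd u) = 0).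
  { assert (T := f_equal snd E1). unfold Cexp, RtoC in T. simpl in T. rewrite Ur, exp_0 in T. lra. }
  assert (P4 := PI_RGT_0). assert (P3 := PI2_1).
  assert (Ui : snd u = 0).
  { assert (Rabs (snd u) < 1) by lra. apply Rabs_def2 in H0.
    destruct (Rtotal_order (snd u) 0) as [L|[L|L]]; auto.
    - assert (T := sin_lt_0_var (snd u)). lra.
    - assert (T := sin_gt_0 (snd u)). lra. }
  destruct u as [a b]. simpl in *. subst.
  replace (0, 0) with (RtoC 0) by reflexivity. ring.
Qed.

(** Polar form: [acos] yields the argument up to a sign, which the sign of the imaginary part
    decides. *)
Lemma Cexp_surj y : y <> RtoC 0 -> exists t, Cexp t = y.
Proof.
  intros H. apply Cmod_gt_0 in H. destruct y as [a b]. set (m := Cmod (a, b)) in *.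
  assert (M : a * a + b * b = m * m).
  { assert (T := dot_self (a, b)). unfold dot in T. simpl in T. exact T. }
  set (x := a / m).
  assert (X : -1 <= x <= 1).
  { assert (a * a <= m * m) by nra.
    assert (- m <= a <= m) by (split; nra).
    unfold x. split; apply Rmult_le_reg_r with m; auto; unfold Rdiv;
      rewrite Rmult_assoc, Rinv_l; lra. }
  assert (C1 := cos_acos x X). assert (S1 := sin_acos x X).
  assert (S2 : sin (acos x) = Rabs b / m).
  { rewrite S1. replace (1 - Rsqr x) with (Rsqr (Rabs b / m)).
    - apply sqrt_Rsqr. apply Rmult_le_pos; [apply Rabs_pos|]. left. apply Rinv_0_lt_compat; auto.
    - rewrite Rsqr_div' by lra. rewrite <- Rsqr_abs. unfold x. rewrite Rsqr_div' by lra.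
      unfold Rsqr. apply Rmult_eq_reg_r with (m * m); [|nra]. field_simplify; [|lra|lra].
      nra. }
  destruct (Rle_lt_dec 0 b) as [Hb|Hb].
  - exists (ln m, acos x). unfold Cexp. simpl. rewrite exp_ln, C1, S2, Rabs_pos_eq by lra.
    unfold x. f_equal; field; lra.
  - exists (ln m, - acos x). unfold Cexp. simpl. rewrite exp_ln, cos_neg, sin_neg, C1, S2, Rabs_left by lra.
    unfold x. f_equal; field; lra.
Qed.

(** * Cauchy's integral formula *)

Lemma seg_bounded f a b : cont_seg f a b ->
  exists M, 0 < M /\ forall t, 0 <= t <= 1 -> Cmod (f (pt a b t)) <= M.
Proof.
  intros H.
  destruct (continuity_ab_maj (fun t => Cmod (f (pt a b t))) 0 1) as [x [Hx _]]; [lra| |].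
  - intros t Ht. apply continuity_pt_filterlim.
    assert (T := pt_continuous f a b t (H t Ht)).
    intros P [e HP]. 
    destruct (T (fun w => Cmod (w - f (pt a b t)) < e)) as [d Hd].
    { apply locally_C_ball. exists e. split; [apply cond_pos|auto]. }
    exists d. intros s Hs. apply HP. specialize (Hd s Hs).
    change (Rabs (Cmod (f (pt a b s)) - Cmod (f (pt a b t))) < e).
    assert (T1 := Cmod_rev_triangle (f (pt a b s)) (f (pt a b t))).
    assert (T2 := Cmod_rev_triangle (f (pt a b t)) (f (pt a b s))).
    rewrite (Cmod_sub_comm (f (pt a b t))) in T2.
    unfold Rabs. destruct (Rcase_abs _); lra.
  - exists (Cmod (f (pt a b x)) + 1). split.
    + assert (Q := Cmod_ge_0 (f (pt a b x))). lra.
    + intros t Ht. specialize (Hx t Ht). simpl in Hx. lra.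
Qed.

Definition tau : C := (0, 2 * PI).

Lemma tau_neq0 : tau <> RtoC 0.
Proof. intros E. assert (T := f_equal snd E). simpl in T. assert (P := PI_RGT_0). lra. Qed.

Lemma pt_tau_fst t : fst (pt (RtoC 0) tau t) = 0.
Proof. unfold pt, tau, RtoC, Cplus, Cmult, Cminus, Copp. simpl. ring. Qed.

Lemma Cmod_Cexp_tau t : Cmod (Cexp (pt (RtoC 0) tau t)) = 1.
Proof. rewrite Cmod_Cexp, pt_tau_fst. apply exp_0. Qed.

(* Circles are parametrised by [w |-> c + r e^w] on the segment from [0] to [tau = 2 i pi]. *)
Definition circ (c : C) (r : R) (w : C) : C := (c + RtoC r * Cexp w)%C.

Lemma circ_dist c r t : 0 < r -> Cmod (circ c r (pt (RtoC 0) tau t) - c) = r.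
Proof.
  intros Hr. unfold circ.
  replace (c + r * Cexp (pt 0 tau t) - c)%C with (RtoC r * Cexp (pt 0 tau t))%C by ring.
  rewrite Cmod_mult, Cmod_Cexp_tau, Cmod_R, Rabs_pos_eq; lra.
Qed.

Lemma circ_far c r z t : 0 < r -> r - Cmod (z - c) <= Cmod (circ c r (pt (RtoC 0) tau t) - z).
Proof.
  intros Hr. assert (T := Cmod_triangle3 (circ c r (pt (RtoC 0) tau t)) z c).
  rewrite circ_dist in T by auto. lra.
Qed.

Lemma circ_neq c r z t : 0 < r -> ball_at c r z -> (circ c r (pt (RtoC 0) tau t) - z)%C <> RtoC 0.
Proof.
  intros Hr Hz. apply Cmod_gt_0. assert (T := circ_far c r z t Hr). unfold ball_at in Hz. lra.
Qed.

Lemma dC_circ c r w : dC (circ c r) w (RtoC r * Cexp w)%C.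
Proof.
  unfold circ. replace (RtoC r * Cexp w)%C with (RtoC 0 + RtoC r * Cexp w)%C by ring.
  apply (dC_plus (fun _ => c) (fun w => RtoC r * Cexp w)%C); [apply dC_const|].
  apply dC_scal, dC_Cexp.
Qed.

Lemma cont_circ c r w : cont_at (circ c r) w.
Proof. eapply dC_cont, dC_circ. Qed.

Lemma seg_const k a b : seg (fun _ => k) a b = (k * (b - a))%C.
Proof.
  rewrite (seg_ext (fun _ => k) (fun x => k + RtoC 0 * x)%C) by (intros; ring).
  rewrite seg_affine. field; apply RtoC_neq0; lra.
Qed.

(** Differentiation under the integral. With [d] the distance from [z] to the circle and
    [Cmod (x - z) < d / 2], the remainder of [1 / (circ - x)] after the linear term is at most
    [2 / d ^ 3] times [Cmod (x - z) ^ 2]. *)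
Lemma cauchy_transform_dC (phi : C -> C) c r z :
  0 < r -> ball_at c r z -> cont_seg phi (RtoC 0) tau ->
  dC (fun z => seg (fun w => phi w / (circ c r w - z))%C (RtoC 0) tau) z
     (seg (fun w => phi w / ((circ c r w - z) * (circ c r w - z)))%C (RtoC 0) tau).
Proof.
  intros Hr Hz Hphi e He.
  destruct (seg_bounded phi _ _ Hphi) as [M [PM HM]].
  set (d := r - Cmod (z - c)). assert (Pd : 0 < d) by (unfold d, ball_at in *; lra).
  assert (Ptau : 0 < Cmod tau) by (apply Cmod_gt_0, tau_neq0).
  set (K := M * (2 / (d * d * d)) * Cmod tau).
  assert (PK : 0 < K).
  { unfold K. apply Rmult_lt_0_compat; auto. apply Rmult_lt_0_compat; auto.
    apply Rdiv_lt_0_compat; [lra|]. repeat apply Rmult_lt_0_compat; auto. }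
  exists (Rmin (d / 2) (e / K)). split; [apply Rmin_pos; [lra|apply Rdiv_lt_0_compat; auto]|].
  intros x Hx.
  assert (X1 : Cmod (x - z) < d / 2) by (eapply Rlt_le_trans; [exact Hx|apply Rmin_l]).
  assert (X2 : Cmod (x - z) < e / K) by (eapply Rlt_le_trans; [exact Hx|apply Rmin_r]).
  assert (Hxb : ball_at c r x).
  { unfold ball_at. assert (T := Cmod_triangle3 x z c). unfold d in X1, Pd. lra. }
  set (s := fun y => fun w => (circ c r w - y)%C).
  assert (Cs : forall y t, cont_at (s y) t).
  { intros y t. unfold s. apply cont_minus; [apply cont_circ|apply cont_const]. }
  assert (Ns : forall y t, ball_at c r y -> s y (pt (RtoC 0) tau t) <> RtoC 0).
  { intros y t Hy. apply circ_neq; auto. }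
  assert (C1 : forall y, ball_at c r y -> cont_seg (fun w => phi w / s y w)%C (RtoC 0) tau).
  { intros y Hy t Ht. apply cont_div; auto. }
  assert (C2 : cont_seg (fun w => phi w / (s z w * s z w))%C (RtoC 0) tau).
  { intros t Ht. apply (cont_div phi (fun w => s z w * s z w)%C); auto.
    - apply Cmult_neq_0; auto.
    - apply cont_mult; auto. }
  change (Cmod (seg (fun w => phi w / s x w)%C (RtoC 0) tau - seg (fun w => phi w / s z w)%C (RtoC 0) tau
    - seg (fun w => phi w / (s z w * s z w))%C (RtoC 0) tau * (x - z)) <= e * Cmod (x - z)).
  rewrite <- (seg_minus (fun w => phi w / s x w)%C (fun w => phi w / s z w)%C) by auto.
  rewrite (Cmult_comm _ (x - z)). rewrite <- (seg_scal (x - z) (fun w => phi w / (s z w * s z w))%C) by auto.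
  assert (C3 : cont_seg (fun w => phi w / s x w - phi w / s z w)%C (RtoC 0) tau).
  { intros t Ht. apply cont_minus; [apply C1|apply C1]; auto. }
  assert (C4 : cont_seg (fun w => (x - z) * (phi w / (s z w * s z w)))%C (RtoC 0) tau).
  { intros t Ht. apply cont_mult; [apply cont_const|auto]. }
  rewrite <- (seg_minus (fun w => phi w / s x w - phi w / s z w)%C) by auto.
  eapply Rle_trans; [apply (seg_bound _ _ _ (M * (2 / (d * d * d)) * (Cmod (x - z) * Cmod (x - z))))|].
  - intros t Ht. apply cont_minus; auto.
  - intros t Ht. set (w := pt (RtoC 0) tau t).
    assert (N1 : s x w <> RtoC 0) by (apply Ns; auto).
    assert (N2 : s z w <> RtoC 0) by (apply Ns; auto).
    replace (phi w / s x w - phi w / s z w - (x - z) * (phi w / (s z w * s z w)))%C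
      with (phi w * ((x - z) * (x - z)) / (s x w * (s z w * s z w)))%C.
    2:{ replace (x - z)%C with (s z w - s x w)%C by (unfold s; ring). field; auto. }
    rewrite Cmod_div by (repeat apply Cmult_neq_0; auto). rewrite !Cmod_mult.
    assert (F1 : d / 2 <= Cmod (s x w)).
    { unfold s, w. assert (T := circ_far c r x t Hr). assert (T' := Cmod_triangle3 x z c). unfold d in *. lra. }
    assert (F2 : d <= Cmod (s z w)) by (apply circ_far; auto).
    assert (F3 : d * d * d / 2 <= Cmod (s x w) * (Cmod (s z w) * Cmod (s z w))).
    { replace (d * d * d / 2) with (d / 2 * (d * d)) by field.
      assert (d * d <= Cmod (s z w) * Cmod (s z w)) by (apply Rmult_le_compat; lra).
      apply Rmult_le_compat; try lra. nra. }
    assert (PD : 0 < d * d * d) by (repeat apply Rmult_lt_0_compat; auto).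
    apply Rmult_le_reg_r with (Cmod (s x w) * (Cmod (s z w) * Cmod (s z w))); [lra|].
    unfold Rdiv at 1. rewrite Rmult_assoc, Rinv_l, Rmult_1_r by lra.
    apply Rle_trans with (M * (2 / (d * d * d)) * (Cmod (x - z) * Cmod (x - z)) * (d * d * d / 2)).
    + replace (M * (2 / (d * d * d)) * (Cmod (x - z) * Cmod (x - z)) * (d * d * d / 2))
        with (M * (Cmod (x - z) * Cmod (x - z))) by (field; lra).
      apply Rmult_le_compat_r; [|apply HM; auto]. assert (Q := Cmod_ge_0 (x - z)). nra.
    + apply Rmult_le_compat_l; auto. apply Rmult_le_pos.
      * apply Rmult_le_pos; [lra|]. left. apply Rdiv_lt_0_compat; lra.
      * assert (Q := Cmod_ge_0 (x - z)). nra.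
  - replace (tau - RtoC 0)%C with tau by ring.
    replace (M * (2 / (d * d * d)) * (Cmod (x - z) * Cmod (x - z)) * Cmod tau)
      with (K * Cmod (x - z) * Cmod (x - z)) by (unfold K; ring).
    apply Rmult_le_compat_r; [apply Cmod_ge_0|].
    apply Rmult_le_reg_r with (/ K); [apply Rinv_0_lt_compat; auto|].
    replace (K * Cmod (x - z) * / K) with (Cmod (x - z)) by (field; lra). left. exact X2.
Qed.

(** As a function of [z] the integral has derivative zero: the differentiated integrand has the
    primitive [- 1 / (circ - z)], which takes equal values at both ends of the period. Its constant
    value is read off at [z = c], where the integrand is [1]. *)
Lemma winding_one c r z : 0 < r -> ball_at c r z ->
  seg (fun w => RtoC r * Cexp w / (circ c r w - z))%C (RtoC 0) tau = tau.
Proof.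
  intros Hr Hz.
  set (phi := fun w => (RtoC r * Cexp w)%C).
  assert (Cphi : forall a b, cont_seg phi a b).
  { intros a b t _. apply cont_mult; [apply cont_const|apply cont_Cexp]. }
  set (J := fun z => seg (fun w => phi w / (circ c r w - z))%C (RtoC 0) tau).
  assert (DJ : forall y, ball_at c r y -> dC J y (RtoC 0)).
  { intros y Hy. assert (T := cauchy_transform_dC phi c r y Hr Hy (Cphi _ _)).
    fold J in T. rewrite (seg_FTC (fun w => RtoC (-1) * / (circ c r w - y))%C) in T.
    - unfold circ in T. replace (Cexp tau) with (RtoC 1) in T by (symmetry; exact Cexp_2PI).
      rewrite Cexp_0 in T.
      replace (RtoC (-1) * / (c + RtoC r * RtoC 1 - y) - RtoC (-1) * / (c + RtoC r * RtoC 1 - y))%C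
        with (RtoC 0) in T by ring. exact T.
    - intros t Ht. set (w := pt (RtoC 0) tau t).
      assert (N := circ_neq c r y t Hr Hy). fold w in N.
      replace (phi w / ((circ c r w - y) * (circ c r w - y)))%C
        with (RtoC (-1) * (- (phi w) / ((circ c r w - y) * (circ c r w - y))))%C by (field; auto).
      apply (dC_scal (fun w => / (circ c r w - y))%C).
      apply (dC_inv (fun w => circ c r w - y)%C); auto.
      replace (phi w) with (phi w - RtoC 0)%C by ring. apply dC_minus; [apply dC_circ|apply dC_const].
    - intros t Ht. apply (cont_div phi (fun w => (circ c r w - y) * (circ c r w - y))%C).
      + apply Cmult_neq_0; apply circ_neq; auto.
      + apply (Cphi (RtoC 0) tau t Ht).
      + apply cont_mult; (apply cont_minus; [apply cont_circ|apply cont_const]). }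
  assert (E : J z = J c).
  { assert (T := seg_FTC J (fun _ => RtoC 0) c z).
    rewrite seg_const in T.
    assert (T' : (RtoC 0 * (z - c))%C = (J z - J c)%C).
    { apply T.
      - intros t Ht. apply DJ. apply ball_convex; auto. apply ball_at_center; auto.
      - intros t _. apply cont_const. }
    replace (J z) with (J z - J c + J c)%C by ring. rewrite <- T'. ring. }
  change (J z = tau). rewrite E. unfold J.
  rewrite (seg_ext _ (fun _ => RtoC 1)).
  - rewrite seg_const. ring.
  - intros t Ht. unfold phi, circ. set (x := (RtoC r * Cexp (pt (RtoC 0) tau t))%C).
    replace (c + x - c)%C with x by ring. apply Cinv_r.
    apply Cmult_neq_0; [apply RtoC_neq0; lra|apply Cexp_neq0].
Qed.

Lemma circ_in_ball c r R0 t : 0 < r < R0 -> ball_at c R0 (circ c r (pt (RtoC 0) tau t)).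
Proof. intros H. unfold ball_at. rewrite circ_dist; lra. Qed.

(** The slope [q] of [f] at [z] is continuous at [z] and holomorphic elsewhere, so it has a
    primitive and integrates to zero around the circle. Splitting [q] into its two terms leaves
    [f z] times the winding integral. *)
Lemma cauchy_formula (f : C -> C) c r R0 z :
  holo (ball_at c R0) f -> 0 < r < R0 -> ball_at c r z ->
  seg (fun w => f (circ c r w) * (RtoC r * Cexp w) / (circ c r w - z))%C (RtoC 0) tau = (tau * f z)%C.
Proof.
  intros Hf Hr Hz.
  assert (HzR : ball_at c R0 z) by (unfold ball_at in *; lra).
  destruct (Hf z HzR) as [l Hl].
  apply dC_slope in Hl. destruct Hl as [q [Cq [El Eq]]].
  assert (Hq : forall x, x <> z -> q x = ((f x - f z) / (x - z))%C).
  { intros x Hx. rewrite (Eq x) at 1. field. apply Cmod_gt_0, Cmod_sub_neq; auto. }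
  assert (Dq : forall x, ball_at c R0 x -> x <> z -> exists l, dC q x l).
  { intros x Hx Nx. destruct (Hf x Hx) as [k Hk].
    assert (P := Cmod_sub_neq _ _ Nx).
    exists (((k - RtoC 0) * (x - z) - (f x - f z) * (RtoC 1 - RtoC 0)) / ((x - z) * (x - z)))%C.
    apply (dC_ext_loc (fun x => (f x - f z) / (x - z))%C _ x _ (Cmod (x - z))); auto.
    - intros w Hw. symmetry. apply Hq. intros E. subst w. rewrite Cmod_sub_comm in Hw. lra.
    - apply (dC_div (fun x => f x - f z)%C (fun x => x - z)%C).
      + apply Cmod_gt_0; auto.
      + apply dC_minus; auto. apply dC_const.
      + apply dC_minus; [apply dC_id|apply dC_const]. }
  destruct (primitive_exists c z R0 q HzR) as [F HF].
  { intros x Hx. destruct (Ceq_dec x z) as [E|E]; [subst; auto|].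
    destruct (Dq x Hx E) as [k Hk]. eapply dC_cont; eauto. }
  { exact Dq. }
  assert (Hr0 : 0 < r) by lra.
  assert (Cf : cont_seg (fun w => f (circ c r w) * (RtoC r * Cexp w) / (circ c r w - z))%C (RtoC 0) tau).
  { intros t Ht.
    apply (cont_div (fun w => f (circ c r w) * (RtoC r * Cexp w))%C (fun w => circ c r w - z)%C).
    - apply circ_neq; auto.
    - apply cont_mult.
      + apply (cont_comp f (circ c r)); [apply cont_circ|]. eapply holo_cont; [exact Hf|].
        apply circ_in_ball; auto.
      + apply cont_mult; [apply cont_const|apply cont_Cexp].
    - apply cont_minus; [apply cont_circ|apply cont_const]. }
  assert (C1 : cont_seg (fun w => RtoC r * Cexp w / (circ c r w - z))%C (RtoC 0) tau).
  { intros t Ht.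
    apply (cont_div (fun w => RtoC r * Cexp w)%C (fun w => circ c r w - z)%C).
    - apply circ_neq; auto.
    - apply cont_mult; [apply cont_const|apply cont_Cexp].
    - apply cont_minus; [apply cont_circ|apply cont_const]. }
  assert (E1 : seg (fun w => q (circ c r w) * (RtoC r * Cexp w))%C (RtoC 0) tau = RtoC 0).
  { rewrite (seg_FTC (fun w => F (circ c r w))).
    - unfold circ. replace (Cexp tau) with (RtoC 1) by (symmetry; exact Cexp_2PI).
      rewrite Cexp_0. ring.
    - intros t Ht. apply dC_comp; [apply dC_circ|]. apply HF. apply circ_in_ball; auto.
    - intros t Ht. apply cont_mult.
      + apply (cont_comp q (circ c r)); [apply cont_circ|].
        destruct (Dq (circ c r (pt (RtoC 0) tau t))) as [k Hk].
        * apply circ_in_ball; auto.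
        * intros E. assert (T := circ_neq c r z t Hr0 Hz). apply T. rewrite E. ring.
        * eapply dC_cont; eauto.
      + apply cont_mult; [apply cont_const|apply cont_Cexp]. }
  rewrite (seg_ext _ (fun w => f (circ c r w) * (RtoC r * Cexp w) / (circ c r w - z)
     - f z * (RtoC r * Cexp w / (circ c r w - z)))%C) in E1.
  2:{ intros t Ht. set (w := pt (RtoC 0) tau t).
      assert (T := circ_neq c r z t Hr0 Hz). fold w in T.
      rewrite Hq.
      - field; auto.
      - intros E. apply T. rewrite E. ring. }
  rewrite seg_minus, seg_scal, winding_one in E1; auto.
  - set (I := seg _ _ _) in *. replace I with (I - f z * tau + f z * tau)%C by ring. rewrite E1. ring.
  - intros t Ht. apply cont_mult; [apply cont_const|auto].
Qed.

(** Subtracting Cauchy's formulas at [z] and [c] exhibits the quotient as a Cauchy transform, which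
    is differentiable at [c] as well. Iterating this replaces power series throughout. *)
Lemma holo_divide (f : C -> C) c R0 : 0 < R0 -> holo (ball_at c R0) f ->
  exists q, holo (ball_at c R0) q /\ forall z, ball_at c R0 z -> f z = (f c + (z - c) * q z)%C.
Proof.
  intros HR Hf. set (r := R0 / 2). assert (Hr : 0 < r < R0) by (unfold r; lra).
  assert (Hr0 : 0 < r) by lra.
  set (T := fun z => seg (fun w => f (circ c r w) / (circ c r w - z))%C (RtoC 0) tau).
  assert (Cf : cont_seg (fun w => f (circ c r w)) (RtoC 0) tau).
  { intros t Ht. apply (cont_comp f (circ c r)); [apply cont_circ|]. eapply holo_cont; [exact Hf|].
    apply circ_in_ball; auto. }
  assert (DT : forall z, ball_at c r z -> exists l, dC T z l).
  { intros z Hz. eexists. apply (cauchy_transform_dC (fun w => f (circ c r w)) c r z); auto. }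
  assert (ET : forall z, ball_at c r z -> (f z - f c)%C = ((z - c) * (T z / tau))%C).
  { intros z Hz.
    assert (Hc := ball_at_center c r Hr0).
    assert (K : (tau * f z - tau * f c)%C = ((z - c) * T z)%C).
    { rewrite <- (cauchy_formula f c r R0 z), <- (cauchy_formula f c r R0 c) by auto.
      assert (CC : forall y, ball_at c r y ->
        cont_seg (fun w => f (circ c r w) * (RtoC r * Cexp w) / (circ c r w - y))%C (RtoC 0) tau).
      { intros y Hy t Ht.
        apply (cont_div (fun w => f (circ c r w) * (RtoC r * Cexp w))%C (fun w => circ c r w - y)%C).
        - apply circ_neq; auto.
        - apply cont_mult; [apply (Cf t Ht)|]. apply cont_mult; [apply cont_const|apply cont_Cexp].
        - apply cont_minus; [apply cont_circ|apply cont_const]. }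
      rewrite <- seg_minus by auto. unfold T. rewrite <- seg_scal.
      - apply seg_ext. intros t Ht. set (w := pt (RtoC 0) tau t).
        assert (N1 := circ_neq c r z t Hr0 Hz). assert (N2 := circ_neq c r c t Hr0 Hc). fold w in N1, N2.
        replace (RtoC r * Cexp w)%C with (circ c r w - c)%C by (unfold circ; ring).
        field. auto.
      - intros t Ht. apply (cont_div (fun w => f (circ c r w)) (fun w => circ c r w - z)%C).
        + apply circ_neq; auto.
        + apply (Cf t Ht).
        + apply cont_minus; [apply cont_circ|apply cont_const]. }
    assert (Nt := tau_neq0).
    replace (f z - f c)%C with ((tau * f z - tau * f c) / tau)%C by (field; auto).
    rewrite K. field. auto. }
  (* The circle has radius [R0 / 2] only, so the transform covers a neighbourhood of [c] and the
     plain quotient the rest; they agree where both make sense. *)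
  set (q := fun z => if Rlt_dec (Cmod (z - c)) r then (T z / tau)%C else ((f z - f c) / (z - c))%C).
  assert (Qn : forall z, z <> c -> q z = ((f z - f c) / (z - c))%C).
  { intros z Nz. unfold q. destruct (Rlt_dec (Cmod (z - c)) r) as [L|L]; auto.
    rewrite (ET z L). field. split; [apply tau_neq0|]. apply Cmod_gt_0, Cmod_sub_neq; auto. }
  exists q. split.
  - intros z Hz. destruct (Ceq_dec z c) as [E|E].
    + subst z. destruct (DT c (ball_at_center c r Hr0)) as [l Hl].
      exists (/ tau * l)%C. apply (dC_ext_loc (fun z => / tau * T z)%C q c _ r); auto.
      * intros w Hw. unfold q. destruct (Rlt_dec (Cmod (w - c)) r); [|lra]. unfold Cdiv. ring.
      * apply dC_scal; auto.
    + assert (P := Cmod_sub_neq _ _ E). destruct (Hf z Hz) as [k Hk].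
      exists (((k - RtoC 0) * (z - c) - (f z - f c) * (RtoC 1 - RtoC 0)) / ((z - c) * (z - c)))%C.
      apply (dC_ext_loc (fun x => (f x - f c) / (x - c))%C _ z _ (Cmod (z - c))); auto.
      * intros w Hw. symmetry. apply Qn. intros E'. subst w. rewrite Cmod_sub_comm in Hw. lra.
      * apply (dC_div (fun x => f x - f c)%C (fun x => x - c)%C).
        -- apply Cmod_gt_0; auto.
        -- apply dC_minus; auto. apply dC_const.
        -- apply dC_minus; [apply dC_id|apply dC_const].
  - intros z Hz. destruct (Ceq_dec z c) as [E|E]; [subst; ring|].
    rewrite Qn by auto. field. apply Cmod_gt_0, Cmod_sub_neq; auto.
Qed.

(** The kernel is at most [1 / (r - Cmod (z - c))] on the circle. The resulting factor exceeds that
    of the maximum principle, but it is [1] at the centre and elsewhere any fixed factor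
    suffices. *)
Lemma cauchy_bound (f : C -> C) c r R0 z M :
  holo (ball_at c R0) f -> 0 < r < R0 -> ball_at c r z -> 0 <= M ->
  (forall w, Cmod (w - c) = r -> Cmod (f w) <= M) ->
  Cmod (f z) <= M * (r / (r - Cmod (z - c))).
Proof.
  intros Hf Hr Hz PM HM. assert (Hr0 : 0 < r) by lra.
  assert (Ptau : 0 < Cmod tau) by (apply Cmod_gt_0, tau_neq0).
  apply Rmult_le_reg_l with (Cmod tau); auto. rewrite <- Cmod_mult.
  rewrite <- (cauchy_formula f c r R0 z) by auto.
  replace (Cmod tau * (M * (r / (r - Cmod (z - c)))))
    with (M * (r / (r - Cmod (z - c))) * Cmod (tau - RtoC 0))
    by (replace (tau - RtoC 0)%C with tau by ring; ring).
  unfold ball_at in Hz.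
  apply seg_bound.
  - intros t Ht.
    apply (cont_div (fun w => f (circ c r w) * (RtoC r * Cexp w))%C (fun w => circ c r w - z)%C).
    + apply circ_neq; auto.
    + apply cont_mult.
      * apply (cont_comp f (circ c r)); [apply cont_circ|]. eapply holo_cont; [exact Hf|].
        apply circ_in_ball; auto.
      * apply cont_mult; [apply cont_const|apply cont_Cexp].
    + apply cont_minus; [apply cont_circ|apply cont_const].
  - intros t Ht. rewrite Cmod_div by (apply circ_neq; auto).
    rewrite !Cmod_mult, Cmod_Cexp_tau, Cmod_R, Rabs_pos_eq, Rmult_1_r by lra.
    assert (T := circ_far c r z t Hr0).
    unfold Rdiv. rewrite <- (Rmult_assoc M). apply Rmult_le_compat.
    + apply Rmult_le_pos; [apply Cmod_ge_0|lra].
    + left. apply Rinv_0_lt_compat. lra.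
    + apply Rmult_le_compat_r; [lra|]. apply HM. apply circ_dist; auto.
    + apply Rinv_le_contravar; lra.
Qed.

Lemma cauchy_bound_center (f : C -> C) c r R0 M :
  holo (ball_at c R0) f -> 0 < r < R0 -> 0 <= M ->
  (forall w, Cmod (w - c) = r -> Cmod (f w) <= M) -> Cmod (f c) <= M.
Proof.
  intros Hf Hr PM HM.
  assert (T := cauchy_bound f c r R0 c M Hf Hr (ball_at_center c r ltac:(lra)) PM HM).
  rewrite Cmod_self, Rminus_0_r in T. replace (r / r) with 1 in T by (field; lra). lra.
Qed.

Lemma circle_param c r w : 0 < r -> Cmod (w - c) = r ->
  exists t, 0 <= t <= 1 /\ w = circ c r (pt (RtoC 0) tau t).
Proof.
  intros Hr Hw.
  assert (N : ((w - c) / RtoC r)%C <> RtoC 0).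
  { apply Cmod_gt_0. rewrite Cmod_div by (apply RtoC_neq0; lra). rewrite Hw, Cmod_R, Rabs_pos_eq by lra.
    apply Rdiv_lt_0_compat; lra. }
  destruct (Cexp_surj _ N) as [[x y] E].
  assert (Ex := Cmod_Cexp (x, y)). rewrite E in Ex.
  rewrite Cmod_div in Ex by (apply RtoC_neq0; lra). rewrite Hw, Cmod_R, Rabs_pos_eq in Ex by lra.
  assert (X0 : x = 0).
  { apply exp_inv. simpl in Ex. rewrite <- Ex, exp_0. field; lra. }
  subst x.
  (* [up] exceeds its argument by at most one, so subtracting [k] leaves a number between [0] and
     [1]. *)
  set (k := (up (y / (2 * PI)) - 1)%Z). assert (P := PI_RGT_0).
  destruct (archimed (y / (2 * PI))) as [A1 A2].
  exists (y / (2 * PI) - IZR k). split.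
  - unfold k. rewrite minus_IZR. lra.
  - unfold circ. replace (Cexp (pt 0 tau (y / (2 * PI) - IZR k))) with (Cexp (0, y)).
    + rewrite E. field. apply RtoC_neq0. lra.
    + unfold Cexp, pt, tau. simpl.
      replace (0 + ((y / (2 * PI) - IZR k) * (0 + - 0) - 0 * (2 * PI + - 0))) with 0 by ring.
      replace (0 + ((y / (2 * PI) - IZR k) * (2 * PI + - 0) + 0 * (0 + - 0)))
        with (y + 2 * IZR (- k) * PI) by (rewrite opp_IZR; field; lra).
      assert (Pc : forall n z, cos (z + 2 * INR n * PI) = cos z) by (intros; apply cos_period).
      assert (Ps : forall n z, sin (z + 2 * INR n * PI) = sin z) by (intros; apply sin_period).
      destruct (Z.le_gt_cases 0 (- k)) as [G|G].
      * replace (IZR (- k)) with (INR (Z.to_nat (- k))) by (rewrite INR_IZR_INZ, Z2Nat.id; auto).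
        rewrite Pc, Ps. reflexivity.
      * assert (E' : IZR (- k) = - INR (Z.to_nat k)).
        { rewrite INR_IZR_INZ, Z2Nat.id, <- opp_IZR; [reflexivity|lia]. }
        rewrite E'.
        rewrite <- (Pc (Z.to_nat k) (y + 2 * - INR (Z.to_nat k) * PI)),
                <- (Ps (Z.to_nat k) (y + 2 * - INR (Z.to_nat k) * PI)).
        replace (y + 2 * - INR (Z.to_nat k) * PI + 2 * INR (Z.to_nat k) * PI) with y by ring.
        reflexivity.
Qed.

Lemma holo_bounded_circle (f : C -> C) c r R0 :
  holo (ball_at c R0) f -> 0 < r < R0 ->
  exists M, 0 < M /\ forall w, Cmod (w - c) = r -> Cmod (f w) <= M.
Proof.
  intros Hf Hr.
  destruct (seg_bounded (fun w => f (circ c r w)) (RtoC 0) tau) as [M [PM HM]].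
  - intros t Ht. apply (cont_comp f (circ c r)); [apply cont_circ|]. eapply holo_cont; [exact Hf|].
    apply circ_in_ball; auto.
  - exists M. split; auto. intros w Hw.
    destruct (circle_param c r w ltac:(lra) Hw) as [t [Ht E]]. subst w. auto.
Qed.

(** * Order of vanishing, leading coefficients and local estimates *)

Lemma small_pow x K e : 0 <= x < 1 -> 0 <= K -> 0 < e -> exists n, x ^ n * K < e.
Proof.
  intros Hx HK He.
  destruct (pow_lt_1_zero x ltac:(rewrite Rabs_pos_eq; lra) (e / (K + 1))) as [N HN];
    [apply Rdiv_lt_0_compat; lra|].
  exists N. specialize (HN N (le_n _)). rewrite Rabs_pos_eq in HN by (apply pow_le; lra).
  assert (0 <= x ^ N) by (apply pow_le; lra).
  apply Rle_lt_trans with (x ^ N * (K + 1)); [nra|].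
  apply Rlt_le_trans with (e / (K + 1) * (K + 1)); [apply Rmult_lt_compat_r; lra|].
  right. field. lra.
Qed.

Lemma ball_point (c : C) (r : R) : 0 < r -> exists z, z <> c /\ Cmod (z - c) = r.
Proof.
  intros Hr. exists (c + RtoC r)%C.
  assert (E : Cmod (c + RtoC r - c) = r).
  { replace (c + RtoC r - c)%C with (RtoC r) by ring. rewrite Cmod_R, Rabs_pos_eq; lra. }
  split; auto. intros H. rewrite H, Cmod_self in E. lra.
Qed.

(** If division by [z - c] never stops, then [f = (z - c) ^ n q_n] for every [n], and Cauchy's bound
    on a circle of radius [r] beyond [z] gives [Cmod (f z)] at most a constant times
    [(Cmod (z - c) / r) ^ n], which tends to zero. *)
Lemma order_dichotomy (f : C -> C) c R0 : 0 < R0 -> holo (ball_at c R0) f ->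
  (forall z, ball_at c R0 z -> f z = RtoC 0) \/
  exists m q, holo (ball_at c R0) q /\ q c <> RtoC 0 /\
    forall z, ball_at c R0 z -> f z = ((z - c) ^ m * q z)%C.
Proof.
  intros HR Hf.
  destruct (classic (exists m q, holo (ball_at c R0) q /\ q c <> RtoC 0 /\
    forall z, ball_at c R0 z -> f z = ((z - c) ^ m * q z)%C)) as [H|H]; [right; exact H|left].
  assert (A : forall m, exists q, holo (ball_at c R0) q /\
    forall z, ball_at c R0 z -> f z = ((z - c) ^ m * q z)%C).
  { induction m as [|m [q [Hq Eq]]].
    - exists f. split; auto. intros z _. simpl. ring.
    - assert (E0 : q c = RtoC 0).
      { destruct (Ceq_dec (q c) (RtoC 0)) as [E|N]; auto. exfalso. apply H. exists m, q. auto. }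
      destruct (holo_divide q c R0 HR Hq) as [p [Hp Ep]]. exists p. split; auto.
      intros z Hz. rewrite (Eq z Hz), (Ep z Hz), E0. simpl. ring. }
  intros z Hz. set (d := Cmod (z - c)). set (r := (d + R0) / 2).
  assert (Hd : 0 <= d) by apply Cmod_ge_0.
  assert (Hr : 0 < r < R0) by (unfold r, ball_at in *; fold d in Hz; lra).
  assert (Hdr : d < r) by (unfold r, ball_at in *; fold d in Hz; lra).
  destruct (holo_bounded_circle f c r R0 Hf Hr) as [M [PM HM]].
  replace (f z) with (f z - RtoC 0 + RtoC 0)%C by ring.
  apply Cmod_small_eq. intros e He. replace (f z - 0 + 0 - 0)%C with (f z) by ring.
  assert (P : 0 < r / (r - d)) by (apply Rdiv_lt_0_compat; lra).
  destruct (small_pow (d / r) (M * (r / (r - d))) e) as [n Hn]; auto.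
  { split; [apply Rmult_le_pos; auto; left; apply Rinv_0_lt_compat; lra|].
    apply Rmult_lt_reg_r with r; [lra|]. unfold Rdiv. rewrite Rmult_assoc, Rinv_l; lra. }
  { apply Rmult_le_pos; lra. }
  destruct (A n) as [q [Hq Eq]].
  assert (Pr : 0 < r ^ n) by (apply pow_lt; lra).
  assert (B := cauchy_bound q c r R0 z (M / r ^ n) Hq Hr Hdr).
  fold d in B. assert (PMr : 0 < M / r ^ n) by (apply Rdiv_lt_0_compat; auto).
  specialize (B ltac:(lra)).
  assert (B' : Cmod (q z) <= M / r ^ n * (r / (r - d))).
  { apply B. intros w Hw. apply Rmult_le_reg_l with (r ^ n); auto.
    specialize (HM w Hw). rewrite (Eq w) in HM by (unfold ball_at; lra).
    rewrite Cmod_mult, Cmod_pow, Hw in HM. replace (r ^ n * (M / r ^ n)) with M by (field; lra). exact HM. }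
  rewrite (Eq z Hz), Cmod_mult, Cmod_pow. fold d.
  left. eapply Rle_lt_trans; [|exact Hn].
  apply Rle_trans with (d ^ n * (M / r ^ n * (r / (r - d)))).
  - apply Rmult_le_compat_l; auto. apply pow_le; auto.
  - right. replace ((d / r) ^ n) with (d ^ n / r ^ n)
      by (unfold Rdiv; rewrite Rpow_mult_distr, pow_inv; reflexivity).
    field. lra.
Qed.

Lemma holo_identity (f : C -> C) c R0 e : 0 < R0 -> holo (ball_at c R0) f -> 0 < e ->
  (forall z, Cmod (z - c) < e -> f z = RtoC 0) ->
  forall z, ball_at c R0 z -> f z = RtoC 0.
Proof.
  intros HR Hf He H0.
  destruct (order_dichotomy f c R0 HR Hf) as [H|[m [q [Hq [N E]]]]]; auto.
  exfalso. assert (Cq := holo_cont _ _ _ Hq (ball_at_center c R0 HR)).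
  destruct (cont_neq q c _ Cq N) as [d [Pd Hd]].
  set (s := Rmin (Rmin e d) R0 / 2).
  assert (Ps : 0 < Rmin (Rmin e d) R0) by (repeat apply Rmin_pos; auto).
  assert (s1 := Rmin_l (Rmin e d) R0). assert (s2 := Rmin_r (Rmin e d) R0).
  assert (s3 := Rmin_l e d). assert (s4 := Rmin_r e d).
  destruct (ball_point c s) as [z [Nz Ez]]; [unfold s; lra|].
  assert (T := H0 z ltac:(rewrite Ez; unfold s; lra)).
  rewrite (E z) in T by (unfold ball_at; rewrite Ez; unfold s; lra).
  revert T. apply Cmult_neq_0.
  - apply Cpow_nz. apply Cmod_gt_0, Cmod_sub_neq; auto.
  - apply Hd. rewrite Ez. unfold s. lra.
Qed.

Lemma cont_limit_eq (f : C -> C) z a : cont_at f z ->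
  (forall e, 0 < e -> exists d, 0 < d /\ forall w, 0 < Cmod (w - z) < d -> Cmod (f w - a) <= e) ->
  f z = a.
Proof.
  intros Cf H. apply Cmod_small_eq. intros e He.
  destruct (Cf (e/2)) as [d1 [P1 H1]]; [lra|]. destruct (H (e/2)) as [d2 [P2 H2]]; [lra|].
  assert (Pm : 0 < Rmin d1 d2) by (apply Rmin_pos; auto).
  assert (m1 := Rmin_l d1 d2). assert (m2 := Rmin_r d1 d2).
  destruct (ball_point z (Rmin d1 d2 / 2)) as [w [Nw Ew]]; [lra|].
  specialize (H1 w ltac:(lra)). specialize (H2 w ltac:(lra)).
  assert (T := Cmod_triangle3 (f z) (f w) a). rewrite (Cmod_sub_comm (f z) (f w)) in T. lra.
Qed.

(** Cauchy's estimate for the leading coefficient, phrased with asymptotics rather than derivatives.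
    A leading term of positive degree forces [K 0 = 0]; dividing by [z] lowers [m] and costs one
    factor [r]. *)
Lemma cauchy_coefficient m : forall (K : C -> C) r R0 M b, holo (ball_at (RtoC 0) R0) K ->
  0 < r < R0 -> 0 <= M -> (forall w, Cmod w = r -> Cmod (K w) <= M) ->
  (forall e, 0 < e -> exists d, 0 < d /\ forall w, 0 < Cmod w < d ->
     Cmod (K w - b * w ^ m) <= e * Cmod w ^ m) ->
  Cmod b <= M / r ^ m.
Proof.
  induction m as [|m IH]; intros K r R0 M b HK Hr PM HM Ho.
  - assert (E : K (RtoC 0) = b).
    { apply cont_limit_eq.
      - eapply holo_cont; [exact HK|]. apply ball_at_center; lra.
      - intros e He. destruct (Ho e He) as [d [Pd Hd]]. exists d. split; auto.
        intros w Hw. replace (w - 0)%C with w in Hw by ring.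
        specialize (Hd w Hw). simpl in Hd. rewrite Rmult_1_r, Cmult_1_r in Hd. exact Hd. }
    rewrite <- E. simpl. unfold Rdiv. rewrite Rinv_1, Rmult_1_r.
    apply (cauchy_bound_center K (RtoC 0) r R0 M HK Hr PM).
    intros w Hw. apply HM. rewrite <- Hw. f_equal. ring.
  - assert (HR : 0 < R0) by lra.
    assert (E : K (RtoC 0) = RtoC 0).
    { apply cont_limit_eq.
      - eapply holo_cont; [exact HK|]. apply ball_at_center; lra.
      - intros e He. destruct (Ho 1 ltac:(lra)) as [d [Pd Hd]].
        assert (Pb := Cmod_ge_0 b).
        exists (Rmin (Rmin d 1) (e / (Cmod b + 1))). split.
        { repeat apply Rmin_pos; auto; try lra. apply Rdiv_lt_0_compat; lra. }
        intros w Hw. replace (w - 0)%C with w in Hw by ring.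
        assert (m1 := Rmin_l (Rmin d 1) (e / (Cmod b + 1))). assert (m2 := Rmin_r (Rmin d 1) (e / (Cmod b + 1))).
        assert (m3 := Rmin_l d 1). assert (m4 := Rmin_r d 1).
        specialize (Hd w ltac:(lra)).
        assert (T := Cmod_triangle (K w - b * w ^ S m) (b * w ^ S m)).
        replace (K w - b * w ^ S m + b * w ^ S m)%C with (K w) in T by ring.
        rewrite Cmod_mult, Cmod_pow in T. replace (K w - 0)%C with (K w) by ring.
        assert (Hp : Cmod w ^ S m <= Cmod w).
        { simpl. rewrite <- (Rmult_1_r (Cmod w)) at 3. apply Rmult_le_compat_l; [lra|].
          rewrite <- (pow1 m). apply pow_incr. lra. }
        assert (Hp0 : 0 <= Cmod w ^ S m) by (apply pow_le; lra).
        assert (Cmod w * (Cmod b + 1) <= e).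
        { apply Rle_trans with (e / (Cmod b + 1) * (Cmod b + 1)); [apply Rmult_le_compat_r; lra|].
          right; field; lra. }
        nra. }
    destruct (holo_divide K (RtoC 0) R0 HR HK) as [q [Hq Eq]].
    assert (Eq' : forall z, ball_at (RtoC 0) R0 z -> K z = (z * q z)%C).
    { intros z Hz. rewrite (Eq z Hz), E. ring. }
    replace (M / r ^ S m) with ((M / r) / r ^ m)
      by (simpl; field; split; [apply pow_nonzero|]; lra).
    apply (IH q r R0); auto.
    + apply Rmult_le_pos; auto. left; apply Rinv_0_lt_compat; lra.
    + intros w Hw. specialize (HM w Hw).
      rewrite Eq' in HM by (unfold ball_at; replace (w - 0)%C with w by ring; lra).
      rewrite Cmod_mult, Hw in HM. apply Rmult_le_reg_l with r; [lra|].
      replace (r * (M / r)) with M by (field; lra). exact HM.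
    + intros e He. destruct (Ho e He) as [d [Pd Hd]]. exists (Rmin d R0).
      split; [apply Rmin_pos; auto|]. intros w Hw.
      assert (m1 := Rmin_l d R0). assert (m2 := Rmin_r d R0).
      specialize (Hd w ltac:(lra)).
      rewrite Eq' in Hd by (unfold ball_at; replace (w - 0)%C with w by ring; lra).
      simpl in Hd. replace (w * q w - b * (w * w ^ m))%C with (w * (q w - b * w ^ m))%C in Hd by ring.
      rewrite Cmod_mult in Hd. apply Rmult_le_reg_l with (Cmod w); [lra|]. lra.
Qed.

Lemma holo_locally_bounded (f : C -> C) c R0 r : holo (ball_at c R0) f -> 0 < r < R0 ->
  exists M, 0 < M /\ forall z, Cmod (z - c) <= r -> Cmod (f z) <= M.
Proof.
  intros Hf Hr. set (s := (r + R0) / 2). assert (Hs : 0 < s < R0) by (unfold s; lra).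
  destruct (holo_bounded_circle f c s R0 Hf Hs) as [M [PM HM]].
  assert (Q : 0 < s / (s - r)) by (apply Rdiv_lt_0_compat; unfold s; lra).
  exists (M * (s / (s - r))). split; [apply Rmult_lt_0_compat; auto|].
  intros z Hz.
  assert (T := cauchy_bound f c s R0 z M Hf Hs ltac:(unfold ball_at, s; lra) ltac:(lra) HM).
  eapply Rle_trans; [exact T|]. apply Rmult_le_compat_l; [lra|].
  unfold Rdiv. apply Rmult_le_compat_l; [lra|]. apply Rinv_le_contravar; unfold s in *; lra.
Qed.

Lemma holo_lipschitz (f : C -> C) c R0 : 0 < R0 -> holo (ball_at c R0) f ->
  exists L d, 0 < d /\ 0 < L /\ forall x y, Cmod (x - c) < d -> Cmod (y - c) < d ->
    Cmod (f x - f y) <= L * Cmod (x - y).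
Proof.
  intros HR Hf. set (r := R0 / 4).
  destruct (holo_locally_bounded f c R0 (2 * r) Hf ltac:(unfold r; lra)) as [M [PM HM]].
  exists (4 * M / r), (r / 4). assert (Pr : 0 < r) by (unfold r; lra).
  split; [lra|]. split; [apply Rdiv_lt_0_compat; lra|].
  intros x y Hx Hy.
  assert (Hy' : holo (ball_at y (2 * r)) f).
  { intros z Hz. apply Hf. eapply (ball_at_sub c y R0 (2 * r)); eauto. unfold r in *. lra. }
  destruct (holo_divide f y (2 * r) ltac:(lra) Hy') as [q [Hq Eq]].
  assert (Hxy : Cmod (x - y) <= r / 2).
  { assert (T := Cmod_triangle3 x c y). rewrite (Cmod_sub_comm c y) in T. lra. }
  assert (B := cauchy_bound q y r (2 * r) x (2 * M / r) Hq ltac:(lra)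
    ltac:(unfold ball_at; lra) ltac:(left; apply Rdiv_lt_0_compat; lra)).
  assert (B' : Cmod (q x) <= 2 * M / r * (r / (r - Cmod (x - y)))).
  { apply B. intros w Hw. apply Rmult_le_reg_l with r; auto.
    replace (r * (2 * M / r)) with (2 * M) by (field; lra). rewrite <- Hw at 1. rewrite <- Cmod_mult.
    replace ((w - y) * q w)%C with (f w - f y)%C by (rewrite (Eq w) by (unfold ball_at; lra); ring).
    eapply Rle_trans; [apply Cmod_sub_le|].
    assert (T := Cmod_triangle3 w y c).
    assert (T1 := HM w ltac:(lra)). assert (T2 := HM y ltac:(lra)). lra. }
  replace (f x - f y)%C with ((x - y) * q x)%C by (rewrite (Eq x) by (unfold ball_at; lra); ring).
  rewrite Cmod_mult, Rmult_comm. apply Rmult_le_compat_r; [apply Cmod_ge_0|].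
  eapply Rle_trans; [exact B'|].
  replace (4 * M / r) with (2 * M / r * 2) by (field; lra).
  apply Rmult_le_compat_l; [left; apply Rdiv_lt_0_compat; lra|].
  apply Rmult_le_reg_r with (r - Cmod (x - y)); [lra|].
  unfold Rdiv. rewrite Rmult_assoc, Rinv_l by lra. lra.
Qed.

(** Unlike in [dC] both points vary: jets compare a lift with an approximate orbit, neither of which
    stays at the base point. With [f z = f c + (z - c) q z] the error is
    [(q x - q c)(x - y) + (y - c)(q x - q y)]; continuity of [q] controls the first term, its
    Lipschitz bound the second. *)
Lemma dC_strict (f : C -> C) c R0 l : 0 < R0 -> holo (ball_at c R0) f -> dC f c l ->
  forall e, 0 < e -> exists d, 0 < d /\ forall x y, Cmod (x - c) < d -> Cmod (y - c) < d ->
    Cmod (f x - f y - l * (x - y)) <= e * Cmod (x - y).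
Proof.
  intros HR Hf Hl e He.
  destruct (holo_divide f c R0 HR Hf) as [q [Hq Eq]].
  assert (Cq := holo_cont _ _ _ Hq (ball_at_center c R0 HR)).
  assert (El : q c = l).
  { destruct (Hq c (ball_at_center c R0 HR)) as [k Hk].
    apply (dC_unique f c); auto.
    apply (dC_ext_loc (fun z => f c + (z - c) * q z)%C f c _ R0); auto.
    - intros w Hw. symmetry. apply Eq. exact Hw.
    - replace (q c) with (RtoC 0 + ((RtoC 1 - RtoC 0) * q c + (c - c) * k))%C by ring.
      apply (dC_plus (fun _ => f c) (fun z => (z - c) * q z)%C); [apply dC_const|].
      apply (dC_mult (fun z => z - c)%C q); auto. apply dC_minus; [apply dC_id|apply dC_const]. }
  destruct (holo_lipschitz q c R0 HR Hq) as [L [d1 [P1 [PL HL]]]].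
  destruct (Cq (e / 2)) as [d2 [P2 H2]]; [lra|].
  exists (Rmin (Rmin d1 d2) (Rmin R0 (e / (2 * L)))). split.
  { repeat apply Rmin_pos; auto. apply Rdiv_lt_0_compat; lra. }
  intros x y Hx Hy.
  assert (m1 := Rmin_l (Rmin d1 d2) (Rmin R0 (e / (2 * L)))).
  assert (m2 := Rmin_r (Rmin d1 d2) (Rmin R0 (e / (2 * L)))).
  assert (m3 := Rmin_l d1 d2). assert (m4 := Rmin_r d1 d2).
  assert (m5 := Rmin_l R0 (e / (2 * L))). assert (m6 := Rmin_r R0 (e / (2 * L))).
  rewrite (Eq x), (Eq y) by (unfold ball_at; lra).
  replace (f c + (x - c) * q x - (f c + (y - c) * q y) - l * (x - y))%C
    with ((q x - q c) * (x - y) + (y - c) * (q x - q y))%C by (rewrite El; ring).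
  eapply Rle_trans; [apply Cmod_triangle|]. rewrite !Cmod_mult.
  specialize (H2 x ltac:(lra)). specialize (HL x y ltac:(lra) ltac:(lra)).
  assert (Q := Cmod_ge_0 (x - y)). assert (Q' := Cmod_ge_0 (y - c)).
  assert (Cmod (q x - q c) * Cmod (x - y) <= e / 2 * Cmod (x - y)) by (apply Rmult_le_compat_r; lra).
  assert (Cmod (y - c) * Cmod (q x - q y) <= (e / (2 * L)) * (L * Cmod (x - y))).
  { apply Rmult_le_compat; try lra. apply Cmod_ge_0. }
  replace (e / (2 * L) * (L * Cmod (x - y))) with (e / 2 * Cmod (x - y)) in H0 by (field; lra). lra.
Qed.

(* Averaging over [r, ir, -r, -ir] annihilates the Taylor terms of degrees one to three. *)
Lemma four_point_mean (G : C -> C) R0 : 0 < R0 -> holo (ball_at (RtoC 0) R0) G ->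
  exists B d, 0 < d /\ 0 < B /\ forall r, 0 < r < d ->
    4 * Cmod (G (RtoC 0)) ^ 2 - B * r ^ 3 <=
    Cmod (G (RtoC r)) ^ 2 + Cmod (G (RtoC r * Ci)%C) ^ 2 +
    Cmod (G (RtoC (- r))) ^ 2 + Cmod (G (RtoC (- r) * Ci)%C) ^ 2.
Proof.
  intros HR HG.
  destruct (holo_divide G _ R0 HR HG) as [q1 [H1 E1]].
  destruct (holo_divide q1 _ R0 HR H1) as [q2 [H2 E2]].
  destruct (holo_divide q2 _ R0 HR H2) as [q3 [H3 E3]].
  destruct (holo_locally_bounded q3 (RtoC 0) R0 (R0 / 2) H3 ltac:(lra)) as [M [PM HM]].
  set (g0 := G (RtoC 0)) in *. set (g1 := q1 (RtoC 0)) in *. set (g2 := q2 (RtoC 0)) in *.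
  (* With [t = r ^ 3 * M] the lower bound comes from [4 (Cmod g0 - t) ^ 2], whose cross term is
     [8 * Cmod g0 * t]; the [+ 1] only makes the constant positive. *)
  exists (8 * Cmod g0 * M + 1), (R0 / 2). split; [lra|].
  assert (P0 := Cmod_ge_0 g0). split; [nra|].
  intros r Hr.
  assert (Ex : forall z, Cmod z = r -> G z = (g0 + g1 * z + g2 * z ^ 2 + z ^ 3 * q3 z)%C /\
     Cmod (z ^ 3 * q3 z) <= r ^ 3 * M).
  { intros z Hz. assert (Hb : ball_at (RtoC 0) R0 z).
    { unfold ball_at. replace (z - 0)%C with z by ring. lra. }
    split.
    - rewrite (E1 z Hb), (E2 z Hb), (E3 z Hb). ring.
    - rewrite Cmod_mult, Cmod_pow, Hz. apply Rmult_le_compat_l; [apply pow_le; lra|].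
      apply HM. replace (z - 0)%C with z by ring. lra. }
  assert (A1 : Cmod (RtoC r) = r) by (rewrite Cmod_R, Rabs_pos_eq; lra).
  assert (A2 : Cmod (RtoC r * Ci) = r) by (rewrite Cmod_mult, Cmod_Ci, A1; ring).
  assert (A3 : Cmod (RtoC (- r)) = r) by (rewrite Cmod_R, Rabs_Ropp, Rabs_pos_eq; lra).
  assert (A4 : Cmod (RtoC (- r) * Ci) = r) by (rewrite Cmod_mult, Cmod_Ci, A3; ring).
  destruct (Ex _ A1) as [X1 Y1]. destruct (Ex _ A2) as [X2 Y2].
  destruct (Ex _ A3) as [X3 Y3]. destruct (Ex _ A4) as [X4 Y4].
  set (a := G (RtoC r)) in *. set (b := G (RtoC r * Ci)%C) in *.
  set (c := G (RtoC (- r))) in *. set (e := G (RtoC (- r) * Ci)%C) in *.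
  set (u1 := (RtoC r ^ 3 * q3 (RtoC r))%C) in *.
  set (u2 := ((RtoC r * Ci) ^ 3 * q3 (RtoC r * Ci))%C) in *.
  set (u3 := (RtoC (- r) ^ 3 * q3 (RtoC (- r)))%C) in *.
  set (u4 := ((RtoC (- r) * Ci) ^ 3 * q3 (RtoC (- r) * Ci))%C) in *.
  assert (I2 : (Ci * Ci)%C = (- RtoC 1)%C).
  { unfold Ci, Cmult, Copp, RtoC. simpl. f_equal; ring. }
  assert (S : (a + b + c + e)%C = (RtoC 4 * g0 + (u1 + u2 + u3 + u4))%C).
  { rewrite X1, X2, X3, X4. rewrite RtoC_opp. simpl Cpow.
    replace (RtoC r * Ci * (RtoC r * Ci * RtoC 1))%C with (RtoC r * RtoC r * (Ci * Ci))%C by ring.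
    replace (- RtoC r * Ci * (- RtoC r * Ci * RtoC 1))%C with (RtoC r * RtoC r * (Ci * Ci))%C by ring.
    rewrite I2.
    replace (RtoC 4) with (RtoC 1 + RtoC 1 + RtoC 1 + RtoC 1)%C
      by (rewrite <- !RtoC_plus; f_equal; ring).
    ring. }
  set (t := r ^ 3 * M) in *.
  assert (Pt : 0 <= t) by (unfold t; apply Rmult_le_pos; [apply pow_le|]; lra).
  assert (SL : 4 * Cmod g0 - 4 * t <= Cmod a + Cmod b + Cmod c + Cmod e).
  { assert (T1 := Cmod_triangle (a + b + c) e). assert (T2 := Cmod_triangle (a + b) c).
    assert (T3 := Cmod_triangle a b).
    assert (T4 := Cmod_triangle (u1 + u2 + u3) u4). assert (T5 := Cmod_triangle (u1 + u2) u3).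
    assert (T6 := Cmod_triangle u1 u2).
    assert (T7 := Cmod_rev_triangle (RtoC 4 * g0) (- (u1 + u2 + u3 + u4))).
    rewrite Cmod_opp in T7.
    replace (RtoC 4 * g0 - - (u1 + u2 + u3 + u4))%C with (a + b + c + e)%C in T7 by (rewrite S; ring).
    rewrite Cmod_mult, Cmod_R, Rabs_pos_eq in T7 by lra. lra. }
  assert (Pa := Cmod_ge_0 a). assert (Pb := Cmod_ge_0 b). assert (Pc := Cmod_ge_0 c). assert (Pe := Cmod_ge_0 e).
  replace ((8 * Cmod g0 * M + 1) * r ^ 3) with (8 * Cmod g0 * t + r ^ 3) by (unfold t; ring).
  assert (Pr3 : 0 <= r ^ 3) by (apply pow_le; lra).
  set (x := Cmod a) in *. set (y := Cmod b) in *. set (z := Cmod c) in *. set (w := Cmod e) in *.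
  set (g := Cmod g0) in *.
  assert (CSq : (x + y + z + w) ^ 2 <= 4 * (x ^ 2 + y ^ 2 + z ^ 2 + w ^ 2)).
  { assert (Q1 := Rle_0_sqr (x - y)). assert (Q2 := Rle_0_sqr (x - z)). assert (Q3 := Rle_0_sqr (x - w)).
    assert (Q4 := Rle_0_sqr (y - z)). assert (Q5 := Rle_0_sqr (y - w)). assert (Q6 := Rle_0_sqr (z - w)).
    unfold Rsqr in *. nra. }
  destruct (Rle_lt_dec (g - t) 0) as [G0|G0].
  - assert (0 <= x ^ 2 + y ^ 2 + z ^ 2 + w ^ 2) by nra. nra.
  - assert ((4 * g - 4 * t) ^ 2 <= (x + y + z + w) ^ 2) by (apply pow_incr; lra). nra.
Qed.

(** A continuous lift is holomorphic where [f'] does not vanish: the slope of [h] is the slope of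
    [phi] divided by the slope of [f] along [h], and this quotient is continuous at [z]. *)
Lemma lift_dC (f phi h : C -> C) z k l d : 0 < d ->
  (forall w, Cmod (w - z) < d -> f (h w) = phi w) -> cont_at h z ->
  dC phi z k -> dC f (h z) l -> l <> RtoC 0 -> dC h z (k / l)%C.
Proof.
  intros Pd E Ch Hphi Hf Nl.
  apply dC_slope in Hphi, Hf.
  destruct Hphi as [s [Cs [Es Fs]]]. destruct Hf as [t [Ct [Et Ft]]].
  assert (Cth : cont_at (fun w => t (h w)) z) by (apply (cont_comp t h); auto).
  assert (Nth : t (h z) <> RtoC 0) by congruence.
  destruct (cont_neq _ z _ Cth Nth) as [d2 [P2 N2]].
  assert (m1 := Rmin_l d d2). assert (m2 := Rmin_r d d2).
  apply (dC_ext_loc (fun w => h z + (s w / t (h w)) * (w - z))%C h z _ (Rmin d d2)).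
  - apply Rmin_pos; auto.
  - intros w Hw. assert (N := N2 w ltac:(lra)).
    assert (X := E w ltac:(lra)). assert (X0 := E z ltac:(rewrite Cmod_self; auto)).
    rewrite (Ft (h w)), (Fs w), X0 in X.
    assert (Y : (t (h w) * (h w - h z))%C = (s w * (w - z))%C).
    { replace (t (h w) * (h w - h z))%C with ((phi z + t (h w) * (h w - h z)) - phi z)%C by ring.
      rewrite X. ring. }
    replace (s w / t (h w) * (w - z))%C with ((s w * (w - z)) / t (h w))%C by (field; auto).
    rewrite <- Y. field. auto.
  - apply dC_slope. exists (fun w => s w / t (h w))%C. split; [|split].
    + apply (cont_div s (fun w => t (h w))); auto.
    + congruence.
    + intros w. ring.
Qed.

Lemma dC_pow_sub a n z : dC (fun w => (w - a) ^ S n)%C z (RtoC (INR (S n)) * (z - a) ^ n)%C.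
Proof.
  assert (D1 : dC (fun w => w - a)%C z (RtoC 1)).
  { replace (RtoC 1) with (RtoC 1 - RtoC 0)%C by ring. apply dC_minus; [apply dC_id|apply dC_const]. }
  induction n.
  - apply (dC_ext (fun w => w - a)%C); [intros; simpl; ring|]. simpl. rewrite Cmult_1_r. exact D1.
  - assert (T := dC_mult (fun w => w - a)%C (fun w => (w - a) ^ S n)%C z _ _ D1 IHn).
    apply (dC_ext (fun w => (w - a) * (w - a) ^ S n)%C); [intros; reflexivity|].
    rewrite S_INR, RtoC_plus.
    replace ((RtoC (INR (S n)) + RtoC 1) * (z - a) ^ S n)%C
      with (RtoC 1 * (z - a) ^ S n + (z - a) * (RtoC (INR (S n)) * (z - a) ^ n))%C by (simpl Cpow; ring).
    exact T.
Qed.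

Lemma dC_bound (f : C -> C) z l L d : 0 < d ->
  (forall w, Cmod (w - z) < d -> Cmod (f w - f z) <= L * Cmod (w - z)) -> dC f z l -> Cmod l <= L.
Proof.
  intros Pd H Hl. apply le_epsilon. intros e He.
  destruct (Hl e He) as [d2 [P2 H2]].
  assert (m1 := Rmin_l d d2). assert (m2 := Rmin_r d d2).
  assert (Pm : 0 < Rmin d d2) by (apply Rmin_pos; auto).
  destruct (ball_point z (Rmin d d2 / 2)) as [w [Nw Ew]]; [lra|].
  specialize (H w ltac:(lra)). specialize (H2 w ltac:(lra)).
  assert (T := Cmod_sub_le (f w - f z) (f w - f z - l * (w - z))).
  replace (f w - f z - (f w - f z - l * (w - z)))%C with (l * (w - z))%C in T by ring.
  rewrite Cmod_mult in T. apply Rmult_le_reg_r with (Cmod (w - z)); [lra|]. nra.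
Qed.

(* The zeros of [f'] being isolated, a continuous local section is holomorphic off the
   base point, hence also there by removability. *)
Lemma section_deriv_neq0 (f s : C -> C) x0 R0 e l :
  0 < R0 -> holo (ball_at x0 R0) f -> 0 < e ->
  (forall y, Cmod (y - f x0) < e -> f (s y) = y /\ cont_at s y) -> s (f x0) = x0 ->
  dC f x0 l -> l <> RtoC 0.
Proof.
  intros HR Hf He Hs Es Hl. set (y0 := f x0) in *.
  assert (C0 : cont_at s y0) by (apply Hs; rewrite Cmod_self; auto).
  assert (Hg : holo (ball_at x0 R0) (fun z => f z - y0)%C) by (apply holo_minus; auto; apply holo_const).
  destruct (order_dichotomy _ x0 R0 HR Hg) as [Z|[m [q [Hq [Nq Eq]]]]].
  { exfalso. destruct (C0 R0 HR) as [d [Pd Hd]].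
    assert (Pm : 0 < Rmin d e) by (apply Rmin_pos; auto).
    assert (m1 := Rmin_l d e). assert (m2 := Rmin_r d e).
    destruct (ball_point y0 (Rmin d e / 2)) as [y [Ny Ey]]; [lra|].
    assert (T := Z (s y)). rewrite (proj1 (Hs y ltac:(lra))) in T.
    apply Ny. replace y with (y - y0 + y0)%C by ring. rewrite T; [ring|].
    unfold ball_at. rewrite <- Es. apply Hd. lra. }
  destruct m as [|m].
  { exfalso. apply Nq. assert (T := Eq x0 (ball_at_center x0 R0 HR)). simpl in T.
    rewrite Cmult_1_l in T. rewrite <- T. unfold y0. ring. }
  assert (Cq := holo_cont _ _ _ Hq (ball_at_center x0 R0 HR)).
  destruct (holo_lipschitz q x0 R0 HR Hq) as [L [d1 [P1 [PL HL]]]].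
  set (Q := Cmod (q x0)). assert (PQ : 0 < Q) by (apply Cmod_gt_0; auto).
  destruct (Cq (Q / 2)) as [d2 [P2 H2]]; [lra|].
  set (d := Rmin (Rmin d1 d2) (Rmin R0 (Q / (2 * L + 1)))).
  assert (PQL : 0 < Q / (2 * L + 1)) by (apply Rdiv_lt_0_compat; lra).
  assert (Pd : 0 < d) by (unfold d; repeat apply Rmin_pos; auto).
  assert (m1 := Rmin_l (Rmin d1 d2) (Rmin R0 (Q / (2 * L + 1)))).
  assert (m2 := Rmin_r (Rmin d1 d2) (Rmin R0 (Q / (2 * L + 1)))).
  assert (m3 := Rmin_l d1 d2). assert (m4 := Rmin_r d1 d2).
  assert (m5 := Rmin_l R0 (Q / (2 * L + 1))). assert (m6 := Rmin_r R0 (Q / (2 * L + 1))).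
  fold d in m1, m2.
  (* From [f - y0 = (z - x0) ^ (m+1) q] the derivative is [(z - x0) ^ m ((m+1) q + (z - x0) q')];
     [d] is so small that the bracket stays away from zero. *)
  assert (Df : forall z, z <> x0 -> Cmod (z - x0) < d -> exists k, dC f z k /\ k <> RtoC 0).
  { intros z Nz Hz. assert (Hzb : ball_at x0 R0 z) by (unfold ball_at; lra).
    destruct (Hq z Hzb) as [k Hk]. assert (Pz := Cmod_sub_neq _ _ Nz).
    assert (Bk : Cmod k <= L).
    { apply (dC_bound q z k L (d1 - Cmod (z - x0))); auto; [lra|].
      intros w Hw. apply HL; [|lra]. assert (T := Cmod_triangle3 w z x0). lra. }
    exists (RtoC (INR (S m)) * (z - x0) ^ m * q z + (z - x0) ^ S m * k)%C. split.
    - apply (dC_ext_loc (fun w => y0 + (w - x0) ^ S m * q w)%C f z _ (R0 - Cmod (z - x0))); [lra| |].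
      + intros w Hw. rewrite <- Eq; [ring|]. unfold ball_at. assert (T := Cmod_triangle3 w z x0). lra.
      + replace (RtoC (INR (S m)) * (z - x0) ^ m * q z + (z - x0) ^ S m * k)%C
          with (RtoC 0 + (RtoC (INR (S m)) * (z - x0) ^ m * q z + (z - x0) ^ S m * k))%C by ring.
        apply (dC_plus (fun _ => y0) (fun w => (w - x0) ^ S m * q w)%C); [apply dC_const|].
        apply (dC_mult (fun w => (w - x0) ^ S m)%C q); auto. apply dC_pow_sub.
    - replace (RtoC (INR (S m)) * (z - x0) ^ m * q z + (z - x0) ^ S m * k)%C
        with ((z - x0) ^ m * (RtoC (INR (S m)) * q z + (z - x0) * k))%C by (simpl Cpow; ring).
      apply Cmult_neq_0; [apply Cpow_nz; apply Cmod_gt_0; auto|].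
      apply Cmod_gt_0.
      assert (T := Cmod_rev_triangle (RtoC (INR (S m)) * q z) (- ((z - x0) * k))).
      replace (RtoC (INR (S m)) * q z - - ((z - x0) * k))%C
        with (RtoC (INR (S m)) * q z + (z - x0) * k)%C in T by ring.
      rewrite Cmod_opp, !Cmod_mult, Cmod_R, Rabs_pos_eq in T by apply pos_INR.
      assert (Hqz := H2 z ltac:(lra)). assert (T2 := Cmod_rev_triangle (q x0) (q z)).
      rewrite (Cmod_sub_comm (q x0)) in T2. fold Q in T2.
      assert (I1 : 1 <= INR (S m)) by (rewrite S_INR; assert (X := pos_INR m); lra).
      assert (Cmod (z - x0) * Cmod k <= Q / (2 * L + 1) * L).
      { apply Rmult_le_compat; try apply Cmod_ge_0; lra. }
      assert (Q / (2 * L + 1) * L < Q / 2).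
      { apply Rmult_lt_reg_r with (2 * L + 1); [lra|].
        replace (Q / (2 * L + 1) * L * (2 * L + 1)) with (Q * L) by (field; lra). nra. }
      nra. }
  destruct (C0 d Pd) as [e1 [Pe1 He1]].
  set (e2 := Rmin e e1). assert (Pe2 : 0 < e2) by (apply Rmin_pos; auto).
  assert (n1 := Rmin_l e e1). assert (n2 := Rmin_r e e1). fold e2 in n1, n2.
  rewrite Es in He1.
  assert (Ds : forall y, y <> y0 -> Cmod (y - y0) < e2 -> exists k, dC s y k).
  { intros y Ny Hy. destruct (Hs y ltac:(lra)) as [E1 Cy].
    destruct (Df (s y)) as [k [Hk Nk]].
    - intros E. apply Ny. rewrite <- E1, E. reflexivity.
    - apply He1; lra.
    - exists (RtoC 1 / k)%C.
      apply (lift_dC f (fun w => w) s y (RtoC 1) k (e - Cmod (y - y0))); auto; [lra| |apply dC_id].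
      intros w Hw. apply Hs. assert (T := Cmod_triangle3 w y y0). lra. }
  (* The extra factor makes the function differentiable at [y0] with slope [s - x0], by mere
     continuity of [s]; dividing the factor out again removes the singularity. *)
  set (K := fun y => ((y - y0) * (s y - x0))%C).
  assert (HK : holo (ball_at y0 e2) K).
  { intros y Hy. destruct (Ceq_dec y y0) as [E|Ny].
    - subst y. exists (RtoC 0). apply dC_slope. exists (fun y => s y - x0)%C.
      split; [|split].
      + apply cont_minus; auto. apply cont_const.
      + rewrite Es. ring.
      + intros w. unfold K. ring.
    - destruct (Ds y Ny Hy) as [k Hk].
      exists ((RtoC 1 - RtoC 0) * (s y - x0) + (y - y0) * (k - RtoC 0))%C.
      apply (dC_mult (fun y => y - y0)%C (fun y => s y - x0)%C);
        apply dC_minus; auto; try apply dC_id; apply dC_const. }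
  destruct (holo_divide K y0 e2 Pe2 HK) as [S0 [HS ES]].
  assert (ES1 : forall y, y <> y0 -> Cmod (y - y0) < e2 -> s y = (x0 + S0 y)%C).
  { intros y Ny Hy. assert (T := ES y Hy). unfold K in T.
    assert (N : (y - y0)%C <> RtoC 0) by (apply Cmod_gt_0, Cmod_sub_neq; auto).
    replace (s y) with (x0 + ((y - y0) * (s y - x0)) / (y - y0))%C by (field; auto).
    rewrite T. field. auto. }
  assert (CS := holo_cont _ _ _ HS (ball_at_center y0 e2 Pe2)).
  assert (ES0 : S0 y0 = RtoC 0).
  { apply cont_limit_eq; auto. intros a Pa. destruct (C0 a Pa) as [b [Pb Hb]].
    exists (Rmin b e2). split; [apply Rmin_pos; auto|]. intros w Hw.
    assert (k1 := Rmin_l b e2). assert (k2 := Rmin_r b e2).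
    specialize (Hb w ltac:(lra)). rewrite Es, (ES1 w) in Hb; [|intros E; rewrite E, Cmod_self in Hw; lra|lra].
    replace (x0 + S0 w - x0)%C with (S0 w) in Hb by ring. replace (S0 w - 0)%C with (S0 w) by ring. lra. }
  destruct (HS y0 (ball_at_center y0 e2 Pe2)) as [k Hk].
  assert (Dsy : dC s y0 (RtoC 0 + k)%C).
  { apply (dC_ext_loc (fun y => x0 + S0 y)%C s y0 _ e2); auto.
    - intros w Hw. destruct (Ceq_dec w y0) as [E|N]; [rewrite E, ES0, Es; ring|].
      symmetry; apply ES1; auto.
    - apply (dC_plus (fun _ => x0) S0); auto. apply dC_const. }
  assert (Dfs : dC (fun y => f (s y)) y0 (l * (RtoC 0 + k))%C).
  { apply dC_comp; auto. rewrite Es. exact Hl. }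
  assert (Did : dC (fun y => f (s y)) y0 (RtoC 1)).
  { apply (dC_ext_loc (fun y => y) _ y0 _ e); auto; [|apply dC_id].
    intros w Hw. symmetry. apply Hs. exact Hw. }
  intros E. assert (T := dC_unique _ _ _ _ Dfs Did). rewrite E in T.
  apply C1_nz. rewrite <- T. ring.
Qed.

Lemma dC0_const (F : C -> C) c r : (forall z, ball_at c r z -> dC F z (RtoC 0)) ->
  forall z, ball_at c r z -> F z = F c.
Proof.
  intros H z Hz. assert (T := seg_FTC F (fun _ => RtoC 0) c z). rewrite seg_const in T.
  assert (T' : (RtoC 0 * (z - c))%C = (F z - F c)%C).
  { apply T.
    - intros t Ht. apply H. apply ball_convex; auto. unfold ball_at in *. rewrite Cmod_self.
      assert (Q := Cmod_ge_0 (z - c)). lra.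
    - intros t _. apply cont_const. }
  replace (F z) with (F z - F c + F c)%C by ring. rewrite <- T'. ring.
Qed.

(** The primitive [F] of [1 / z] is normalised at [1]; the quotient of [exp] of it by [z] has
    derivative zero and equals [1] at the centre. *)
Lemma Clog_exists : exists lg, holo (ball_at (RtoC 1) 1) lg /\ lg (RtoC 1) = RtoC 0 /\
  forall z, ball_at (RtoC 1) 1 z -> Cexp (lg z) = z.
Proof.
  assert (N : forall z, ball_at (RtoC 1) 1 z -> z <> RtoC 0).
  { intros z Hz E. subst z. unfold ball_at in Hz. replace (0 - 1)%C with (- RtoC 1)%C in Hz by ring.
    rewrite Cmod_opp, Cmod_1 in Hz. lra. }
  assert (D1 : forall z, ball_at (RtoC 1) 1 z -> dC (fun z => / z)%C z (- RtoC 1 / (z * z))%C).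
  { intros z Hz. apply (dC_inv (fun z => z)); [auto|apply dC_id]. }
  destruct (primitive_exists (RtoC 1) (RtoC 1) 1 (fun z => / z)%C) as [F HF].
  { apply ball_at_center; lra. }
  { intros z Hz. eapply dC_cont; auto. }
  { intros z Hz _. eexists; auto. }
  exists (fun z => F z - F (RtoC 1))%C.
  assert (DF : forall z, ball_at (RtoC 1) 1 z -> dC (fun z => F z - F (RtoC 1))%C z (/ z - RtoC 0)%C).
  { intros z Hz. apply dC_minus; [auto|apply dC_const]. }
  split; [|split].
  - intros z Hz. eexists; auto.
  - ring.
  - intros z Hz.
    assert (T := dC0_const (fun z => Cexp (F z - F (RtoC 1)) / z)%C (RtoC 1) 1).
    assert (E : (Cexp (F z - F (RtoC 1)) / z)%C = RtoC 1).
    { rewrite T; auto.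
      - replace (F 1 - F 1)%C with (RtoC 0) by ring. rewrite Cexp_0. field; apply C1_nz.
      - intros w Hw. assert (Nw := N w Hw).
        replace (RtoC 0) with
          (((Cexp (F w - F (RtoC 1)) * (/ w - RtoC 0)) * w - Cexp (F w - F (RtoC 1)) * RtoC 1) / (w * w))%C
          by (field; auto).
        apply (dC_div (fun z => Cexp (F z - F (RtoC 1)))%C (fun z => z)); [exact Nw| |apply dC_id].
        apply (dC_comp Cexp (fun z => F z - F (RtoC 1))%C); [apply DF; exact Hw|apply dC_Cexp]. }
    assert (Nz := N z Hz).
    replace (Cexp (F z - F (RtoC 1))) with (Cexp (F z - F (RtoC 1)) / z * z)%C by (field; auto).
    rewrite E. ring.
Qed.

(** * Lifting through a covering *)

(** Continuous induction on [0, 1]. Near each [s] the property moves rightwards between any two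
    points, so at the supremum of the points where it holds it passes beyond, unless this supremum
    is [1]. *)
Lemma interval_chain (P : R -> Prop) : P 0 ->
  (forall s, 0 <= s <= 1 -> exists d, 0 < d /\ forall a b, 0 <= a <= b -> b <= 1 ->
     s - d < a -> b < s + d -> P a -> P b) -> P 1.
Proof.
  intros H0 H.
  destruct (completeness (fun x => 0 <= x <= 1 /\ P x)) as [m [Hm1 Hm2]].
  - exists 1. intros x [Hx _]. lra.
  - exists 0. split; [lra|auto].
  - assert (M0 : 0 <= m) by (apply Hm1; split; [lra|auto]).
    assert (M1 : m <= 1) by (apply Hm2; intros x [Hx _]; lra).
    destruct (H m ltac:(lra)) as [d [Pd Hd]].
    destruct (classic (exists a, m - d < a /\ 0 <= a <= 1 /\ P a)) as [[a [Ha1 [Ha2 Ha3]]]|N].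
    + assert (Ham : a <= m) by (apply Hm1; auto).
      set (b := Rmin 1 (m + d / 2)).
      assert (b1 := Rmin_l 1 (m + d / 2)). assert (b2 := Rmin_r 1 (m + d / 2)). fold b in b1, b2.
      assert (Hb : m <= b) by (apply Rmin_glb; lra).
      assert (Pb : P b) by (apply (Hd a b); auto; lra).
      assert (b <= m) by (apply Hm1; split; [lra|auto]).
      assert (b = 1).
      { unfold b, Rmin in *. destruct (Rle_dec 1 (m + d / 2)); auto. lra. }
      rewrite <- H2. exact Pb.
    + exfalso. assert (m <= m - d); [|lra].
      apply Hm2. intros x [Hx1 Hx2]. destruct (Rle_lt_dec x (m - d)); auto.
      exfalso. apply N. exists x. auto.
Qed.

Definition cpath (u v : R) (l : R -> C) : Prop :=
  forall t, u <= t <= v -> forall e, 0 < e -> exists d, 0 < d /\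
    forall s, u <= s <= v -> Rabs (s - t) < d -> Cmod (l s - l t) < e.

Lemma cpath_glue a b g k : 0 <= a <= b -> cpath 0 a g -> cpath a b k -> g a = k a ->
  cpath 0 b (fun t => if Rle_dec t a then g t else k t).
Proof.
  intros Hab Hg Hk E t Ht e He.
  destruct (Rlt_le_dec t a) as [L|L].
  - destruct (Hg t ltac:(lra) e He) as [d [Pd Hd]]. exists (Rmin d (a - t)).
    split; [apply Rmin_pos; lra|]. intros s Hs Hst.
    assert (m1 := Rmin_l d (a - t)). assert (m2 := Rmin_r d (a - t)).
    assert (s < a) by (assert (T := Rle_abs (s - t)); lra).
    destruct (Rle_dec t a); [|lra]. destruct (Rle_dec s a); [|lra]. apply Hd; lra.
  - destruct (Rle_lt_dec t a) as [L2|L2].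
    + assert (t = a) by lra. subst t.
      destruct (Hg a ltac:(lra) e He) as [d1 [P1 H1]]. destruct (Hk a ltac:(lra) e He) as [d2 [P2 H2]].
      exists (Rmin d1 d2). split; [apply Rmin_pos; auto|]. intros s Hs Hst.
      assert (m1 := Rmin_l d1 d2). assert (m2 := Rmin_r d1 d2).
      destruct (Rle_dec a a); [|lra]. destruct (Rle_dec s a).
      * apply H1; lra.
      * rewrite E. apply H2; lra.
    + destruct (Hk t ltac:(lra) e He) as [d [Pd Hd]]. exists (Rmin d (t - a)).
      split; [apply Rmin_pos; lra|]. intros s Hs Hst.
      assert (m1 := Rmin_l d (t - a)). assert (m2 := Rmin_r d (t - a)).
      assert (a < s) by (assert (T := Rle_abs (- (s - t))); rewrite Rabs_Ropp in T; lra).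
      destruct (Rle_dec t a); [lra|]. destruct (Rle_dec s a); [lra|]. apply Hd; lra.
Qed.

Section Lifting.
Variables (f : C -> C) (X Y : C -> Prop).
Hypothesis Hcov : Defs.covering f X Y.

Lemma covering_chart y : Y y -> exists N (I : Type) (S : I -> C -> Prop),
  (exists d, 0 < d /\ forall v, Cmod (v - y) < d -> N v) /\
  (forall i z, S i z -> exists d, 0 < d /\ forall w, Cmod (w - z) < d -> S i w) /\
  (forall i j z, S i z -> S j z -> i = j) /\
  (forall z, X z -> N (f z) -> exists i, S i z) /\
  (forall i z, S i z -> X z) /\
  (forall i, exists s : C -> C, (forall v, N v -> S i (s v) /\ f (s v) = v /\ cont_at s v) /\
     (forall z, S i z -> s (f z) = z)).
Proof.
  intros Hy. destruct Hcov as [_ [_ H]]. destruct (H y Hy) as [N [ON [Ny [NY [I [S [OS [DS [PS HS]]]]]]]]].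
  exists N, I, S. split; [|split; [|split; [|split; [|split]]]].
  - apply (proj1 (C_open_ball N) ON); auto.
  - intros i z Hz. apply (proj1 (C_open_ball (S i)) (OS i)); auto.
  - exact DS.
  - intros z Hz Nz. apply PS. auto.
  - intros i z Hz. apply PS. exists i. exact Hz.
  - intros i. destruct (HS i) as [_ [s [H1 H2]]]. exists s. split; auto.
    intros v Hv. destruct (H1 v Hv) as [A [B C0]]. split; [|split]; auto.
    apply C_continuous_cont_at. exact C0.
Qed.

(** Near each time the two lifts stay in one sheet each. Agreement at one nearby time identifies the
    sheets by disjointness, and then the section over the sheet recovers both lifts from their
    common image. *)
Lemma path_lift_unique l1 l2 : cpath 0 1 l1 -> cpath 0 1 l2 ->
  (forall t, 0 <= t <= 1 -> X (l1 t) /\ X (l2 t) /\ f (l1 t) = f (l2 t)) ->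
  l1 0 = l2 0 -> l1 1 = l2 1.
Proof.
  intros C1 C2 H E0. apply (interval_chain (fun t => l1 t = l2 t)); auto.
  intros s Hs. destruct (H s Hs) as [X1 [X2 E]].
  destruct (covering_chart (f (l1 s))) as [N [I [S [[e [Pe He]] [OS [DS [PS [_ HS]]]]]]]].
  { apply Hcov. exact X1. }
  assert (Ny : N (f (l1 s))) by (apply He; rewrite Cmod_self; auto).
  destruct (PS _ X1 Ny) as [i Hi]. rewrite E in Ny. destruct (PS _ X2 Ny) as [j Hj].
  destruct (OS i _ Hi) as [d1 [P1 H1]]. destruct (OS j _ Hj) as [d2 [P2 H2]].
  destruct (C1 s Hs d1 P1) as [e1 [Pe1 He1]]. destruct (C2 s Hs d2 P2) as [e2 [Pe2 He2]].
  exists (Rmin e1 e2). split; [apply Rmin_pos; auto|]. intros a b Ha Hb Has Hbs Ea.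
  assert (m1 := Rmin_l e1 e2). assert (m2 := Rmin_r e1 e2).
  assert (Ra : Rabs (a - s) < Rmin e1 e2) by (apply Rabs_def1; lra).
  assert (Rb : Rabs (b - s) < Rmin e1 e2) by (apply Rabs_def1; lra).
  assert (Sa1 : S i (l1 a)) by (apply H1, He1; lra).
  assert (Sa2 : S j (l2 a)) by (apply H2, He2; lra).
  rewrite <- Ea in Sa2. assert (i = j) by (eapply DS; eauto). subst j.
  assert (Sb1 : S i (l1 b)) by (apply H1, He1; lra).
  assert (Sb2 : S i (l2 b)) by (apply H2, He2; lra).
  destruct (HS i) as [sec [_ Hsec]]. rewrite <- (Hsec _ Sb1), <- (Hsec _ Sb2).
  f_equal. apply H. lra.
Qed.

Lemma covering_locally_injective x : X x -> exists d, 0 < d /\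
  forall a b, Cmod (a - x) < d -> Cmod (b - x) < d -> f a = f b -> a = b.
Proof.
  intros Hx. destruct (covering_chart (f x)) as [N [I [S [[e [Pe He]] [OS [DS [PS [_ HS]]]]]]]].
  { apply Hcov. exact Hx. }
  destruct (PS x Hx) as [i Hi]. { apply He. rewrite Cmod_self. auto. }
  destruct (OS i x Hi) as [d [Pd Hd]]. exists d. split; auto. intros a b Ha Hb E.
  destruct (HS i) as [sec [_ Hsec]]. rewrite <- (Hsec _ (Hd a Ha)), <- (Hsec _ (Hd b Hb)), E. reflexivity.
Qed.

Lemma covering_deriv_neq0 x l : X x -> (exists R0, 0 < R0 /\ holo (ball_at x R0) f) ->
  dC f x l -> l <> RtoC 0.
Proof.
  intros Hx [R0 [HR Hf]] Hl.
  destruct (covering_chart (f x)) as [N [I [S [[e [Pe He]] [OS [DS [PS [_ HS]]]]]]]].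
  { apply Hcov. exact Hx. }
  destruct (PS x Hx) as [i Hi]. { apply He. rewrite Cmod_self. auto. }
  destruct (HS i) as [sec [H1 H2]].
  apply (section_deriv_neq0 f sec x R0 e l HR Hf Pe); auto.
  intros y Hy. destruct (H1 y (He y Hy)) as [_ T]. exact T.
Qed.

Variables (L : C -> Prop) (p0 x0 : C) (phi : C -> C).
Hypothesis Lconv : convex L.
Hypothesis Lopen : forall z, L z -> exists d, 0 < d /\ forall w, Cmod (w - z) < d -> L w.
Hypothesis Lp0 : L p0.
Hypothesis Hphi : forall z, L z -> Y (phi z) /\ cont_at phi z.
Hypothesis Hx0 : X x0.
Hypothesis Ex0 : f x0 = phi p0.

Definition is_path_lift (s : R) (z : C) (l : R -> C) : Prop :=
  l 0 = x0 /\ cpath 0 s l /\ forall t, 0 <= t <= s -> X (l t) /\ f (l t) = phi (pt p0 z t).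

(** Paths to all targets near [z0] are lifted at once. Joint continuity is not recorded: continuity
    of the end values [K s] in the target is enough to see that they all start the next step in the
    same sheet. *)
Definition lifts_near (z0 : C) (s : R) : Prop :=
  exists eta K, 0 < eta /\
    (forall z, Cmod (z - z0) < eta -> is_path_lift s z (fun t => K t z)) /\ cont_at (K s) z0.

Lemma pt_base_dist z z0 t s : 0 <= t <= 1 ->
  Cmod (pt p0 z t - pt p0 z0 s) <= Cmod (z - z0) + Rabs (t - s) * Cmod (z0 - p0).
Proof.
  intros Ht.
  replace (pt p0 z t - pt p0 z0 s)%C with (RtoC t * (z - z0) + RtoC (t - s) * (z0 - p0))%C
    by (unfold pt; rewrite RtoC_minus; ring).
  eapply Rle_trans; [apply Cmod_triangle|]. rewrite !Cmod_mult, !Cmod_R.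
  rewrite (Rabs_pos_eq t) by lra. assert (Q := Cmod_ge_0 (z - z0)). nra.
Qed.

Lemma lifts_near_step z0 s : L z0 -> 0 <= s <= 1 -> exists d, 0 < d /\
  forall a b, 0 <= a <= b -> b <= 1 -> s - d < a -> b < s + d -> lifts_near z0 a -> lifts_near z0 b.
Proof.
  intros Lz0 Hs.
  assert (Ls : L (pt p0 z0 s)) by (apply Lconv; auto).
  destruct (Hphi _ Ls) as [Ys Cs].
  destruct (covering_chart _ Ys) as [N [I [S [[e [Pe He]] [OS [DS [PS [SX HS]]]]]]]].
  destruct (Cs e Pe) as [r [Pr Hr]]. destruct (Lopen z0 Lz0) as [rl [Prl Hrl]].
  assert (Pm : 0 < Cmod (z0 - p0) + 1) by (assert (Q := Cmod_ge_0 (z0 - p0)); lra).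
  set (d := r / 2 / (Cmod (z0 - p0) + 1)).
  assert (Pd : 0 < d) by (apply Rdiv_lt_0_compat; lra).
  assert (Near : forall t z, 0 <= t <= 1 -> Rabs (t - s) < d -> Cmod (z - z0) < r / 2 -> N (phi (pt p0 z t))).
  { intros t z Ht Hts Hz. apply He, Hr. eapply Rle_lt_trans; [apply pt_base_dist; auto|].
    assert (Rabs (t - s) * Cmod (z0 - p0) <= d * (Cmod (z0 - p0) + 1)).
    { apply Rmult_le_compat; try lra; [apply Rabs_pos|apply Cmod_ge_0]. }
    assert (d * (Cmod (z0 - p0) + 1) = r / 2) by (unfold d; field; lra). lra. }
  exists d. split; auto. intros a b Ha Hb Has Hbs [eta [K [Peta [HK CK]]]].
  destruct (HK z0 ltac:(rewrite Cmod_self; auto)) as [_ [_ Ka]].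
  destruct (Ka a ltac:(lra)) as [Xa Fa].
  assert (Nab : forall t z, a <= t <= b -> Cmod (z - z0) < r / 2 -> N (phi (pt p0 z t))).
  { intros t z Ht Hz. apply Near; auto; [lra|]. apply Rabs_def1; lra. }
  destruct (PS _ Xa) as [i Hi].
  { rewrite Fa. apply Nab; [lra|]. rewrite Cmod_self; lra. }
  destruct (OS i _ Hi) as [r2 [Pr2 Hr2]]. destruct (CK r2 Pr2) as [r3 [Pr3 Hr3]].
  destruct (HS i) as [sec [Hsec1 Hsec2]].
  set (eta' := Rmin (Rmin eta rl) (Rmin (r / 2) r3)).
  assert (m1 := Rmin_l (Rmin eta rl) (Rmin (r / 2) r3)). assert (m2 := Rmin_r (Rmin eta rl) (Rmin (r / 2) r3)).
  assert (m3 := Rmin_l eta rl). assert (m4 := Rmin_r eta rl).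
  assert (m5 := Rmin_l (r / 2) r3). assert (m6 := Rmin_r (r / 2) r3). fold eta' in m1, m2.
  assert (Pe' : 0 < eta') by (unfold eta'; repeat apply Rmin_pos; lra).
  assert (Glue : forall z, Cmod (z - z0) < eta' -> K a z = sec (phi (pt p0 z a))).
  { intros z Hz. destruct (HK z ltac:(lra)) as [_ [_ T]]. destruct (T a ltac:(lra)) as [_ E].
    rewrite <- E. symmetry. apply Hsec2, Hr2, Hr3. lra. }
  assert (Csec : forall z t, L z -> a <= t <= b -> Cmod (z - z0) < r / 2 ->
    cont_at (fun w => sec (phi w)) (pt p0 z t)).
  { intros z t Lz Ht Hz. apply (cont_comp sec phi).
    - apply Hphi. apply Lconv; auto. lra.
    - apply Hsec1. apply Nab; auto. }
  (* Beyond time [a] the section of the sheet containing [K a z0] takes over; [Glue] says that it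
     continues every nearby path, not only the central one. *)
  exists eta', (fun t z => if Rle_dec t a then K t z else sec (phi (pt p0 z t))).
  split; auto. split.
  - intros z Hz. destruct (HK z ltac:(lra)) as [T1 [T2 T3]].
    assert (Lz : L z) by (apply Hrl; lra).
    split; [|split].
    + destruct (Rle_dec 0 a); [exact T1|lra].
    + apply (cpath_glue a b (fun t => K t z) (fun t => sec (phi (pt p0 z t)))); auto.
      intros t Ht e' He'. destruct (Csec z t Lz Ht ltac:(lra) e' He') as [d' [Pd' Hd']].
      assert (Pz : 0 < Cmod (z - p0) + 1) by (assert (Q := Cmod_ge_0 (z - p0)); lra).
      exists (d' / (Cmod (z - p0) + 1)). split; [apply Rdiv_lt_0_compat; auto|].
      intros u Hu Hut. apply Hd'. rewrite pt_dist.
      assert (T := Rabs_pos (u - t)). assert (T' := Cmod_ge_0 (z - p0)).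
      apply Rle_lt_trans with (Rabs (u - t) * (Cmod (z - p0) + 1)); [nra|].
      apply Rlt_le_trans with (d' / (Cmod (z - p0) + 1) * (Cmod (z - p0) + 1)).
      * apply Rmult_lt_compat_r; auto.
      * right; field; lra.
    + intros t Ht. destruct (Rle_dec t a); [apply T3; lra|].
      destruct (Hsec1 (phi (pt p0 z t))) as [A1 [A2 _]]; [apply Nab; lra|].
      split; auto. eapply SX; eauto.
  - destruct (Rle_dec b a) as [Q|Q].
    + assert (b = a) by lra. subst b.
      apply (cont_ext_loc (K a) _ z0 1); [lra| |auto]. intros; destruct (Rle_dec a a); [reflexivity|lra].
    + apply (cont_ext_loc (fun z => sec (phi (pt p0 z b))) _ z0 1); [lra| |].
      * intros; destruct (Rle_dec b a); [lra|reflexivity].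
      * apply (cont_comp (fun w => sec (phi w)) (fun z => pt p0 z b)).
        -- unfold pt. apply cont_plus; [apply cont_const|]. apply cont_mult; [apply cont_const|].
           apply cont_minus; [apply cont_id|apply cont_const].
        -- apply Csec; auto; [lra|]. rewrite Cmod_self; lra.
Qed.

Lemma lifts_near_all z0 : L z0 -> lifts_near z0 1.
Proof.
  intros Lz0. apply (interval_chain (lifts_near z0)).
  - exists 1, (fun _ _ => x0). split; [lra|]. split; [|apply cont_const].
    intros z _. split; [reflexivity|split].
    + intros t _ e He. exists 1. split; [lra|]. intros. rewrite Cmod_self. auto.
    + intros t Ht. split; auto. assert (t = 0) by lra. subst t. rewrite pt0. exact Ex0.
  - intros s Hs. apply lifts_near_step; auto.
Qed.

(** The value at [z] is the end of the lifted straight path from [p0], available because [L] is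
    convex. Uniqueness makes the choice of the lift immaterial and lets the local families [K 1]
    prove continuity. *)
Lemma covering_lift : exists h, h p0 = x0 /\
  forall z, L z -> X (h z) /\ f (h z) = phi z /\ cont_at h z.
Proof.
  set (h := fun z => epsilon (inhabits (RtoC 0)) (fun v => exists l, is_path_lift 1 z l /\ l 1 = v)).
  assert (Hh : forall z, L z -> exists l, is_path_lift 1 z l /\ l 1 = h z).
  { intros z Lz. unfold h.
    apply (epsilon_spec (inhabits (RtoC 0)) (fun v => exists l, is_path_lift 1 z l /\ l 1 = v)).
    destruct (lifts_near_all z Lz) as [eta [K [P [HK _]]]].
    exists (K 1 z), (fun t => K t z). split; auto. apply HK. rewrite Cmod_self. auto. }
  assert (Uq : forall z l l', is_path_lift 1 z l -> is_path_lift 1 z l' -> l 1 = l' 1).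
  { intros z l l' [A1 [A2 A3]] [B1 [B2 B3]]. apply path_lift_unique; auto; [|congruence].
    intros t Ht. destruct (A3 t Ht), (B3 t Ht). repeat split; auto. congruence. }
  exists h. split.
  - destruct (Hh p0 Lp0) as [l [Hl El]]. rewrite <- El.
    apply (Uq p0 l (fun _ => x0) Hl). split; [reflexivity|split].
    + intros t _ e He. exists 1. split; [lra|]. intros. rewrite Cmod_self. auto.
    + intros t Ht. split; auto. rewrite Ex0. f_equal. unfold pt. ring.
  - intros z Lz. destruct (Hh z Lz) as [l [Hl El]].
    assert (T := Hl). destruct T as [_ [_ T]]. destruct (T 1 ltac:(lra)) as [T1 T2].
    rewrite El in T1, T2. rewrite pt1 in T2. split; [|split]; auto.
    destruct (lifts_near_all z Lz) as [eta [K [P [HK CK]]]]. destruct (Lopen z Lz) as [r [Pr Hr]].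
    apply (cont_ext_loc (K 1) h z (Rmin eta r)); auto; [apply Rmin_pos; auto|].
    intros w Hw. assert (m1 := Rmin_l eta r). assert (m2 := Rmin_r eta r).
    destruct (Hh w (Hr w ltac:(lra))) as [lw [Hlw Elw]]. rewrite <- Elw.
    apply (Uq w (fun t => K t w) lw); auto. apply HK. lra.
Qed.

(** What makes lifted motions injective: two lifts that meet at one parameter would agree at the
    base parameter. *)
Lemma covering_lift_unique h1 h2 z1 z2 : L z1 -> L z2 ->
  (forall z, L z -> X (h1 z) /\ X (h2 z) /\ f (h1 z) = f (h2 z) /\ cont_at h1 z /\ cont_at h2 z) ->
  h1 z1 = h2 z1 -> h1 z2 = h2 z2.
Proof.
  intros L1 L2 H E.
  assert (Lt : forall t, 0 <= t <= 1 -> L (pt z1 z2 t)) by (intros; apply Lconv; auto).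
  assert (CP : forall h, (forall z, L z -> cont_at h z) -> cpath 0 1 (fun t => h (pt z1 z2 t))).
  { intros h Hh t Ht e He. destruct (Hh _ (Lt t Ht) e He) as [d [Pd Hd]].
    assert (Pz : 0 < Cmod (z2 - z1) + 1) by (assert (Q := Cmod_ge_0 (z2 - z1)); lra).
    exists (d / (Cmod (z2 - z1) + 1)). split; [apply Rdiv_lt_0_compat; auto|].
    intros u Hu Hut. apply Hd. rewrite pt_dist.
    assert (T := Rabs_pos (u - t)). assert (T' := Cmod_ge_0 (z2 - z1)).
    apply Rle_lt_trans with (Rabs (u - t) * (Cmod (z2 - z1) + 1)); [nra|].
    apply Rlt_le_trans with (d / (Cmod (z2 - z1) + 1) * (Cmod (z2 - z1) + 1)).
    + apply Rmult_lt_compat_r; auto.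
    + right; field; lra. }
  assert (T := path_lift_unique (fun t => h1 (pt z1 z2 t)) (fun t => h2 (pt z1 z2 t))).
  cbv beta in T. rewrite !pt0, !pt1 in T. apply T; auto.
  - apply CP. intros z Lz. apply H; auto.
  - apply CP. intros z Lz. apply H; auto.
  - intros t Ht. destruct (H _ (Lt t Ht)) as [A1 [A2 [A3 _]]]. auto.
Qed.
End Lifting.

Lemma covering_lift_holo f X Y L p0 x0 phi :
  Defs.covering f X Y -> (forall x, X x -> exists R0, 0 < R0 /\ holo (ball_at x R0) f) ->
  convex L -> (forall z, L z -> exists d, 0 < d /\ forall w, Cmod (w - z) < d -> L w) ->
  L p0 -> (forall z, L z -> Y (phi z)) -> holo L phi -> X x0 -> f x0 = phi p0 ->
  exists h, h p0 = x0 /\ holo L h /\ forall z, L z -> X (h z) /\ f (h z) = phi z.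
Proof.
  intros Hcov Hf Lconv Lopen Lp0 HY Hphi Hx0 Ex0.
  destruct (covering_lift f X Y Hcov L p0 x0 phi) as [h [H0 H]]; auto.
  { intros z Lz. split; auto. eapply holo_cont; eauto. }
  exists h. split; auto. split.
  - intros z Lz. destruct (H z Lz) as [Xh [Eh Ch]]. destruct (Hphi z Lz) as [k Hk].
    destruct (Hf _ Xh) as [R0 [HR Hfh]]. destruct (Hfh _ (ball_at_center _ _ HR)) as [l Hl].
    destruct (Lopen z Lz) as [d [Pd Hd]].
    exists (k / l)%C. apply (lift_dC f phi h z k l d); auto.
    + intros w Hw. apply H. auto.
    + exact (covering_deriv_neq0 f X Y Hcov (h z) l Xh (Hf _ Xh) Hl).
  - intros z Lz. destruct (H z Lz) as [A [B _]]. auto.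
Qed.

(** * A Phragmen-Lindelof principle in a product of half-planes *)

Definition tends (u : nat -> C) (l : C) : Prop :=
  forall e, 0 < e -> exists N, forall k, (N <= k)%nat -> Cmod (u k - l) < e.

Lemma tends_sub u l s : (forall k, (k <= s k)%nat) -> tends u l -> tends (fun k => u (s k)) l.
Proof.
  intros Hs H e He. destruct (H e He) as [N HN]. exists N. intros k Hk. apply HN.
  specialize (Hs k). lia.
Qed.

Lemma tends_cont f u l : cont_at f l -> tends u l -> tends (fun k => f (u k)) (f l).
Proof.
  intros Cf H e He. destruct (Cf e He) as [d [Pd Hd]]. destruct (H d Pd) as [N HN].
  exists N. intros k Hk. apply Hd, HN, Hk.
Qed.

Lemma tends_const a : tends (fun _ => a) a.
Proof. intros e He. exists O. intros. rewrite Cmod_self. auto. Qed.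

Lemma tends_plus u v a b : tends u a -> tends v b -> tends (fun k => u k + v k)%C (a + b)%C.
Proof.
  intros Hu Hv e He. destruct (Hu (e/2)) as [N HN]; [lra|]. destruct (Hv (e/2)) as [M HM]; [lra|].
  exists (N + M)%nat. intros k Hk.
  replace (u k + v k - (a + b))%C with ((u k - a) + (v k - b))%C by ring.
  eapply Rle_lt_trans; [apply Cmod_triangle|].
  specialize (HN k ltac:(lia)). specialize (HM k ltac:(lia)). lra.
Qed.

Lemma tends_mult u v a b : tends u a -> tends v b -> tends (fun k => u k * v k)%C (a * b)%C.
Proof.
  intros Hu Hv e He.
  assert (Pa := Cmod_ge_0 a). assert (Pb := Cmod_ge_0 b).
  destruct (Hu (Rmin 1 (e / (2 * (Cmod b + 1))))) as [N HN].
  { apply Rmin_pos; [lra|apply Rdiv_lt_0_compat; lra]. }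
  destruct (Hv (e / (2 * (Cmod a + 1)))) as [M HM]; [apply Rdiv_lt_0_compat; lra|].
  exists (N + M)%nat. intros k Hk.
  specialize (HN k ltac:(lia)). specialize (HM k ltac:(lia)).
  assert (m1 := Rmin_l 1 (e / (2 * (Cmod b + 1)))). assert (m2 := Rmin_r 1 (e / (2 * (Cmod b + 1)))).
  replace (u k * v k - a * b)%C with (u k * (v k - b) + (u k - a) * b)%C by ring.
  eapply Rle_lt_trans; [apply Cmod_triangle|]. rewrite !Cmod_mult.
  assert (Uk : Cmod (u k) <= Cmod a + 1) by (assert (T := Cmod_rev_triangle (u k) a); lra).
  assert (A1 : Cmod (u k) * Cmod (v k - b) <= (Cmod a + 1) * Cmod (v k - b)).
  { apply Rmult_le_compat_r; auto. apply Cmod_ge_0. }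
  assert (A2 : (Cmod a + 1) * Cmod (v k - b) < (Cmod a + 1) * (e / (2 * (Cmod a + 1)))).
  { apply Rmult_lt_compat_l; lra. }
  replace ((Cmod a + 1) * (e / (2 * (Cmod a + 1)))) with (e / 2) in A2 by (field; lra).
  assert (A3 : Cmod (u k - a) * Cmod b <= e / (2 * (Cmod b + 1)) * (Cmod b + 1)).
  { apply Rmult_le_compat; try apply Cmod_ge_0; lra. }
  replace (e / (2 * (Cmod b + 1)) * (Cmod b + 1)) with (e / 2) in A3 by (field; lra). lra.
Qed.

Lemma tends_fst_le u l M : tends u l -> (forall k, fst (u k) <= M) -> fst l <= M.
Proof.
  intros H HM. apply le_epsilon. intros e He. destruct (H e He) as [K HK].
  specialize (HK K (le_n _)). specialize (HM K).
  assert (T := re_le_Cmod (u K - l)). simpl in T.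
  assert (T' := Rle_abs (- (fst (u K) + - fst l))). rewrite Rabs_Ropp in T'. lra.
Qed.

Lemma real_subsequence (x : nat -> R) B : (forall k, Rabs (x k) <= B) ->
  exists s l, (forall k, (k <= s k)%nat) /\ forall e, 0 < e -> exists N, forall k, (N <= k)%nat -> Rabs (x (s k) - l) < e.
Proof.
  intros H.
  destruct (Bolzano_Weierstrass x (fun t => - B <= t <= B)) as [l Hl].
  { apply compact_P3. }
  { intros k. specialize (H k). apply Rabs_le_between in H. exact H. }
  assert (Q : forall k, exists p, (k <= p)%nat /\ Rabs (x p - l) < / (INR k + 1)).
  { intros k. assert (P : 0 < / (INR k + 1)) by (apply Rinv_0_lt_compat; assert (T := pos_INR k); lra).
    destruct (Hl (fun t => Rabs (t - l) < / (INR k + 1)) k) as [p [Hp1 Hp2]].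
    - exists (mkposreal _ P). intros t Ht. exact Ht.
    - exists p. auto. }
  exists (fun k => proj1_sig (constructive_indefinite_description _ (Q k))), l. split.
  - intros k. exact (proj1 (proj2_sig (constructive_indefinite_description _ (Q k)))).
  - intros e He. destruct (archimed_cor1 e He) as [N [HN1 HN2]]. exists N. intros k Hk.
    eapply Rlt_trans; [exact (proj2 (proj2_sig (constructive_indefinite_description _ (Q k))))|].
    eapply Rle_lt_trans; [|exact HN1]. apply Rinv_le_contravar.
    + apply lt_0_INR. lia.
    + apply le_INR in Hk. lra.
Qed.

Lemma complex_subsequence (u : nat -> C) B : (forall k, Cmod (u k) <= B) ->
  exists s l, (forall k, (k <= s k)%nat) /\ tends (fun k => u (s k)) l.
Proof.
  intros H.
  assert (Hf : forall z, Rabs (fst z) <= Cmod z) by (intros; apply re_le_Cmod).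
  assert (Hs : forall z, Rabs (snd z) <= Cmod z).
  { intros z. eapply Rle_trans; [apply Rmax_r|apply Rmax_Cmod]. }
  destruct (real_subsequence (fun k => fst (u k)) B) as [s1 [a [S1 C1]]].
  { intros k. eapply Rle_trans; [apply Hf|auto]. }
  destruct (real_subsequence (fun k => snd (u (s1 k))) B) as [s2 [b [S2 C2]]].
  { intros k. eapply Rle_trans; [apply Hs|auto]. }
  exists (fun k => s1 (s2 k)), (a, b). split.
  - intros k. specialize (S1 (s2 k)). specialize (S2 k). lia.
  - intros e He. destruct (C1 (e/2)) as [N1 H1]; [lra|]. destruct (C2 (e/2)) as [N2 H2]; [lra|].
    exists (N1 + N2)%nat. intros k Hk.
    eapply Rle_lt_trans; [apply Cmod_le_sum|]. simpl.
    specialize (H1 (s2 k) ltac:(specialize (S2 k); lia)). specialize (H2 k ltac:(lia)).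
    unfold Rminus in *. lra.
Qed.

Lemma tuple_subsequence n (u : nat -> nat -> C) B : (forall k i, (i < n)%nat -> Cmod (u k i) <= B) ->
  exists s t, (forall k, (k <= s k)%nat) /\ forall i, (i < n)%nat -> tends (fun k => u (s k) i) (t i).
Proof.
  induction n; intros H.
  - exists (fun k => k), (fun _ => RtoC 0). split; [auto|]. intros; lia.
  - destruct IHn as [s [t [Hs Ht]]]; [intros; apply H; lia|].
    destruct (complex_subsequence (fun k => u (s k) n) B) as [s2 [l [Hs2 Hl]]]; [intros; apply H; lia|].
    exists (fun k => s (s2 k)), (fun i => if Nat.eq_dec i n then l else t i). split.
    + intros k. specialize (Hs (s2 k)). specialize (Hs2 k). lia.
    + intros i Hi. destruct (Nat.eq_dec i n) as [E|E]; [subst; exact Hl|].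
      apply (tends_sub (fun k => u (s k) i)); auto. apply Ht. lia.
Qed.

Lemma pow_near_one n eta : 0 < eta -> exists e, 0 < e /\ (1 + e) ^ n <= 1 + eta.
Proof.
  revert eta. induction n; intros eta He.
  - exists 1. simpl. lra.
  - set (a := Rmin eta 1 / 3). assert (m1 := Rmin_l eta 1). assert (m2 := Rmin_r eta 1).
    assert (Pa : 0 < a) by (unfold a; assert (0 < Rmin eta 1) by (apply Rmin_pos; lra); lra).
    destruct (IHn a Pa) as [e [Pe Hp]]. exists (Rmin e a). split; [apply Rmin_pos; auto|].
    assert (k1 := Rmin_l e a). assert (k2 := Rmin_r e a). assert (k0 : 0 < Rmin e a) by (apply Rmin_pos; auto).
    simpl. assert (Q : (1 + Rmin e a) ^ n <= (1 + e) ^ n) by (apply pow_incr; lra).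
    assert (Q0 : 0 <= (1 + Rmin e a) ^ n) by (apply pow_le; lra).
    apply Rle_trans with ((1 + a) * (1 + a)); [apply Rmult_le_compat; lra|].
    unfold a in *. nra.
Qed.

(** On the closed left half-planes each factor has modulus at least [1]. A bound on the product
    therefore bounds every coordinate, while dividing by it never increases a modulus. *)
Fixpoint prod_shift (n : nat) (p : nat -> C) : C :=
  match n with O => RtoC 1 | S m => ((RtoC 1 - p m) * prod_shift m p)%C end.

Lemma one_minus_ge z : fst z <= 0 -> 1 <= Cmod (RtoC 1 - z).
Proof.
  intros H. assert (T := re_le_Cmod (RtoC 1 - z)). simpl in T.
  assert (T' := Rle_abs (1 + - fst z)). lra.
Qed.

Lemma prod_shift_ge n p : (forall i, (i < n)%nat -> fst (p i) <= 0) ->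
  1 <= Cmod (prod_shift n p) /\ forall i, (i < n)%nat -> Cmod (RtoC 1 - p i) <= Cmod (prod_shift n p).
Proof.
  induction n; intros H; simpl.
  - rewrite Cmod_1. split; [lra|intros; lia].
  - destruct IHn as [A B]; [intros; apply H; lia|].
    assert (C1 := one_minus_ge (p n) (H n ltac:(lia))). rewrite Cmod_mult. split; [nra|].
    intros i Hi. destruct (Nat.eq_dec i n) as [E|E]; [subst; nra|].
    specialize (B i ltac:(lia)). nra.
Qed.

Lemma prod_shift_tends n (u : nat -> nat -> C) t : (forall i, (i < n)%nat -> tends (fun k => u k i) (t i)) ->
  tends (fun k => prod_shift n (u k)) (prod_shift n t).
Proof.
  induction n; intros H; simpl; [apply tends_const|].
  apply tends_mult; [|apply IHn; intros; apply H; lia].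
  apply (tends_cont (fun z => RtoC 1 - z)%C (fun k => u k n)); [|apply H; lia].
  apply cont_minus; [apply cont_const|apply cont_id].
Qed.

Lemma prod_shift_holo n D (g : C -> nat -> C) : (forall i, (i < n)%nat -> holo D (fun z => g z i)) ->
  holo D (fun z => prod_shift n (g z)).
Proof.
  induction n; intros H; simpl; [apply holo_const|].
  apply holo_mult; [|apply IHn; intros; apply H; lia].
  apply holo_minus; [apply holo_const|apply H; lia].
Qed.

Lemma prod_shift_ext n p q : (forall i, (i < n)%nat -> p i = q i) -> prod_shift n p = prod_shift n q.
Proof.
  induction n; intros H; simpl; auto. rewrite (H n) by lia. f_equal. apply IHn. intros; apply H; lia.
Qed.

(** The right side is [2] plus the square of [exp r - exp (- r)], which is at least [r]. This is the
    quadratic gain by which [Cmod (Cexp _) ^ 2] is strictly subharmonic. *)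
Lemma cosh_lower r : 0 <= r -> 2 + r * r <= exp (2 * r) + exp (- (2 * r)).
Proof.
  intros Hr. assert (E1 := exp_ineq1_le r). assert (P := exp_pos r).
  assert (Q := exp_pos (- r)).
  assert (I : exp r * exp (- r) = 1) by (rewrite <- exp_plus, Rplus_opp_r; apply exp_0).
  replace (2 * r) with (r + r) by ring. rewrite Ropp_plus_distr, !exp_plus.
  assert (D : r <= exp r - exp (- r)).
  { assert (exp (- r) * (1 + r) <= 1) by nra. nra. }
  nra.
Qed.

(** Summed over the four points at distance [r], the exponential term gains a multiple of [r ^ 2]
    over its central value, whereas [Cmod G ^ 2] loses at most [B * r ^ 3]. For small [r] the gain
    wins, against maximality at the centre. *)
Lemma no_local_max (G : C -> C) r0 z0 eta m : 0 < r0 -> 0 < eta -> holo (ball_at (RtoC 0) r0) G ->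
  Cmod (G (RtoC 0)) ^ 2 + eta * Cmod (Cexp z0) ^ 2 = m ->
  (forall z, Cmod z < r0 -> Cmod (G z) ^ 2 + eta * Cmod (Cexp (z0 + z)) ^ 2 <= m) -> False.
Proof.
  intros Hr He HG E0 Hm.
  destruct (four_point_mean G r0 Hr HG) as [B [d [Pd [PB H]]]].
  set (a := Cmod (Cexp z0) ^ 2).
  assert (Pa : 0 < a).
  { unfold a. apply pow_lt. apply Cmod_gt_0. apply Cexp_neq0. }
  set (r := Rmin (Rmin (r0 / 2) (d / 2)) (eta * a / (2 * B))).
  assert (Pe : 0 < eta * a) by (apply Rmult_lt_0_compat; auto).
  assert (m1 := Rmin_l (Rmin (r0 / 2) (d / 2)) (eta * a / (2 * B))).
  assert (m2 := Rmin_r (Rmin (r0 / 2) (d / 2)) (eta * a / (2 * B))).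
  assert (m3 := Rmin_l (r0 / 2) (d / 2)). assert (m4 := Rmin_r (r0 / 2) (d / 2)). fold r in m1, m2.
  assert (Pr : 0 < r). { unfold r. repeat apply Rmin_pos; try lra. apply Rdiv_lt_0_compat; lra. }
  specialize (H r ltac:(lra)).
  assert (A1 : Cmod (RtoC r) < r0) by (rewrite Cmod_R, Rabs_pos_eq; lra).
  assert (A2 : Cmod (RtoC r * Ci) < r0) by (rewrite Cmod_mult, Cmod_Ci, Cmod_R, Rabs_pos_eq; lra).
  assert (A3 : Cmod (RtoC (- r)) < r0) by (rewrite Cmod_R, Rabs_Ropp, Rabs_pos_eq; lra).
  assert (A4 : Cmod (RtoC (- r) * Ci) < r0) by (rewrite Cmod_mult, Cmod_Ci, Cmod_R, Rabs_Ropp, Rabs_pos_eq; lra).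
  assert (M1 := Hm _ A1). assert (M2 := Hm _ A2). assert (M3 := Hm _ A3). assert (M4 := Hm _ A4).
  rewrite !Cexp_add, !Cmod_mult, !Rpow_mult_distr in M1, M2, M3, M4. fold a in M1, M2, M3, M4, E0.
  rewrite !Cmod_Cexp in M1, M2, M3, M4. simpl fst in M1, M2, M3, M4.
  replace (r * 0 - 0 * 1) with 0 in M2 by ring. replace (- r * 0 - 0 * 1) with 0 in M4 by ring.
  rewrite exp_0 in M2, M4.
  assert (S1 : exp r ^ 2 = exp (2 * r)) by (replace (2 * r) with (r + r) by ring; rewrite exp_plus; ring).
  assert (S3 : exp (- r) ^ 2 = exp (- (2 * r))).
  { replace (- (2 * r)) with (- r + - r) by ring; rewrite exp_plus; ring. }
  rewrite S1 in M1. rewrite S3 in M3.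
  assert (Ch := cosh_lower r ltac:(lra)).
  assert (Ch' : eta * a * (2 + r * r) <= eta * a * (exp (2 * r) + exp (- (2 * r)))).
  { apply Rmult_le_compat_l; lra. }
  assert (F : eta * a * (r * r) <= B * r ^ 3) by lra.
  assert (F2 : eta * a <= B * r).
  { apply Rmult_le_reg_r with (r * r); [nra|]. replace (B * r * (r * r)) with (B * r ^ 3) by ring. exact F. }
  assert (F3 : B * r <= B * (eta * a / (2 * B))) by (apply Rmult_le_compat_l; lra).
  replace (B * (eta * a / (2 * B))) with (eta * a / 2) in F3 by (field; lra). lra.
Qed.

(* [F] is compared with the powers of [prod (1 - p_i)], which tame it at infinity;
   the strictly subharmonic term [|exp p_0|^2] excludes an interior maximum. *)
Lemma product_max_principle (n : nat) (S : (nat -> C) -> Prop) (F : (nat -> C) -> C) (C0 : R) :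
  (0 < n)%nat ->
  (forall p, S p -> forall i, (i < n)%nat -> fst (p i) < 0) ->
  (forall p, S p -> exists r (g : C -> nat -> C), 0 < r /\
     (forall z, Cmod z < r -> S (g z) /\ g z O = (p O + z)%C) /\
     (forall i, (i < n)%nat -> holo (ball_at (RtoC 0) r) (fun z => g z i) /\ g (RtoC 0) i = p i) /\
     holo (ball_at (RtoC 0) r) (fun z => F (g z)) /\ F (g (RtoC 0)) = F p) ->
  (forall p, S p -> Cmod (F p) <= C0) ->
  (forall u t, (forall k, S (u k)) -> (forall i, (i < n)%nat -> tends (fun k => u k i) (t i)) ->
     (forall i, (i < n)%nat -> fst (t i) < 0) -> S t /\ tends (fun k => F (u k)) (F t)) ->
  (forall u t, (forall k, S (u k)) -> (forall i, (i < n)%nat -> tends (fun k => u k i) (t i)) ->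
     (forall i, (i < n)%nat -> fst (t i) <= 0) -> (exists i, (i < n)%nat /\ fst (t i) = 0) ->
     forall e, 0 < e -> exists N, forall k, (N <= k)%nat -> Cmod (F (u k)) <= 1 + e) ->
  forall p, S p -> Cmod (F p) <= 1.
Proof.
  intros Hn Hneg Hdisc Hbd Hcl Hbdry p0 Sp0.
  destruct (Rle_lt_dec (Cmod (F p0)) 1) as [Ok|Big]; auto. exfalso.
  assert (Pi0 := prod_shift_ge n p0 ltac:(intros i Hi; left; apply Hneg; auto)).
  destruct Pi0 as [Pi0 _]. set (P0 := Cmod (prod_shift n p0)) in *.
  (* The power is chosen so that [F ^ K] still exceeds [1] at [p0] after division by the taming
     product. *)
  destruct (Pow_x_infinity (Cmod (F p0)) ltac:(rewrite Rabs_pos_eq; lra) (P0 + 1)) as [K HK].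
  specialize (HK K (le_n _)). rewrite Rabs_pos_eq in HK by (apply pow_le; lra).
  set (G := fun p => (F p ^ K / prod_shift n p)%C).
  assert (PN : forall p, S p -> 1 <= Cmod (prod_shift n p)).
  { intros p Sp. apply prod_shift_ge. intros; left; apply Hneg; auto. }
  assert (Nz : forall p, S p -> prod_shift n p <> RtoC 0).
  { intros p Sp. apply Cmod_gt_0. specialize (PN p Sp). lra. }
  assert (EG : forall p, S p -> Cmod (G p) = Cmod (F p) ^ K / Cmod (prod_shift n p)).
  { intros p Sp. unfold G. rewrite Cmod_div, Cmod_pow by auto. reflexivity. }
  assert (G0 : 1 < Cmod (G p0)).
  { rewrite EG by auto. fold P0. apply Rmult_lt_reg_r with P0; [lra|].
    unfold Rdiv. rewrite Rmult_assoc, Rinv_l by lra. lra. }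
  (* The supremum of [Phi] is then at least [1 + 2 * eta], while the exponential term contributes at
     most [eta]; so near-maximal points keep [Cmod (G _) ^ 2] above [1], up to the error of the
     sequence. *)
  set (eta := (Cmod (G p0) ^ 2 - 1) / 2).
  assert (Pe : 0 < eta) by (unfold eta; nra).
  set (Phi := fun p : nat -> C => Cmod (G p) ^ 2 + eta * Cmod (Cexp (p O)) ^ 2).
  assert (PhiE : forall p, S p -> 0 <= Cmod (Cexp (p O)) ^ 2 <= 1).
  { intros p Sp. rewrite Cmod_Cexp. assert (Q := Hneg p Sp O Hn). assert (X := exp_pos (fst (p O))).
    assert (exp (fst (p O)) < 1) by (rewrite <- exp_0; apply exp_increasing; auto). split; nra. }
  assert (GB : forall p, S p -> Cmod (G p) <= C0 ^ K / Cmod (prod_shift n p)).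
  { intros p Sp. rewrite EG by auto. apply Rmult_le_compat_r.
    - left. apply Rinv_0_lt_compat. specialize (PN p Sp). lra.
    - apply pow_incr. split; [apply Cmod_ge_0|auto]. }
  assert (PC : 0 <= C0 ^ K).
  { apply pow_le. specialize (Hbd p0 Sp0). assert (Q := Cmod_ge_0 (F p0)). lra. }
  assert (GB' : forall p, S p -> Cmod (G p) <= C0 ^ K).
  { intros p Sp. eapply Rle_trans; [apply GB; auto|]. specialize (PN p Sp).
    apply Rmult_le_reg_r with (Cmod (prod_shift n p)); [lra|].
    unfold Rdiv. rewrite Rmult_assoc, Rinv_l by lra. nra. }
  destruct (completeness (fun x => exists p, S p /\ x = Phi p)) as [m [Hm1 Hm2]].
  { exists ((C0 ^ K) ^ 2 + eta). intros x [p [Sp E]]. subst x. unfold Phi.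
    specialize (PhiE p Sp). specialize (GB' p Sp). assert (Q := Cmod_ge_0 (G p)).
    assert (Cmod (G p) ^ 2 <= (C0 ^ K) ^ 2) by (apply pow_incr; auto). nra. }
  { exists (Phi p0). exists p0. auto. }
  assert (Mge : 1 + 2 * eta <= m).
  { apply Rle_trans with (Phi p0); [|apply Hm1; exists p0; auto].
    unfold Phi. specialize (PhiE p0 Sp0). unfold eta at 1. nra. }
  assert (Near : forall k, exists p, S p /\ m - eta / (INR k + 1) < Phi p).
  { intros k. assert (Pk : 0 < eta / (INR k + 1)) by (apply Rdiv_lt_0_compat; assert (T := pos_INR k); lra).
    apply NNPP. intros N. assert (m <= m - eta / (INR k + 1)); [|lra].
    apply Hm2. intros x [p [Sp E]]. subst x. apply Rnot_lt_le. intros L. apply N. exists p. auto. }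
  set (u := fun k => proj1_sig (constructive_indefinite_description _ (Near k))).
  assert (Su : forall k, S (u k)).
  { intros k. exact (proj1 (proj2_sig (constructive_indefinite_description _ (Near k)))). }
  assert (Pu : forall k, m - eta / (INR k + 1) < Phi (u k)).
  { intros k. exact (proj2 (proj2_sig (constructive_indefinite_description _ (Near k)))). }
  assert (Ek : forall k, eta / (INR k + 1) <= eta).
  { intros k. assert (T := pos_INR k). apply Rmult_le_reg_r with (INR k + 1); [lra|].
    unfold Rdiv. rewrite Rmult_assoc, Rinv_l by lra. nra. }
  assert (Gu : forall k, 1 - eta / (INR k + 1) + eta < Cmod (G (u k)) ^ 2).
  { intros k. specialize (Pu k). unfold Phi in Pu. specialize (PhiE (u k) (Su k)). nra. }
  (* Along the maximising sequence [Cmod (G _)] is at least [1], so the product is at most [C0 ^ K],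
     and with it every factor [1 - p i]. *)
  assert (Bu : forall k i, (i < n)%nat -> Cmod (u k i) <= C0 ^ K + 1).
  { intros k i Hi. specialize (Gu k). specialize (Ek k).
    assert (Q : 1 <= Cmod (G (u k))).
    { assert (P := Cmod_ge_0 (G (u k))). nra. }
    specialize (GB (u k) (Su k)). specialize (PN (u k) (Su k)).
    destruct (prod_shift_ge n (u k) ltac:(intros j Hj; left; apply Hneg; auto)) as [_ T]. specialize (T i Hi).
    assert (Cmod (prod_shift n (u k)) <= C0 ^ K).
    { apply Rmult_le_reg_r with (/ Cmod (prod_shift n (u k))); [apply Rinv_0_lt_compat; lra|].
      rewrite Rinv_r by lra. unfold Rdiv in GB. lra. }
    assert (X := Cmod_rev_triangle (u k i) (RtoC 1)). rewrite Cmod_1, Cmod_sub_comm in X. lra. }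
  destruct (tuple_subsequence n u _ Bu) as [s [t [Hs Ht]]].
  assert (St : forall k, S (u (s k))) by auto.
  assert (Tle : forall i, (i < n)%nat -> fst (t i) <= 0).
  { intros i Hi. apply (tends_fst_le _ _ _ (Ht i Hi)). intros k. left. apply Hneg; auto. }
  destruct (classic (exists i, (i < n)%nat /\ fst (t i) = 0)) as [B|NB].
  (* At the boundary [Cmod (G _) ^ 2] is at most [1 + eta / 4], whereas the maximising sequence
     keeps it above [1 + 3 * eta / 4]. *)
  - destruct (pow_near_one (K * 2) (eta / 4) ltac:(lra)) as [e [Pe' He]].
    destruct (Hbdry (fun k => u (s k)) t St Ht Tle B e Pe') as [N HN].
    set (k := (N + 4)%nat). specialize (HN k ltac:(unfold k; lia)).
    specialize (Gu (s k)). specialize (Hs k).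
    assert (Cmod (G (u (s k))) <= (1 + e) ^ K).
    { rewrite EG by auto. specialize (PN _ (St k)).
      apply Rmult_le_reg_r with (Cmod (prod_shift n (u (s k)))); [lra|].
      unfold Rdiv. rewrite Rmult_assoc, Rinv_l, Rmult_1_r by lra.
      assert (X : Cmod (F (u (s k))) ^ K <= (1 + e) ^ K) by (apply pow_incr; split; [apply Cmod_ge_0|auto]).
      assert (0 <= (1 + e) ^ K) by (apply pow_le; lra). nra. }
    assert (Cmod (G (u (s k))) ^ 2 <= ((1 + e) ^ K) ^ 2) by (apply pow_incr; split; [apply Cmod_ge_0|auto]).
    rewrite <- pow_mult in H0.
    assert (eta / (INR (s k) + 1) <= eta / 4).
    { unfold Rdiv. apply Rmult_le_compat_l; [lra|]. apply Rinv_le_contravar; [lra|].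
      assert (Y : (4 <= s k)%nat) by (unfold k in *; lia). apply le_INR in Y. simpl in Y. lra. }
    lra.
  - assert (Tlt : forall i, (i < n)%nat -> fst (t i) < 0).
    { intros i Hi. destruct (Tle i Hi) as [L|E]; auto. exfalso. apply NB. exists i. auto. }
    destruct (Hcl (fun k => u (s k)) t St Ht Tlt) as [S_t Ft].
    assert (Em : Phi t = m).
    { apply Rle_antisym; [apply Hm1; exists t; auto|].
      assert (TG : tends (fun k => G (u (s k))) (G t)).
      { unfold G. unfold Cdiv. apply (tends_mult (fun k => F (u (s k)) ^ K)%C (fun k => / prod_shift n (u (s k)))%C).
        - apply (tends_cont (fun z => z ^ K)%C (fun k => F (u (s k)))); auto.
          eapply holo_cont; [apply (holo_pow (fun _ => True) (fun z => z)); apply holo_id|exact I].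
        - apply (tends_cont (fun z => / z)%C (fun k => prod_shift n (u (s k)))).
          + apply cont_inv_id. auto.
          + apply prod_shift_tends. exact Ht. }
      assert (TE : tends (fun k => Cexp (u (s k) O)) (Cexp (t O))).
      { apply (tends_cont Cexp (fun k => u (s k) O)); [apply cont_Cexp|apply Ht; auto]. }
      assert (TG2 := tends_mult _ _ _ _ TG TG). assert (TE2 := tends_mult _ _ _ _ TE TE).
      apply le_epsilon. intros e Hpe.
      set (e1 := e / (3 * (1 + eta))). assert (Pe1 : 0 < e1) by (apply Rdiv_lt_0_compat; lra).
      destruct (TG2 e1 Pe1) as [N1 HN1]. destruct (TE2 e1 Pe1) as [N2 HN2].
      destruct (archimed_cor1 (e / (3 * eta)) ltac:(apply Rdiv_lt_0_compat; lra)) as [N3 [HN3 HN3']].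
      set (k := (N1 + N2 + N3)%nat).
      specialize (HN1 k ltac:(unfold k; lia)). specialize (HN2 k ltac:(unfold k; lia)).
      specialize (Pu (s k)).
      assert (R1 := Cmod_rev_triangle (G (u (s k)) * G (u (s k))) (G t * G t)).
      assert (R2 := Cmod_rev_triangle (Cexp (u (s k) O) * Cexp (u (s k) O)) (Cexp (t O) * Cexp (t O))).
      rewrite !Cmod_mult in R1, R2. unfold Phi in *.
      assert (R3 : eta / (INR (s k) + 1) <= e / 3).
      { assert (Y : (N3 <= s k)%nat) by (specialize (Hs k); unfold k in *; lia). apply le_INR in Y.
        assert (Z : 0 < INR N3) by (apply lt_0_INR; auto).
        assert (/ (INR (s k) + 1) <= / INR N3) by (apply Rinv_le_contravar; lra).
        apply Rle_trans with (eta * (e / (3 * eta))).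
        - unfold Rdiv at 1. apply Rmult_le_compat_l; lra.
        - right. field. lra. }
      assert (R4 : e1 + eta * e1 = e / 3) by (unfold e1; field; lra).
      assert (R5 : eta * (Cmod (Cexp (u (s k) O)) ^ 2 - Cmod (Cexp (t O)) ^ 2) <= eta * e1).
      { apply Rmult_le_compat_l; [lra|]. simpl. rewrite !Rmult_1_r. lra. }
      replace (Cmod (G (u (s k))) ^ 2) with (Cmod (G (u (s k))) * Cmod (G (u (s k)))) in Pu by ring.
      replace (Cmod (G t) ^ 2) with (Cmod (G t) * Cmod (G t)) by ring. lra. }
    destruct (Hdisc t S_t) as [r [g [Pr [Hg1 [Hg2 [Hg3 Hg4]]]]]].
    apply (no_local_max (fun z => G (g z)) r (t O) eta m Pr Pe).
    + unfold G. apply holo_div.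
      * intros z Hz. apply Nz, Hg1. unfold ball_at in Hz. replace (z - 0)%C with z in Hz by ring. auto.
      * apply holo_pow. auto.
      * apply prod_shift_holo. intros i Hi. apply Hg2; auto.
    + rewrite <- Em. unfold Phi, G. rewrite Hg4.
      rewrite (prod_shift_ext n (g (RtoC 0)) t) by (intros i Hi; apply Hg2; auto). reflexivity.
    + intros z Hz. destruct (Hg1 z Hz) as [Sg Eg]. apply Hm1. exists (g z). split; auto.
      unfold Phi. rewrite Eg. reflexivity.
Qed.

(** * Motions of a marked orbit and their lifts *)

Lemma finite_radius (N : nat) (P : nat -> C -> Prop) :
  (forall n, (n <= N)%nat -> exists d, 0 < d /\ forall z, Cmod z < d -> P n z) ->
  exists d, 0 < d /\ forall n z, (n <= N)%nat -> Cmod z < d -> P n z.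
Proof.
  induction N; intros H.
  - destruct (H O (le_n _)) as [d [Pd Hd]]. exists d. split; auto. intros n z Hn. replace n with O by lia. auto.
  - destruct IHN as [d1 [P1 H1]]; [intros; apply H; lia|]. destruct (H (S N) (le_n _)) as [d2 [P2 H2]].
    exists (Rmin d1 d2). split; [apply Rmin_pos; auto|]. intros n z Hn Hz.
    assert (m1 := Rmin_l d1 d2). assert (m2 := Rmin_r d1 d2).
    destruct (Nat.eq_dec n (S N)) as [E|E]; [subst; apply H2; lra|apply H1; [lia|lra]].
Qed.

Lemma finite_bound (N : nat) (x : nat -> C) : exists B, 0 < B /\ forall n, (n <= N)%nat -> Cmod (x n) <= B.
Proof.
  induction N.
  - exists (Cmod (x O) + 1). assert (Q := Cmod_ge_0 (x O)). split; [lra|]. intros n Hn. replace n with O by lia. lra.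
  - destruct IHN as [B [PB HB]]. exists (B + Cmod (x (S N))). assert (Q := Cmod_ge_0 (x (S N))).
    split; [lra|]. intros n Hn. destruct (Nat.eq_dec n (S N)) as [E|E]; [subst; lra|].
    specialize (HB n ltac:(lia)). lra.
Qed.

Definition little_o (m : nat) (K : C -> C) (b : C) : Prop :=
  forall e, 0 < e -> exists d, 0 < d /\ forall z, 0 < Cmod z < d ->
    Cmod (K z - b * z ^ m) <= e * Cmod z ^ m.

Lemma little_o_minus m K L a b : little_o m K a -> little_o m L b ->
  little_o m (fun z => K z - L z)%C (a - b)%C.
Proof.
  intros HK HL e He. destruct (HK (e/2)) as [d1 [P1 H1]]; [lra|]. destruct (HL (e/2)) as [d2 [P2 H2]]; [lra|].
  exists (Rmin d1 d2). split; [apply Rmin_pos; auto|]. intros z Hz.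
  assert (m1 := Rmin_l d1 d2). assert (m2 := Rmin_r d1 d2).
  specialize (H1 z ltac:(lra)). specialize (H2 z ltac:(lra)).
  replace (K z - L z - (a - b) * z ^ m)%C with ((K z - a * z ^ m) - (L z - b * z ^ m))%C by ring.
  eapply Rle_trans; [apply Cmod_sub_le|]. lra.
Qed.

Lemma little_o_ext m K L a d : 0 < d -> (forall z, Cmod z < d -> K z = L z) ->
  little_o m K a -> little_o m L a.
Proof.
  intros Pd E HK e He. destruct (HK e He) as [d1 [P1 H1]]. exists (Rmin d d1).
  split; [apply Rmin_pos; auto|]. intros z Hz.
  assert (m1 := Rmin_l d d1). assert (m2 := Rmin_r d d1). rewrite <- E by lra. apply H1. lra.
Qed.

Lemma little_o_zero m : little_o m (fun _ => RtoC 0) (RtoC 0).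
Proof.
  intros e He. exists 1. split; [lra|]. intros z Hz. replace (0 - 0 * z ^ m)%C with (RtoC 0) by ring.
  rewrite Cmod_0. apply Rmult_le_pos; [lra|apply pow_le; lra].
Qed.

(* Division of increments: [f x - f y ~ A z^m] gives [x - y ~ (A / f') z^m]. *)
Lemma little_o_pullback m f c R0 l x y A : 0 < R0 -> holo (ball_at c R0) f -> dC f c l -> l <> RtoC 0 ->
  cont_at x (RtoC 0) -> cont_at y (RtoC 0) -> x (RtoC 0) = c -> y (RtoC 0) = c ->
  little_o m (fun z => f (x z) - f (y z))%C A -> little_o m (fun z => x z - y z)%C (A / l)%C.
Proof.
  intros HR Hf Hl Nl Cx Cy Ex Ey HA e He.
  assert (Pl : 0 < Cmod l) by (apply Cmod_gt_0; auto). assert (PA := Cmod_ge_0 A).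
  set (B := 2 * (Cmod A + 1) / Cmod l).
  assert (PB : 0 < B) by (apply Rdiv_lt_0_compat; lra).
  set (e1 := Rmin (Cmod l / 2) (e * Cmod l / (2 * B))).
  assert (Pe1 : 0 < e1).
  { apply Rmin_pos; [lra|]. apply Rdiv_lt_0_compat; [apply Rmult_lt_0_compat; auto|lra]. }
  assert (k1 := Rmin_l (Cmod l / 2) (e * Cmod l / (2 * B))).
  assert (k2 := Rmin_r (Cmod l / 2) (e * Cmod l / (2 * B))). fold e1 in k1, k2.
  destruct (dC_strict f c R0 l HR Hf Hl e1 Pe1) as [d [Pd Hd]].
  destruct (Cx d Pd) as [d1 [P1 H1]]. destruct (Cy d Pd) as [d2 [P2 H2]].
  assert (Pel : 0 < e * Cmod l / 2) by (assert (0 < e * Cmod l) by (apply Rmult_lt_0_compat; auto); lra).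
  destruct (HA (Rmin 1 (e * Cmod l / 2))) as [d3 [P3 H3]]; [apply Rmin_pos; lra|].
  exists (Rmin (Rmin d1 d2) d3). split; [repeat apply Rmin_pos; auto|]. intros z Hz.
  assert (m1 := Rmin_l (Rmin d1 d2) d3). assert (m2 := Rmin_r (Rmin d1 d2) d3).
  assert (m3 := Rmin_l d1 d2). assert (m4 := Rmin_r d1 d2).
  specialize (H1 z). specialize (H2 z). replace (z - 0)%C with z in H1, H2 by ring.
  specialize (H1 ltac:(lra)). specialize (H2 ltac:(lra)). rewrite Ex in H1. rewrite Ey in H2.
  specialize (Hd (x z) (y z) H1 H2). specialize (H3 z ltac:(lra)).
  assert (n1 := Rmin_l 1 (e * Cmod l / 2)). assert (n2 := Rmin_r 1 (e * Cmod l / 2)).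
  set (p := Cmod z ^ m) in *. assert (Pp : 0 < p) by (apply pow_lt; lra).
  set (D := Cmod (x z - y z)) in *. assert (PD : 0 <= D) by apply Cmod_ge_0.
  assert (DB : D <= B * p).
  { assert (T1 := Cmod_sub_le (f (x z) - f (y z)) (f (x z) - f (y z) - l * (x z - y z))).
    replace (f (x z) - f (y z) - (f (x z) - f (y z) - l * (x z - y z)))%C with (l * (x z - y z))%C in T1 by ring.
    rewrite Cmod_mult in T1. fold D in T1.
    assert (T2 := Cmod_rev_triangle (f (x z) - f (y z)) (A * z ^ m)). rewrite Cmod_mult, Cmod_pow in T2. fold p in T2.
    assert (e1 * D <= Cmod l / 2 * D) by (apply Rmult_le_compat_r; auto).
    assert (Rmin 1 (e * Cmod l / 2) * p <= 1 * p) by (apply Rmult_le_compat_r; lra).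
    assert (Cmod l * D <= 2 * (Cmod A + 1) * p) by nra.
    unfold B. apply Rmult_le_reg_l with (Cmod l); auto.
    replace (Cmod l * (2 * (Cmod A + 1) / Cmod l * p)) with (2 * (Cmod A + 1) * p) by (field; lra). auto. }
  apply Rmult_le_reg_l with (Cmod l); auto. rewrite <- Cmod_mult.
  replace (l * (x z - y z - A / l * z ^ m))%C
    with ((f (x z) - f (y z) - A * z ^ m) - (f (x z) - f (y z) - l * (x z - y z)))%C by (field; auto).
  eapply Rle_trans; [apply Cmod_sub_le|].
  assert (e1 * D <= e * Cmod l / (2 * B) * (B * p)) by (apply Rmult_le_compat; lra).
  replace (e * Cmod l / (2 * B) * (B * p)) with (e * Cmod l / 2 * p) in H by (field; lra).
  assert (Rmin 1 (e * Cmod l / 2) * p <= e * Cmod l / 2 * p) by (apply Rmult_le_compat_r; lra). nra.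
Qed.

Section ClassF.
Variables (U V : C -> Prop) (f : C -> C).
Hypothesis hF : class_F U V f.
Variable u0 : C.
Hypothesis Uu0 : U u0.

Let dlt := diam U.

Lemma U_open_ball z : U z -> exists d, 0 < d /\ forall w, Cmod (w - z) < d -> U w.
Proof. apply (proj1 (C_open_ball U) (F_U_open _ _ _ hF)). Qed.

Lemma f_holo : holo U f.
Proof. apply holomorphic_on_holo. exact (F_holomorphic _ _ _ hF). Qed.

Lemma f_holo_near x : U x -> exists R0, 0 < R0 /\ holo (ball_at x R0) f.
Proof.
  intros Hx. destruct (U_open_ball x Hx) as [d [Pd Hd]]. exists d. split; auto.
  apply (holo_sub U); [intros z Hz; apply Hd; exact Hz|exact f_holo].
Qed.

(** Boundedness of [U] makes the extended supremum finite, so that taking its real part loses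
    nothing. *)
Lemma diam_le x y : U x -> U y -> Cmod (x - y) <= dlt.
Proof.
  intros Hx Hy. unfold dlt, diam.
  set (E := fun r => exists x y, U x /\ U y /\ r = Cmod (x - y)).
  destruct (Lub_Rbar_correct E) as [A B].
  destruct (F_U_bounded _ _ _ hF) as [M HM].
  assert (B' : Rbar_le (Lub_Rbar E) (Finite (2 * M))).
  { apply B. intros r [a [b [Ha [Hb Er]]]]. simpl. subst r.
    eapply Rle_trans; [apply Cmod_sub_le|]. specialize (HM a Ha) as H1. specialize (HM b Hb) as H2. lra. }
  assert (A' : Rbar_le (Finite (Cmod (x - y))) (Lub_Rbar E)) by (apply A; exists x, y; auto).
  destruct (Lub_Rbar E); simpl in *; auto; contradiction.
Qed.

Lemma adherent_self x : U x -> adherent U x.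
Proof. intros Hx e He. exists x. rewrite Cmod_self. auto. Qed.

Lemma diam_adherent x y : adherent U x -> adherent U y -> Cmod (x - y) <= dlt.
Proof.
  intros Hx Hy. apply le_epsilon. intros e He.
  destruct (Hx (e/2) ltac:(lra)) as [a [Ua Ha]]. destruct (Hy (e/2) ltac:(lra)) as [b [Ub Hb]].
  assert (T := Cmod_triangle3 x a y). assert (T' := Cmod_triangle3 a b y).
  rewrite (Cmod_sub_comm x a) in T. assert (D := diam_le a b Ua Ub). lra.
Qed.

(** As [U] is open, [x] can be pushed a little further away from [y] within [U], so the diameter is
    not attained at [x]. *)
Lemma diam_strict x y : U x -> adherent U y -> Cmod (x - y) < dlt.
Proof.
  intros Hx Hy. destruct (U_open_ball x Hx) as [d [Pd Hd]].
  destruct (Ceq_dec x y) as [E|E].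
  - subst y. rewrite Cmod_self. destruct (ball_point x (d/2)) as [w [Nw Ew]]; [lra|].
    assert (T := diam_le w x (Hd w ltac:(lra)) Hx). lra.
  - assert (P := Cmod_sub_neq _ _ E). set (s := d / (2 * Cmod (x - y))).
    assert (Ps : 0 < s) by (apply Rdiv_lt_0_compat; lra).
    set (w := (x + RtoC s * (x - y))%C).
    assert (Hw : Cmod (w - x) < d).
    { unfold w. replace (x + s * (x - y) - x)%C with (RtoC s * (x - y))%C by ring.
      rewrite Cmod_mult, Cmod_R, Rabs_pos_eq by lra. unfold s.
      replace (d / (2 * Cmod (x - y)) * Cmod (x - y)) with (d / 2) by (field; lra). lra. }
    assert (T := diam_adherent w y (adherent_self w (Hd w Hw)) Hy).
    replace (w - y)%C with (RtoC (1 + s) * (x - y))%C in T by (unfold w; rewrite RtoC_plus; ring).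
    rewrite Cmod_mult, Cmod_R, Rabs_pos_eq in T by lra. nra.
Qed.

Lemma adherent_zero : adherent U (RtoC 0).
Proof. exact (F_U_zero _ _ _ hF). Qed.

Lemma diam_pos : 0 < dlt.
Proof.
  assert (T := diam_strict u0 u0 Uu0 (adherent_self _ Uu0)). rewrite Cmod_self in T. exact T.
Qed.

Lemma in_V y : Cmod y < dlt -> y <> RtoC 0 -> minus0 V y.
Proof. intros H N. split; auto. apply (F_disc_V _ _ _ hF). exact H. Qed.

Lemma f_deriv_neq0 x l : minus0 U x -> dC f x l -> l <> RtoC 0.
Proof.
  intros Hx. apply (covering_deriv_neq0 f (minus0 U) (minus0 V) (F_covering _ _ _ hF) x l Hx).
  apply f_holo_near. apply Hx.
Qed.

Lemma f_neq0 x : minus0 U x -> f x <> RtoC 0.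
Proof. intros Hx. destruct (F_covering _ _ _ hF) as [H _]. apply (H x Hx). Qed.

Lemma f_lift L p0 x0 phi : convex L ->
  (forall z, L z -> exists d, 0 < d /\ forall w, Cmod (w - z) < d -> L w) -> L p0 ->
  (forall z, L z -> Cmod (phi z) < dlt /\ phi z <> RtoC 0) -> holo L phi -> minus0 U x0 -> f x0 = phi p0 ->
  exists h, h p0 = x0 /\ holo L h /\ forall z, L z -> minus0 U (h z) /\ f (h z) = phi z.
Proof.
  intros. apply (covering_lift_holo f (minus0 U) (minus0 V)); auto.
  - exact (F_covering _ _ _ hF).
  - intros x Hx. apply f_holo_near. apply Hx.
  - intros z Lz. destruct (H2 z Lz). apply in_V; auto.
Qed.

Variables (N : nat) (X : nat -> C) (nxt : nat -> nat).
Hypothesis HN : (1 <= N)%nat.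
Hypothesis X0 : X O = RtoC 0.
Hypothesis HX : forall n, (1 <= n <= N)%nat -> minus0 U (X n).
Hypothesis Xinj : forall m n, (m <= N)%nat -> (n <= N)%nat -> X m = X n -> m = n.
Hypothesis nxt_S : forall n, (1 <= n < N)%nat -> nxt n = S n.
Hypothesis nxt_N : (nxt N <= N)%nat.
Hypothesis HfX : forall n, (1 <= n <= N)%nat -> f (X n) = (X (nxt n) - X 1%nat)%C.

(* The point [0] is marked only when the critical orbit returns to it. *)
Definition idx (n : nat) : Prop := (1 <= n <= N)%nat \/ (n = O /\ nxt N = O).

Lemma idx_le n : idx n -> (n <= N)%nat.
Proof using Type. intros [[_ H]|[-> _]]; [exact H|apply Nat.le_0_l]. Qed.

Lemma idx_1 : idx 1.
Proof using HN. left. split; [reflexivity|exact HN]. Qed.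

Lemma idx_nxt n : (1 <= n <= N)%nat -> idx (nxt n).
Proof using nxt_S nxt_N.
  clear - nxt_S nxt_N. intros Hn. destruct (Nat.eq_dec n N) as [E|E].
  - subst n. destruct (nxt N) as [|k] eqn:Ek; [right; auto|left; lia].
  - rewrite nxt_S by lia. left; lia.
Qed.

(** A return to [c_1] would give [f (X n) = 0], a value that the covering omits. Hence the
    differences [h (nxt n) - h 1] of an injective motion never vanish. *)
Lemma nxt_neq1 n : (1 <= n <= N)%nat -> nxt n <> 1%nat.
Proof.
  intros Hn E. apply (f_neq0 (X n) (HX n Hn)). rewrite HfX, E by auto. ring.
Qed.

Lemma X_adherent n : idx n -> adherent U (X n).
Proof.
  intros [H|[H _]].
  - apply adherent_self. apply HX; auto.
  - subst n. rewrite X0. apply adherent_zero.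
Qed.

(** Indexed by position in the orbit instead of by the marked points themselves, so that [nxt] can
    stand for the action of [g]. *)
Definition motion (e : R) (h : nat -> C -> C) : Prop :=
  (forall n, idx n -> h n (RtoC 0) = X n) /\
  (forall z, Cmod z < e -> forall m n, idx m -> idx n -> h m z = h n z -> m = n) /\
  (forall n, idx n -> holo (ball_at (RtoC 0) e) (h n)).

Definition small_motion (e : R) (h : nat -> C -> C) : Prop :=
  forall z, Cmod z < e -> forall n, idx n -> Cmod (h n z - h 1%nat z) < dlt.

Definition lifts (e : R) (h k : nat -> C -> C) : Prop :=
  forall z, Cmod z < e -> (nxt N = O -> k O z = RtoC 0) /\
    forall n, (1 <= n <= N)%nat -> minus0 U (k n z) /\ f (k n z) = (h (nxt n) z - h 1%nat z)%C.

Lemma ball_at_0 e z : ball_at (RtoC 0) e z <-> Cmod z < e.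
Proof. unfold ball_at. replace (z - 0)%C with z by ring. tauto. Qed.

Lemma ball_open c e z : ball_at c e z -> exists d, 0 < d /\ forall w, Cmod (w - z) < d -> ball_at c e w.
Proof.
  unfold ball_at. intros H. exists (e - Cmod (z - c)). split; [lra|]. intros w Hw.
  assert (T := Cmod_triangle3 w z c). lra.
Qed.

(** For injectivity, suppose two lifts meet at [z]. Their images under [f] agree there, so
    [nxt m = nxt n] by injectivity of [h]; both then lift the same function, hence agree at [0],
    where they are [X m] and [X n]. The zero index meets no other one because the lifts avoid
    [0]. *)
Lemma lift_step e h : 0 < e -> motion e h -> small_motion e h ->
  exists k, motion e k /\ small_motion e k /\ lifts e h k.
Proof.
  intros He [M0 [Mi Mh]] Sh.
  assert (Hc : Cmod (RtoC 0) < e) by (rewrite Cmod_0; auto).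
  assert (Q : forall n, exists k : C -> C, (1 <= n <= N)%nat -> k (RtoC 0) = X n /\
    holo (ball_at (RtoC 0) e) k /\
    forall z, Cmod z < e -> minus0 U (k z) /\ f (k z) = (h (nxt n) z - h 1%nat z)%C).
  { intros n. destruct (classic (1 <= n <= N)%nat) as [Hn|Hn]; [|exists (fun z => z); tauto].
    destruct (f_lift (ball_at (RtoC 0) e) (RtoC 0) (X n) (fun z => h (nxt n) z - h 1%nat z)%C)
      as [k [k1 [k2 k3]]].
    - apply ball_convex.
    - apply ball_open.
    - apply (proj2 (ball_at_0 _ _)); auto.
    - intros z Hz. apply (proj1 (ball_at_0 _ _)) in Hz. split.
      + apply Sh; auto. apply idx_nxt; auto.
      + intros E. apply (nxt_neq1 n Hn). apply (Mi z Hz); [apply idx_nxt; auto|apply idx_1|].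
        replace (h (nxt n) z) with (h (nxt n) z - h 1%nat z + h 1%nat z)%C by ring. rewrite E. ring.
    - apply holo_minus; apply Mh; [apply idx_nxt; auto|apply idx_1].
    - apply HX; auto.
    - rewrite !M0; [apply HfX; auto|apply idx_1|apply idx_nxt; auto].
    - exists k. intros _. split; [|split]; auto. intros z Hz. apply k3. apply (proj2 (ball_at_0 _ _)); auto. }
  set (k := fun n => if Nat.eq_dec n 0 then (fun _ => RtoC 0)
                     else proj1_sig (constructive_indefinite_description _ (Q n))).
  assert (Hk : forall n, (1 <= n <= N)%nat -> k n (RtoC 0) = X n /\
    holo (ball_at (RtoC 0) e) (k n) /\
    forall z, Cmod z < e -> minus0 U (k n z) /\ f (k n z) = (h (nxt n) z - h 1%nat z)%C).
  { intros n Hn. unfold k. destruct (Nat.eq_dec n 0) as [E|E]; [lia|].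
    apply (proj2_sig (constructive_indefinite_description _ (Q n)) Hn). }
  assert (Hk0 : forall z, k O z = RtoC 0) by reflexivity.
  exists k. split; [split; [|split]|split].
  - intros n [Hn|[Hn _]]; [apply Hk; auto|subst; rewrite Hk0; auto].
  - intros z Hz m n Hm Hn E. 
    destruct Hm as [Hm|[Hm Zm]]; destruct Hn as [Hn|[Hn Zn]].
    + destruct (Hk m Hm) as [m1 [m2 m3]]. destruct (Hk n Hn) as [n1 [n2 n3]].
      assert (En : nxt m = nxt n).
      { apply (Mi z Hz); try (apply idx_nxt; auto).
        assert (F : f (k m z) = f (k n z)) by congruence.
        rewrite (proj2 (m3 z Hz)), (proj2 (n3 z Hz)) in F.
        replace (h (nxt m) z) with (h (nxt m) z - h 1%nat z + h 1%nat z)%C by ring. rewrite F. ring. }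
      apply Xinj; try lia. rewrite <- m1, <- n1.
      apply (covering_lift_unique f (minus0 U) (minus0 V) (F_covering _ _ _ hF)
        (ball_at (RtoC 0) e) (ball_convex _ _) (k m) (k n) z (RtoC 0)); [apply (proj2 (ball_at_0 _ _)); auto|apply (proj2 (ball_at_0 _ _)); auto| |exact E].
      intros y Hy. destruct (m3 y (proj1 (ball_at_0 _ _) Hy)) as [A1 A2].
      destruct (n3 y (proj1 (ball_at_0 _ _) Hy)) as [B1 B2].
      split; [|split; [|split; [|split]]]; auto.
      * rewrite A2, B2, En. reflexivity.
      * eapply holo_cont; eauto.
      * eapply holo_cont; eauto.
    + exfalso. subst n. rewrite Hk0 in E. destruct (Hk m Hm) as [_ [_ T]]. apply (T z Hz). exact E.
    + exfalso. subst m. rewrite Hk0 in E. destruct (Hk n Hn) as [_ [_ T]]. apply (T z Hz). auto.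
    + congruence.
  - intros n [Hn|[Hn _]]; [apply Hk; auto|subst n; change (holo (ball_at (RtoC 0) e) (fun _ => RtoC 0)); apply holo_const].
  - intros z Hz n Hn. destruct (Hk 1%nat ltac:(lia)) as [_ [_ T1]]. destruct (T1 z Hz) as [[U1 _] _].
    rewrite Cmod_sub_comm. apply diam_strict; auto.
    destruct Hn as [Hn|[Hn _]].
    + apply adherent_self. destruct (Hk n Hn) as [_ [_ T]]. apply (T z Hz).
    + subst n. rewrite Hk0. apply adherent_zero.
  - intros z Hz. split; [intros; apply Hk0|]. intros n Hn. apply Hk; auto.
Qed.

Lemma motion_restrict e e' h : e' <= e -> motion e h -> motion e' h.
Proof.
  intros He [A [B D]]. split; [|split]; auto.
  - intros z Hz. apply B. lra.
  - intros n Hn. apply (holo_sub (ball_at (RtoC 0) e)); auto. intros z Hz. unfold ball_at in *. lra.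
Qed.

Lemma lift_sequence h0 : motion 1 h0 ->
  exists e M h, 0 < e <= 1 /\ 0 < M /\ h O = h0 /\ (forall k, motion e (h k)) /\
    (forall k, lifts e (h k) (h (S k))) /\
    (forall k n z, idx n -> Cmod z < e -> Cmod (h k n z) <= M).
Proof.
  intros Hm. assert (Hm' := Hm). destruct Hm' as [M0 [Mi Mh]].
  assert (C0 : forall n, idx n -> cont_at (h0 n) (RtoC 0)).
  { intros n Hn. eapply holo_cont; [apply Mh; auto|]. apply (proj2 (ball_at_0 _ _)). rewrite Cmod_0. lra. }
  destruct (finite_radius N (fun n z => idx n ->
    Cmod (h0 n z - h0 1%nat z) < dlt /\ Cmod (h0 n z) <= Cmod (X n) + 1)) as [d [Pd Hd]].
  { intros n _. destruct (classic (idx n)) as [In|Nn]; [|exists 1; split; [lra|tauto]].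
    assert (P : Cmod (X n - X 1%nat) < dlt).
    { rewrite Cmod_sub_comm. apply diam_strict; [apply HX; lia|apply X_adherent; auto]. }
    assert (Cd : cont_at (fun z => h0 n z - h0 1%nat z)%C (RtoC 0)).
    { apply cont_minus; apply C0; auto. apply idx_1. }
    destruct (Cd (dlt - Cmod (X n - X 1%nat))) as [d1 [P1 H1]]; [lra|].
    destruct (C0 n In 1) as [d2 [P2 H2]]; [lra|].
    exists (Rmin d1 d2). split; [apply Rmin_pos; auto|]. intros z Hz _.
    assert (m1 := Rmin_l d1 d2). assert (m2 := Rmin_r d1 d2).
    specialize (H1 z). specialize (H2 z). replace (z - 0)%C with z in H1, H2 by ring.
    specialize (H1 ltac:(lra)). specialize (H2 ltac:(lra)).
    rewrite !M0 in H1 by (auto; apply idx_1). rewrite M0 in H2 by auto.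
    assert (T := Cmod_rev_triangle (h0 n z - h0 1%nat z) (X n - X 1%nat)).
    assert (T2 := Cmod_rev_triangle (h0 n z) (X n)). lra. }
  destruct (finite_bound N X) as [B [PB HB]].
  set (e := Rmin d 1). assert (e1 := Rmin_l d 1). assert (e2 := Rmin_r d 1). fold e in e1, e2.
  assert (Pe : 0 < e) by (apply Rmin_pos; lra). assert (Pdlt := diam_pos).
  (* [B + 1] bounds the initial motion and [dlt] every lift, points of [U] being within [dlt] of the
     adherent point [0]. *)
  set (M := B + 1 + dlt).
  destruct (dependent_choice
    (fun h => motion e h /\ small_motion e h /\ forall n z, idx n -> Cmod z < e -> Cmod (h n z) <= M)
    (lifts e) h0) as [h [H0 Hh]].
  - split; [apply (motion_restrict 1); auto|]. split.
    + intros z Hz n Hn. apply Hd; auto; [apply idx_le; auto|lra].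
    + intros n z Hn Hz. destruct (Hd n z (idx_le n Hn) ltac:(lra) Hn) as [_ T].
      specialize (HB n (idx_le n Hn)). unfold M. lra.
  - intros h [A1 [A2 A3]]. destruct (lift_step e h Pe A1 A2) as [k [B1 [B2 B3]]].
    exists k. split; auto. split; [|split]; auto.
    intros n z Hn Hz. destruct (B3 z Hz) as [C1 C2]. destruct Hn as [Hn|[Hn Zn]].
    + destruct (C2 n Hn) as [[Un _] _].
      assert (T := diam_strict (k n z) (RtoC 0) Un adherent_zero).
      replace (k n z - 0)%C with (k n z) in T by ring. unfold M. lra.
    + subst n. rewrite C1, Cmod_0 by auto. unfold M. lra.
  - exists e, M, h. split; [lra|]. split; [unfold M; lra|]. split; auto.
    split; [|split].
    + intros k. apply (Hh k).
    + intros k. apply (Hh k).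
    + intros k n z Hn Hz. apply (Hh k); auto.
Qed.

Variable df : nat -> C.
Hypothesis Hdf : forall n, (1 <= n <= N)%nat -> dC f (X n) (df n).

Lemma df_neq0 n : (1 <= n <= N)%nat -> df n <> RtoC 0.
Proof. intros Hn. apply (f_deriv_neq0 (X n)); auto. Qed.

(* The jets of the successive lifts relative to an approximate orbit [r] obey an affine
   recursion, and by Cauchy's estimates they stay bounded. *)
Fixpoint jets (b0 err : nat -> C) (k n : nat) : C :=
  match k with
  | O => b0 n
  | S k => if Nat.eq_dec n 0 then RtoC 0
           else ((jets b0 err k (nxt n) - jets b0 err k 1%nat - err n) / df n)%C
  end.

(** Used twice: with [r] the orbit of a moving parameter, whose last relation has a defect of order
    [m], and with [r] constant and [m = 1], where the jets are ordinary first derivatives. *)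
Lemma jets_bounded h0 (m : nat) (r E : nat -> C -> C) b0 err rho : motion 1 h0 -> 0 < rho ->
  (forall n, idx n -> r n (RtoC 0) = X n /\ holo (ball_at (RtoC 0) rho) (r n)) ->
  (forall z, Cmod z < rho -> r O z = RtoC 0) ->
  (forall n z, (1 <= n <= N)%nat -> Cmod z < rho -> f (r n z) = (r (nxt n) z - r 1%nat z + E n z)%C) ->
  (forall n, (1 <= n <= N)%nat -> little_o m (E n) (err n)) ->
  (forall n, idx n -> little_o m (fun z => h0 n z - r n z)%C (b0 n)) ->
  exists B, forall k n, idx n -> Cmod (jets b0 err k n) <= B.
Proof.
  intros Hm Prho Hr Hr0 HfE HE Hb0.
  destruct (lift_sequence h0 Hm) as [e [M [h [He [PM [H0 [Hmot [Hl HM]]]]]]]].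
  (* Under [f], the difference between the next lift and [r n] becomes a combination of stage [k]
     differences and [E n]; the pullback divides its leading coefficient by [df n]. At index [0]
     both functions vanish near [0]. *)
  assert (Lo : forall k n, idx n -> little_o m (fun z => h k n z - r n z)%C (jets b0 err k n)).
  { induction k; intros n Hn.
    - rewrite H0. apply Hb0; auto.
    - simpl. destruct (Nat.eq_dec n 0) as [E0|E0].
      + subst n. destruct Hn as [Hn|[_ Zn]]; [lia|].
        apply (little_o_ext m (fun _ => RtoC 0) _ _ (Rmin e rho)); [apply Rmin_pos; lra| |apply little_o_zero].
        intros z Hz. assert (m1 := Rmin_l e rho). assert (m2 := Rmin_r e rho).
        rewrite Hr0 by lra. destruct (Hl k z ltac:(lra)) as [T _]. rewrite T by auto. ring.
      + assert (Hn1 : (1 <= n <= N)%nat) by (destruct Hn as [Hn|[Hn _]]; lia).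
        destruct (HX n Hn1) as [Un _]. destruct (f_holo_near _ Un) as [R0 [HR Hfn]].
        destruct (Hmot (S k)) as [A1 [_ A3]]. destruct (Hr n Hn) as [R1 R2].
        apply (little_o_pullback m f (X n) R0 (df n)); auto.
        * apply df_neq0; auto.
        * eapply holo_cont; [apply A3; auto|]. apply (proj2 (ball_at_0 _ _)). rewrite Cmod_0. lra.
        * eapply holo_cont; [exact R2|]. apply (proj2 (ball_at_0 _ _)). rewrite Cmod_0. lra.
        * apply (little_o_ext m (fun z => (h k (nxt n) z - r (nxt n) z) - (h k 1%nat z - r 1%nat z) - E n z)%C
            _ _ (Rmin e rho)); [apply Rmin_pos; lra| |].
          -- intros z Hz. assert (m1 := Rmin_l e rho). assert (m2 := Rmin_r e rho).
             destruct (Hl k z ltac:(lra)) as [_ T]. rewrite (proj2 (T n Hn1)), HfE by (auto; lra). ring.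
          -- apply little_o_minus; [apply little_o_minus|].
             ++ apply IHk. apply idx_nxt; auto.
             ++ apply IHk. apply idx_1.
             ++ apply HE; auto. }
  set (s := Rmin e rho / 2).
  assert (Ps : 0 < Rmin e rho) by (apply Rmin_pos; lra).
  assert (m1 := Rmin_l e rho). assert (m2 := Rmin_r e rho).
  assert (HB : forall n, exists B, 0 < B /\ (idx n -> forall z, Cmod z <= s -> Cmod (r n z) <= B)).
  { intros n. destruct (classic (idx n)) as [In|Nn]; [|exists 1; split; [lra|tauto]].
    destruct (holo_locally_bounded (r n) (RtoC 0) rho s) as [B [PB HB]].
    - apply Hr; auto.
    - unfold s. lra.
    - exists B. split; auto. intros _ z Hz. apply HB. replace (z - 0)%C with z by ring. auto. }
  assert (HBB : exists B, 0 < B /\ forall n, (n <= N)%nat -> idx n -> forall z, Cmod z <= s -> Cmod (r n z) <= B).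
  { clear - HB. induction N as [|j IH].
    - destruct (HB O) as [B [PB HB']]. exists B. split; auto. intros n Hn. replace n with O by lia. auto.
    - destruct IH as [B1 [P1 H1]]. destruct (HB (S j)) as [B2 [P2 H2]].
      exists (B1 + B2). split; [lra|]. intros n Hn In z Hz.
      destruct (Nat.eq_dec n (S j)) as [E|E].
      + subst n. specialize (H2 In z Hz). lra.
      + specialize (H1 n ltac:(lia) In z Hz). lra. }
  destruct HBB as [B [PB HBB]].
  exists ((M + B) / s ^ m). intros k n Hn.
  apply (cauchy_coefficient m (fun z => h k n z - r n z)%C s (Rmin e rho) (M + B)).
  - apply holo_minus.
    + destruct (Hmot k) as [_ [_ A3]]. apply (holo_sub (ball_at (RtoC 0) e)); auto.
      intros z Hz. unfold ball_at in *. lra.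
    + apply (holo_sub (ball_at (RtoC 0) rho)); [|apply Hr; auto]. intros z Hz. unfold ball_at in *. lra.
  - unfold s. lra.
  - lra.
  - intros z Hz. eapply Rle_trans; [apply Cmod_sub_le|].
    assert (T1 := HM k n z Hn ltac:(unfold s in *; lra)).
    assert (T2 := HBB n (idx_le n Hn) Hn z ltac:(lra)). lra.
  - apply Lo; auto.
Qed.

(** * The critical relation as a function of the parameter *)

(** The orbit of [w] under [z |-> f z + w], which is [G_w]. Index [0] carries the constant critical
    point, so that a return to it is one more value of [nxt N]. *)
Fixpoint orb (n : nat) (w : C) : C :=
  match n with
  | O => RtoC 0
  | S m => match m with O => w | S _ => (f (orb m w) + w)%C end
  end.

(** At [s = 1] these are the derivatives of [orb n] at [c_1]. In general, if the last relation
    closes up, they form an eigenvector with eigenvalue [s] of the operator that linearises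
    lifting. *)
Fixpoint dorb (s : R) (n : nat) : C :=
  match n with
  | O => RtoC 0
  | S m => match m with O => RtoC 1 | S _ => (RtoC s * df m * dorb s m + RtoC 1)%C end
  end.

Lemma orb_SS n w : (1 <= n)%nat -> orb (S n) w = (f (orb n w) + w)%C.
Proof using Type. clear. destruct n; [lia|]. reflexivity. Qed.

Lemma dorb_SS s n : (1 <= n)%nat -> dorb s (S n) = (RtoC s * df n * dorb s n + RtoC 1)%C.
Proof using Type. clear. destruct n; [lia|]. reflexivity. Qed.

Lemma orb_X n : (1 <= n <= N)%nat -> orb n (X 1%nat) = X n.
Proof.
  induction n as [|n IH]; intros Hn; [lia|]. destruct (Nat.eq_dec n 0) as [E|E]; [subst; reflexivity|].
  rewrite orb_SS, IH, HfX, nxt_S by lia. ring.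
Qed.

Lemma orb_idx n : idx n -> orb n (X 1%nat) = X n.
Proof. intros [H|[H _]]; [apply orb_X; auto|subst; simpl; auto]. Qed.

Lemma minus0_U_open z : minus0 U z -> exists d, 0 < d /\ forall w, Cmod (w - z) < d -> minus0 U w.
Proof.
  intros [Uz Nz]. destruct (U_open_ball z Uz) as [d1 [P1 H1]].
  destruct (cont_neq (fun w => w) z (RtoC 0) (cont_id z) Nz) as [d2 [P2 H2]].
  exists (Rmin d1 d2). split; [apply Rmin_pos; auto|]. intros w Hw.
  assert (m1 := Rmin_l d1 d2). assert (m2 := Rmin_r d1 d2). split; [apply H1|apply H2]; lra.
Qed.

Lemma orb_holo : exists rho, 0 < rho /\
  (forall n, (n <= S N)%nat -> holo (ball_at (X 1%nat) rho) (orb n)) /\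
  (forall n w, (1 <= n <= N)%nat -> ball_at (X 1%nat) rho w -> minus0 U (orb n w)).
Proof.
  assert (Q : forall n, (1 <= n <= N)%nat -> exists rho, 0 < rho /\
    forall j, (1 <= j <= n)%nat -> holo (ball_at (X 1%nat) rho) (orb j) /\
      forall w, ball_at (X 1%nat) rho w -> minus0 U (orb j w)).
  { induction n as [|n IH]; intros Hn; [lia|]. destruct (Nat.eq_dec n 0) as [E|E].
    - subst n. destruct (minus0_U_open _ (HX 1%nat ltac:(lia))) as [d [Pd Hd]].
      exists d. split; auto. intros j Hj. replace j with 1%nat by lia. split; [apply holo_id|]. exact Hd.
    - destruct IH as [rho [Pr Hr]]; [lia|].
      assert (Hh : holo (ball_at (X 1%nat) rho) (orb (S n))).
      { destruct (Hr n ltac:(lia)) as [A B].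
        intros w Hw. destruct (A w Hw) as [a Ha]. destruct (B w Hw) as [Uw _].
        destruct (f_holo _ Uw) as [l Hl].
        exists (l * a + RtoC 1)%C. apply (dC_ext (fun w => f (orb n w) + w)%C).
        + intros y. symmetry. apply orb_SS. lia.
        + apply dC_plus; [apply dC_comp; auto|apply dC_id]. }
      assert (Cc := holo_cont _ _ _ Hh (ball_at_center _ rho Pr)).
      destruct (minus0_U_open _ (HX (S n) Hn)) as [d [Pd Hd]].
      destruct (Cc d Pd) as [d2 [P2 H2]]. rewrite orb_X in H2 by auto.
      exists (Rmin rho d2). split; [apply Rmin_pos; auto|].
      assert (m1 := Rmin_l rho d2). assert (m2 := Rmin_r rho d2).
      intros j Hj. destruct (Nat.eq_dec j (S n)) as [Ej|Ej].
      + subst j. split.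
        * apply (holo_sub (ball_at (X 1%nat) rho)); auto. intros z Hz. unfold ball_at in *. lra.
        * intros w Hw. apply Hd, H2. unfold ball_at in Hw. lra.
      + destruct (Hr j ltac:(lia)) as [A B]. split.
        * apply (holo_sub (ball_at (X 1%nat) rho)); auto. intros z Hz. unfold ball_at in *. lra.
        * intros w Hw. apply B. unfold ball_at in *. lra. }
  destruct (Q N ltac:(lia)) as [rho [Pr Hr]]. exists rho. split; auto. split.
  - intros n Hn. destruct (Nat.eq_dec n 0) as [E|E]; [subst; apply holo_const|].
    destruct (Nat.eq_dec n (S N)) as [E2|E2]; [|apply Hr; lia]. subst n.
    destruct (Hr N ltac:(lia)) as [A B].
    intros w Hw. destruct (A w Hw) as [a Ha]. destruct (B w Hw) as [Uw _].
    destruct (f_holo _ Uw) as [l Hl].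
    exists (l * a + RtoC 1)%C. apply (dC_ext (fun w => f (orb N w) + w)%C).
    + intros y. symmetry. apply orb_SS. lia.
    + apply dC_plus; [apply dC_comp; auto|apply dC_id].
  - intros n w Hn Hw. apply (Hr n); auto.
Qed.

Lemma orb_deriv n : (n <= S N)%nat -> dC (orb n) (X 1%nat) (dorb 1 n).
Proof.
  induction n as [|n IH]; intros Hn; [apply dC_const|].
  destruct (Nat.eq_dec n 0) as [E|E]; [subst; apply dC_id|].
  rewrite dorb_SS by lia. apply (dC_ext (fun w => f (orb n w) + w)%C).
  - intros y. symmetry. apply orb_SS. lia.
  - replace (RtoC 1 * df n * dorb 1 n + RtoC 1)%C with (df n * dorb 1 n + RtoC 1)%C by ring.
    apply dC_plus; [|apply dC_id]. apply dC_comp; [apply IH; lia|].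
    rewrite orb_X by lia. apply Hdf. lia.
Qed.

Definition relation (w : C) : C := (orb (S N) w - orb (nxt N) w)%C.

(** Distinct starting points stay distinct for a short while; the variable is rescaled by [s]
    because the sequence of lifts starts from a motion over the unit disc. *)
Lemma motion_of_family (h : nat -> C -> C) rho : 0 < rho ->
  (forall n, idx n -> h n (RtoC 0) = X n) ->
  (forall n, idx n -> holo (ball_at (RtoC 0) rho) (h n)) ->
  exists s, 0 < s <= rho /\ motion 1 (fun n z => h n (RtoC s * z)%C).
Proof.
  intros Pr H0 Hh.
  destruct (finite_radius N (fun n z => forall m, (m <= N)%nat -> idx m -> idx n -> m <> n -> h m z <> h n z))
    as [d [Pd Hd]].
  { intros n _.
    destruct (finite_radius N (fun m z => idx m -> idx n -> m <> n -> h m z <> h n z)) as [d [Pd Hd]].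
    - intros m _. destruct (classic (idx m /\ idx n /\ m <> n)) as [[Im [In Nmn]]|No].
      + assert (Cc : cont_at (fun z => h m z - h n z)%C (RtoC 0)).
        { apply cont_minus; (eapply holo_cont; [apply Hh; auto|apply ball_at_center; auto]). }
        destruct (cont_neq _ (RtoC 0) (RtoC 0) Cc) as [d [Pd Hd]].
        { rewrite !H0 by auto. intros E. apply Nmn. apply Xinj; try (apply idx_le; auto).
          replace (X m) with (X m - X n + X n)%C by ring. rewrite E. ring. }
        exists d. split; auto. intros z Hz _ _ _ E. apply (Hd z); [replace (z - 0)%C with z by ring; auto|].
        rewrite E. ring.
      + exists 1. split; [lra|]. tauto.
    - exists d. split; auto. }
  set (s := Rmin d rho). assert (m1 := Rmin_l d rho). assert (m2 := Rmin_r d rho). fold s in m1, m2.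
  assert (Ps : 0 < s) by (apply Rmin_pos; auto).
  assert (Sc : forall z, Cmod z < 1 -> Cmod (RtoC s * z) < s).
  { intros z Hz. rewrite Cmod_mult, Cmod_R, Rabs_pos_eq by lra. nra. }
  exists s. split; [lra|]. split; [|split].
  - intros n Hn. rewrite Cmult_0_r. apply H0; auto.
  - intros z Hz m n Hm Hn E. apply NNPP. intros Nmn.
    apply (Hd n (RtoC s * z)%C (idx_le n Hn) ltac:(specialize (Sc z Hz); lra) m (idx_le m Hm) Hm Hn Nmn E).
  - intros n Hn. apply (holo_comp _ (ball_at (RtoC 0) rho) (h n)); [|apply holo_mult; [apply holo_const|apply holo_id]|auto].
    intros z Hz. apply (proj1 (ball_at_0 _ _)) in Hz. apply (proj2 (ball_at_0 _ _)). specialize (Sc z Hz). lra.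
Qed.

Fixpoint csum (b : nat -> C) (K : nat) : C :=
  match K with O => RtoC 0 | S k => (csum b k + b k)%C end.

Lemma csum_shift b K : csum (fun k => b (S k)) K = (csum b K + b K - b O)%C.
Proof. induction K; simpl; [ring|]. rewrite IHK. ring. Qed.

(* Summing the recursion of the jets over [k < K], the sums [s_n] satisfy
   [s_(n+1) = f'(c_n) s_n + s_1 + O(1)], hence [s_n = dorb n * s_1 + O(1)], while the defect
   of the last relation grows like [K * a]. *)
Lemma no_degenerate_jets a B : a <> RtoC 0 -> dorb 1 (S N) = dorb 1 (nxt N) ->
  (forall k n, idx n -> Cmod (jets (fun _ => RtoC 0) (fun n => if Nat.eq_dec n N then a else RtoC 0) k n) <= B) ->
  False.
Proof.
  intros Na Hd HB. set (err := fun n => if Nat.eq_dec n N then a else RtoC 0) in *.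
  set (b := jets (fun _ => RtoC 0) err) in *.
  set (s := fun K n => csum (fun k => b k n) K).
  assert (PB : 0 <= B).
  { specialize (HB O 1%nat idx_1). assert (Q := Cmod_ge_0 (b O 1%nat)). lra. }
  (* The recursion summed over [k < K]. Its left side runs over [b (S k)], and as [b 0 = 0] this
     shifted sum is [s K n + b K n]. *)
  assert (Rec : forall n K, (1 <= n <= N)%nat ->
    (df n * (s K n + b K n))%C = (s K (nxt n) - s K 1%nat - RtoC (INR K) * err n)%C).
  { intros n K Hn. assert (T := csum_shift (fun k => b k n) K). cbv beta in T.
    change (csum (fun k => b k n) K) with (s K n) in T.
    replace (b O n) with (RtoC 0) in T by reflexivity.
    replace (s K n + b K n)%C with (csum (fun k => b (S k) n) K) by (rewrite T; ring).
    clear T. unfold s. induction K; [simpl; ring|].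
    rewrite S_INR, RtoC_plus. simpl csum. rewrite Cmult_plus_distr_l, IHK.
    assert (Eb : (df n * b (S K) n)%C = (b K (nxt n) - b K 1%nat - err n)%C).
    { unfold b. simpl. destruct (Nat.eq_dec n 0) as [E|E]; [lia|]. field. apply df_neq0; auto. }
    rewrite Eb. ring. }
  assert (Bd : forall n, (1 <= n <= N)%nat -> exists M, 0 <= M /\
    forall K, Cmod (s K n - dorb 1 n * s K 1%nat) <= M).
  { induction n as [|n IH]; intros Hn; [lia|]. destruct (Nat.eq_dec n 0) as [E|E].
    - subst n. exists 0. split; [lra|]. intros K. simpl dorb.
      replace (s K 1%nat - 1 * s K 1%nat)%C with (RtoC 0) by ring. rewrite Cmod_0. lra.
    - destruct IH as [M [PM HM]]; [lia|]. exists (Cmod (df n) * (M + B)).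
      split; [apply Rmult_le_pos; [apply Cmod_ge_0|lra]|]. intros K.
      assert (T := Rec n K ltac:(lia)). rewrite nxt_S in T by lia.
      unfold err in T. destruct (Nat.eq_dec n N) as [E2|E2]; [lia|].
      rewrite dorb_SS by lia.
      replace (s K (S n) - (RtoC 1 * df n * dorb 1 n + RtoC 1) * s K 1%nat)%C
        with (df n * ((s K n - dorb 1 n * s K 1%nat) + b K n) +
              ((s K (S n) - s K 1%nat - RtoC (INR K) * RtoC 0) - df n * (s K n + b K n)))%C by ring.
      rewrite <- T. replace (df n * (s K n + b K n) - df n * (s K n + b K n))%C with (RtoC 0) by ring.
      rewrite Cplus_0_r, Cmod_mult. apply Rmult_le_compat_l; [apply Cmod_ge_0|].
      eapply Rle_trans; [apply Cmod_triangle|]. specialize (HM K).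
      specialize (HB K n). fold (b K n) in HB. specialize (HB ltac:(left; lia)). lra. }
  destruct (Bd N ltac:(lia)) as [M1 [P1 H1]].
  assert (H2 : exists M2, 0 <= M2 /\ forall K, Cmod (s K (nxt N) - dorb 1 (nxt N) * s K 1%nat) <= M2).
  { destruct (idx_nxt N ltac:(lia)) as [I|[I _]]; [apply Bd; auto|].
    rewrite I. exists 0. split; [lra|]. intros K. simpl dorb.
    assert (Z : s K O = RtoC 0).
    { assert (Zb : forall k, b k O = RtoC 0) by (destruct k; reflexivity).
      unfold s. clear - Zb. induction K; simpl; auto. rewrite IHK, Zb. ring. }
    rewrite Z. replace (RtoC 0 - RtoC 0 * s K 1%nat)%C with (RtoC 0) by ring. rewrite Cmod_0. lra. }
  destruct H2 as [M2 [P2 H2]].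
  assert (Pa : 0 < Cmod a) by (apply Cmod_gt_0; auto).
  set (M := M2 + Cmod (df N) * (M1 + B)).
  destruct (archimed_cor1 (Cmod a / (M + 1))) as [K [HK PK]].
  { apply Rdiv_lt_0_compat; auto. unfold M. assert (Q := Cmod_ge_0 (df N)). nra. }
  assert (PM : 0 <= M) by (unfold M; assert (Q := Cmod_ge_0 (df N)); nra).
  assert (T := Rec N K ltac:(lia)). unfold err in T. destruct (Nat.eq_dec N N) as [_|E]; [|congruence].
  rewrite dorb_SS in Hd by lia.
  (* The sum [s K 1] itself may be unbounded; equality of the two [dorb] values is exactly what
     makes it cancel. *)
  assert (E : (RtoC (INR K) * a)%C = ((s K (nxt N) - dorb 1 (nxt N) * s K 1%nat)
     - df N * ((s K N - dorb 1 N * s K 1%nat) + b K N))%C).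
  { rewrite <- Hd.
    replace (RtoC (INR K) * a)%C with (s K (nxt N) - s K 1%nat - (s K (nxt N) - s K 1%nat - RtoC (INR K) * a))%C by ring.
    rewrite <- T. ring. }
  assert (L : INR K * Cmod a <= M).
  { rewrite <- (Rabs_pos_eq (INR K)) by apply pos_INR. rewrite <- Cmod_R, <- Cmod_mult, E.
    eapply Rle_trans; [apply Cmod_sub_le|]. unfold M. rewrite Cmod_mult. apply Rplus_le_compat; [apply H2|].
    apply Rmult_le_compat_l; [apply Cmod_ge_0|]. eapply Rle_trans; [apply Cmod_triangle|].
    specialize (H1 K). specialize (HB K N). fold (b K N) in HB. specialize (HB ltac:(left; lia)). lra. }
  assert (PK' : 0 < INR K) by (apply lt_0_INR; auto).
  assert (Cmod a / (M + 1) * INR K <= M / (M + 1)).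
  { unfold Rdiv. replace (Cmod a * / (M + 1) * INR K) with (INR K * Cmod a * / (M + 1)) by ring.
    apply Rmult_le_compat_r; auto. left. apply Rinv_0_lt_compat. lra. }
  assert (M / (M + 1) < 1).
  { apply Rmult_lt_reg_r with (M + 1); [lra|]. unfold Rdiv. rewrite Rmult_assoc, Rinv_l by lra. lra. }
  assert (/ INR K * INR K < Cmod a / (M + 1) * INR K) by (apply Rmult_lt_compat_r; auto).
  rewrite Rinv_l in H3 by lra. lra.
Qed.

(** The motion to be lifted and the approximate orbit are here the same family, so the jets start
    from zero and only the defect of the last relation drives them. *)
Lemma transversal_or_flat : dorb 1 (S N) <> dorb 1 (nxt N) \/
  exists rho, 0 < rho /\ forall w, ball_at (X 1%nat) rho w -> relation w = RtoC 0.
Proof.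
  destruct (Ceq_dec (dorb 1 (S N)) (dorb 1 (nxt N))) as [Hd|Hd]; [right|left; exact Hd].
  destruct orb_holo as [rho [Pr [Ho HU]]].
  assert (HR : holo (ball_at (X 1%nat) rho) relation) by (apply holo_minus; apply Ho; lia).
  destruct (order_dichotomy relation _ rho Pr HR) as [Z|[m [q [Hq [Nq Eq]]]]].
  { exists rho. auto. }
  exfalso.
  set (h := fun n z => orb n (X 1%nat + z)%C).
  assert (Hh : forall n, (n <= S N)%nat -> holo (ball_at (RtoC 0) rho) (h n)).
  { intros n Hn. unfold h. apply (holo_comp _ (ball_at (X 1%nat) rho)); [| |apply Ho; auto].
    - intros z Hz. unfold ball_at in *. replace (X 1%nat + z - X 1%nat)%C with (z - RtoC 0)%C by ring. auto.
    - apply holo_plus; [apply holo_const|apply holo_id]. }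
  assert (h00 : forall n, idx n -> h n (RtoC 0) = X n).
  { intros n Hn. unfold h. rewrite Cplus_0_r. apply orb_idx; auto. }
  destruct (motion_of_family h rho Pr h00) as [s [Hs Hm]].
  { intros n Hn. apply Hh. assert (T := idx_le n Hn). lia. }
  assert (Hsb : forall z, Cmod z < 1 -> ball_at (X 1%nat) rho (X 1%nat + RtoC s * z)%C).
  { intros z Hz. unfold ball_at. replace (X 1%nat + s * z - X 1%nat)%C with (RtoC s * z)%C by ring.
    rewrite Cmod_mult, Cmod_R, Rabs_pos_eq by lra. assert (Q := Cmod_ge_0 z). nra. }
  (* Leading coefficient of the defect after rescaling: [relation (c_1 + s z)] behaves like
     [(s z) ^ m q(c_1)]. *)
  set (a := (RtoC s ^ m * q (X 1%nat))%C).
  destruct (jets_bounded (fun n z => h n (RtoC s * z)%C) m (fun n z => h n (RtoC s * z)%C)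
    (fun n z => if Nat.eq_dec n N then relation (X 1%nat + RtoC s * z)%C else RtoC 0)
    (fun _ => RtoC 0) (fun n => if Nat.eq_dec n N then a else RtoC 0) 1) as [B HB].
  - exact Hm.
  - lra.
  - intros n Hn. destruct Hm as [A1 [_ A3]]. auto.
  - intros z _. reflexivity.
  - intros n z Hn Hz. unfold h. specialize (HU n _ Hn (Hsb z Hz)).
    assert (T := orb_SS n (X 1%nat + RtoC s * z)%C ltac:(lia)).
    change (orb 1 (X 1%nat + RtoC s * z)%C) with (X 1%nat + RtoC s * z)%C.
    destruct (Nat.eq_dec n N) as [E|E].
    + subst n. unfold relation. rewrite T. ring.
    + rewrite nxt_S, T by lia. ring.
  - intros n Hn. destruct (Nat.eq_dec n N) as [E|E]; [|apply little_o_zero].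
    intros e He.
    assert (Cq := holo_cont _ _ _ Hq (ball_at_center _ rho Pr)).
    assert (Ps : 0 < s ^ m) by (apply pow_lt; lra).
    destruct (Cq (e / s ^ m)) as [d [Pd Hdq]]; [apply Rdiv_lt_0_compat; auto|].
    exists (Rmin 1 (d / s)). split; [apply Rmin_pos; [lra|apply Rdiv_lt_0_compat; lra]|].
    intros z Hz. assert (m1 := Rmin_l 1 (d / s)). assert (m2 := Rmin_r 1 (d / s)).
    rewrite Eq by (apply Hsb; lra).
    replace ((X 1%nat + RtoC s * z - X 1%nat) ^ m * q (X 1%nat + RtoC s * z) - a * z ^ m)%C
      with (RtoC s ^ m * z ^ m * (q (X 1%nat + RtoC s * z) - q (X 1%nat)))%C.
    + rewrite !Cmod_mult, !Cmod_pow, Cmod_R, Rabs_pos_eq by lra.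
      replace (e * Cmod z ^ m) with (s ^ m * Cmod z ^ m * (e / s ^ m)) by (field; lra).
      apply Rmult_le_compat_l.
      * apply Rmult_le_pos; [lra|]. apply pow_le; lra.
      * left. apply Hdq. replace (X 1%nat + RtoC s * z - X 1%nat)%C with (RtoC s * z)%C by ring.
        rewrite Cmod_mult, Cmod_R, Rabs_pos_eq by lra.
        apply Rlt_le_trans with (s * (d / s)); [apply Rmult_lt_compat_l; lra|]. right; field; lra.
    + unfold a. replace (X 1%nat + RtoC s * z - X 1%nat)%C with (RtoC s * z)%C by ring.
      rewrite Cpow_mult_l. ring.
  - intros n Hn. apply (little_o_ext m (fun _ => RtoC 0) _ _ 1); [lra| |apply little_o_zero].
    intros z _. ring.
  - apply (no_degenerate_jets a B); auto. unfold a. apply Cmult_neq_0; auto.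
    apply Cpow_nz. apply RtoC_neq0. lra.
Qed.

(** If the relation closed up, the first-order jets of the linear motion [X n + z * dorb s n] would
    be multiplied by [s] at each lift, against their boundedness. Index [1], where [dorb] is [1],
    shows the growth. *)
Lemma no_expanding_relation s : 1 < s -> dorb s (S N) <> dorb s (nxt N).
Proof.
  intros Hs E.
  set (h := fun n z => (X n + z * dorb s n)%C).
  assert (Hh : forall n, idx n -> holo (ball_at (RtoC 0) 1) (h n)).
  { intros n Hn. apply holo_plus; [apply holo_const|]. apply holo_mult; [apply holo_id|apply holo_const]. }
  assert (h00 : forall n, idx n -> h n (RtoC 0) = X n) by (intros; unfold h; ring).
  destruct (motion_of_family h 1 ltac:(lra) h00 Hh) as [r [Hr Hm]].
  set (b0 := fun n => (RtoC r * dorb s n)%C).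
  destruct (jets_bounded (fun n z => h n (RtoC r * z)%C) 1 (fun n _ => X n)
    (fun _ _ => RtoC 0) b0 (fun _ => RtoC 0) 1) as [B HB].
  - exact Hm.
  - lra.
  - intros n Hn. split; auto. apply holo_const.
  - intros z _. exact X0.
  - intros n z Hn _. rewrite HfX by auto. ring.
  - intros n Hn. apply little_o_zero.
  - intros n Hn e He. exists 1. split; [lra|]. intros z Hz.
    replace (h n (RtoC r * z) - X n - b0 n * z ^ 1)%C with (RtoC 0) by (unfold h, b0; simpl; ring).
    rewrite Cmod_0. apply Rmult_le_pos; [lra|apply pow_le; lra].
  - assert (J : forall k n, idx n -> jets b0 (fun _ => RtoC 0) k n = (RtoC s ^ k * b0 n)%C).
    { induction k; intros n Hn; [simpl; ring|]. simpl jets.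
      destruct (Nat.eq_dec n 0) as [E0|E0]; [subst n; unfold b0; simpl; ring|].
      assert (Hn1 : (1 <= n <= N)%nat) by (destruct Hn as [Hn|[Hn _]]; lia).
      rewrite !IHk by (try apply idx_1; apply idx_nxt; auto).
      assert (Ed : dorb s (nxt n) = (RtoC s * df n * dorb s n + RtoC 1)%C).
      { rewrite <- dorb_SS by lia. destruct (Nat.eq_dec n N) as [En|En]; [subst; auto|].
        rewrite nxt_S by lia. reflexivity. }
      unfold b0. rewrite Ed. simpl dorb. simpl Cpow. field. apply df_neq0; auto. }
    destruct (Pow_x_infinity s ltac:(rewrite Rabs_pos_eq; lra) (B / r + 1)) as [K HK].
    specialize (HK K (le_n _)). rewrite Rabs_pos_eq in HK by (apply pow_le; lra).
    specialize (HB K 1%nat idx_1). rewrite J in HB by apply idx_1. unfold b0 in HB. simpl dorb in HB.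
    rewrite Cmult_1_r, Cmod_mult, Cmod_pow, !Cmod_R, !Rabs_pos_eq in HB by lra.
    assert (B / r + 1 <= B / r); [|lra].
    eapply Rle_trans; [apply Rge_le; exact HK|]. apply Rmult_le_reg_r with r; [lra|].
    replace (B / r * r) with B by (field; lra). exact HB.
Qed.

(** * A persistent critical relation is impossible *)

Definition half (t : C) : Prop := fst t < 0.

Lemma half_convex : convex half.
Proof.
  intros a b t Ha Hb Ht. unfold half, pt in *. simpl.
  destruct (Req_dec t 0) as [E|E]; [subst; lra|].
  assert (t * fst b < 0) by nra. nra.
Qed.

Lemma half_open z : half z -> exists d, 0 < d /\ forall w, Cmod (w - z) < d -> half w.
Proof.
  unfold half. intros H. exists (- fst z). split; [lra|]. intros w Hw.
  assert (T := re_le_Cmod (w - z)). simpl in T. assert (T' := Rle_abs (fst w + - fst z)). lra.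
Qed.

(** Uniform in [y], so that it survives a passage to the limit in which the other point moves. *)
Lemma diam_gap x : U x -> exists g, 0 < g /\ forall y, adherent U y -> Cmod (x - y) <= dlt - g.
Proof.
  intros Hx. destruct (U_open_ball x Hx) as [d [Pd Hd]]. exists (d / 2). split; [lra|]. intros y Hy.
  destruct (Ceq_dec x y) as [E|E].
  - subst y. rewrite Cmod_self. destruct (ball_point x (d/2)) as [w [Nw Ew]]; [lra|].
    assert (T := diam_le w x (Hd w ltac:(lra)) Hx). lra.
  - assert (P := Cmod_sub_neq _ _ E). set (s := d / (2 * Cmod (x - y))).
    assert (Ps : 0 < s) by (apply Rdiv_lt_0_compat; lra).
    set (w := (x + RtoC s * (x - y))%C).
    assert (Es : s * Cmod (x - y) = d / 2) by (unfold s; field; lra).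
    assert (Hw : Cmod (w - x) < d).
    { unfold w. replace (x + s * (x - y) - x)%C with (RtoC s * (x - y))%C by ring.
      rewrite Cmod_mult, Cmod_R, Rabs_pos_eq by lra. lra. }
    assert (T := diam_adherent w y (adherent_self w (Hd w Hw)) Hy).
    replace (w - y)%C with (RtoC (1 + s) * (x - y))%C in T by (unfold w; rewrite RtoC_plus; ring).
    rewrite Cmod_mult, Cmod_R, Rabs_pos_eq in T by lra. lra.
Qed.

(** The half-plane is convex and [dlt * exp] maps it into the punctured disc of radius [dlt], so the
    branch of the inverse of [f] at each marked point is defined on all of it. The base value [t0 i]
    lies there because [Cmod (f (X (S i))) < dlt]. *)
Lemma half_lifts_exist : exists (psi : nat -> C -> C) (t0 : nat -> C), forall i, (i < N)%nat ->
  half (t0 i) /\ psi i (t0 i) = X (S i) /\ holo half (psi i) /\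
  forall t, half t -> minus0 U (psi i t) /\ f (psi i t) = (RtoC dlt * Cexp t)%C.
Proof.
  assert (Pd := diam_pos).
  assert (Q : forall i, exists pt0 : (C -> C) * C, (i < N)%nat ->
    half (snd pt0) /\ fst pt0 (snd pt0) = X (S i) /\ holo half (fst pt0) /\
    forall t, half t -> minus0 U (fst pt0 t) /\ f (fst pt0 t) = (RtoC dlt * Cexp t)%C).
  { intros i. destruct (le_lt_dec N i) as [L|L]; [exists (fun z => z, RtoC 0); intros; lia|].
    assert (Hi : (1 <= S i <= N)%nat) by lia.
    assert (Nf : (f (X (S i)) / RtoC dlt)%C <> RtoC 0).
    { apply Cmod_gt_0. rewrite Cmod_div by (apply RtoC_neq0; lra). apply Rdiv_lt_0_compat.
      - apply Cmod_gt_0, f_neq0, HX; auto.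
      - rewrite Cmod_R, Rabs_pos_eq; lra. }
    destruct (Cexp_surj _ Nf) as [t Et].
    assert (Et' : f (X (S i)) = (RtoC dlt * Cexp t)%C) by (rewrite Et; field; apply RtoC_neq0; lra).
    assert (Ht : half t).
    { assert (S1 : Cmod (f (X (S i))) < dlt).
      { rewrite HfX, Cmod_sub_comm by auto. apply diam_strict; [apply HX; lia|].
        apply X_adherent, idx_nxt; auto. }
      rewrite Et', Cmod_mult, Cmod_Cexp, Cmod_R, Rabs_pos_eq in S1 by lra.
      unfold half. apply exp_lt_inv. rewrite exp_0. nra. }
    destruct (f_lift half t (X (S i)) (fun t => RtoC dlt * Cexp t)%C) as [h [h1 [h2 h3]]]; auto.
    - apply half_convex.
    - apply half_open.
    - intros z Hz. split.
      + rewrite Cmod_mult, Cmod_Cexp, Cmod_R, Rabs_pos_eq by lra.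
        assert (exp (fst z) < 1) by (rewrite <- exp_0; apply exp_increasing; exact Hz). nra.
      + apply Cmult_neq_0; [apply RtoC_neq0; lra|apply Cexp_neq0].
    - apply holo_mult; [apply holo_const|]. intros z _. eexists. apply dC_Cexp.
    - exists (h, t). intros _. simpl. auto. }
  exists (fun i => fst (proj1_sig (constructive_indefinite_description _ (Q i)))),
    (fun i => snd (proj1_sig (constructive_indefinite_description _ (Q i)))).
  intros i Hi. exact (proj2_sig (constructive_indefinite_description _ (Q i)) Hi).
Qed.

Section LogCoordinates.
Variables (psi : nat -> C -> C) (t0 : nat -> C).
Hypothesis Hpsi : forall i, (i < N)%nat ->
  half (t0 i) /\ psi i (t0 i) = X (S i) /\ holo half (psi i) /\
  forall t, half t -> minus0 U (psi i t) /\ f (psi i t) = (RtoC dlt * Cexp t)%C.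

(* Logarithmic coordinates: [p i] determines the marked point of index [i + 1]. *)
Definition pos (p : nat -> C) (n : nat) : C :=
  match n with O => RtoC 0 | S i => psi i (p i) end.

Definition gap (t : C) : C := (RtoC dlt * Cexp t)%C.

Definition in_half (p : nat -> C) : Prop := forall i, (i < N)%nat -> half (p i).

Definition chain (p : nat -> C) : Prop :=
  forall i, (S i < N)%nat -> gap (p i) = (pos p (S (S i)) - pos p 1)%C.

Definition closing (p : nat -> C) : C := (pos p (nxt N) - pos p 1 - gap (p (N - 1)%nat))%C.

Definition Sigma (p : nat -> C) : Prop := in_half p /\ chain p /\ closing p = RtoC 0.

Definition disc_in (P : (nat -> C) -> Prop) (p : nat -> C) (r : R) (g : C -> nat -> C) : Prop :=
  0 < r /\
  (forall i, (i < N)%nat -> g (RtoC 0) i = p i /\ holo (ball_at (RtoC 0) r) (fun z => g z i)) /\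
  (forall z, Cmod z < r -> g z O = (p O + z)%C /\ P (g z)).

(** Isolated solutions are excluded: the maximum principle needs a holomorphic disc through every
    tuple, parametrised by the first coordinate. *)
Definition Sigma0 (p : nat -> C) : Prop := Sigma p /\ exists r g, disc_in Sigma p r g.

Lemma gap_f i t : (i < N)%nat -> half t -> f (psi i t) = gap t.
Proof. intros Hi Ht. apply (Hpsi i Hi). exact Ht. Qed.

Lemma cont_gap t : cont_at gap t.
Proof. apply cont_mult; [apply cont_const|apply cont_Cexp]. Qed.

Lemma cont_psi i t : (i < N)%nat -> half t -> cont_at (psi i) t.
Proof. intros Hi Ht. destruct (Hpsi i Hi) as [_ [_ [H _]]]. eapply holo_cont; eauto. Qed.

Lemma Sigma_rel p n : Sigma p -> (1 <= n <= N)%nat -> gap (p (n - 1)%nat) = (pos p (nxt n) - pos p 1)%C.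
Proof.
  intros [_ [Hc Hcl]] Hn. destruct (Nat.eq_dec n N) as [E|E].
  - subst n. unfold closing in Hcl.
    replace (pos p (nxt N) - pos p 1)%C
      with (pos p (nxt N) - pos p 1 - gap (p (N - 1)%nat) + gap (p (N - 1)%nat))%C by ring.
    rewrite Hcl. ring.
  - rewrite nxt_S by lia. replace (S n) with (S (S (n - 1))) by lia. apply Hc. lia.
Qed.

Lemma pos_U p n : in_half p -> (1 <= n <= N)%nat -> minus0 U (pos p n).
Proof. intros H Hn. destruct n as [|i]; [lia|]. simpl. apply (Hpsi i); [lia|]. apply H; lia. Qed.

Lemma pos_adherent p n : in_half p -> (n <= N)%nat -> adherent U (pos p n).
Proof.
  intros H Hn. destruct n as [|i]; [apply adherent_zero|].
  apply adherent_self. apply (pos_U p (S i)); auto. lia.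
Qed.

Lemma nxt_le n : (1 <= n <= N)%nat -> (nxt n <= N)%nat.
Proof. intros Hn. apply idx_le, idx_nxt; auto. Qed.

Lemma pos_ext p q n : (n <= N)%nat -> (forall i, (i < N)%nat -> p i = q i) -> pos p n = pos q n.
Proof. intros Hn H. destruct n as [|i]; auto. simpl. rewrite H by lia. reflexivity. Qed.

Lemma Sigma_ext p q : (forall i, (i < N)%nat -> p i = q i) -> Sigma p -> Sigma q.
Proof.
  intros H [A [B D]]. assert (H' : forall n, (n <= N)%nat -> pos p n = pos q n) by (intros; apply pos_ext; auto).
  split; [|split].
  - intros i Hi. rewrite <- H by auto. apply A; auto.
  - intros i Hi. rewrite <- H, <- !H' by lia. apply B; auto.
  - unfold closing in *. rewrite <- H, <- !H' by lia. exact D.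
Qed.

(** The chain equations are triangular: coordinate [S j] is determined near [p] by coordinates [0]
    and [j], so coordinate [0] is a free parameter. The closing equation is left aside here and
    imposed later by the identity theorem. *)
Lemma chain_disc p : in_half p -> chain p ->
  exists r g, disc_in (fun q => in_half q /\ chain q) p r g.
Proof.
  intros Hp Hc. assert (Pd := diam_pos).
  assert (Q : forall j, (j < N)%nat -> exists r (g : C -> nat -> C), 0 < r /\
    (forall i, (i <= j)%nat -> g (RtoC 0) i = p i /\ holo (ball_at (RtoC 0) r) (fun z => g z i)) /\
    (forall z, Cmod z < r -> g z O = (p O + z)%C /\ (forall i, (i <= j)%nat -> half (g z i)) /\
      forall i, (S i <= j)%nat -> gap (g z i) = (psi (S i) (g z (S i)) - psi 0 (g z O))%C)).
  { induction j as [|j IH]; intros Hj.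
    - destruct (half_open _ (Hp O ltac:(lia))) as [d [P1 H1]].
      exists d, (fun z _ => (p O + z)%C). split; auto. split.
      + intros i Hi. replace i with O by lia. split; [ring|]. apply holo_plus; [apply holo_const|apply holo_id].
      + intros z Hz. split; auto. split; [|intros; lia]. intros i Hi. apply H1.
        replace (p O + z - p O)%C with z by ring. auto.
    - destruct IH as [r [g [Pr [Hg1 Hg2]]]]; [lia|].
      set (y := fun z => (psi 0 (g z O) + gap (g z j))%C).
      assert (Hyh : holo (ball_at (RtoC 0) r) y).
      { apply holo_plus.
        - apply (holo_comp _ half (psi 0)); [|apply Hg1; lia|apply Hpsi; lia].
          intros z Hz. apply (proj1 (ball_at_0 _ _)) in Hz. apply (Hg2 z Hz). lia.
        - apply (holo_comp _ (fun _ => True) gap); auto; [apply Hg1; lia|].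
          apply holo_mult; [apply holo_const|]. intros z _. eexists; apply dC_Cexp. }
      set (x := psi (S j) (p (S j))).
      destruct (Hpsi (S j) Hj) as [_ [_ [_ Hps]]]. destruct (Hps (p (S j)) (Hp (S j) Hj)) as [Ux Fx].
      fold x in Ux, Fx. fold (gap (p (S j))) in Fx.
      assert (y0 : y (RtoC 0) = x).
      { unfold y. rewrite (proj1 (Hg1 O ltac:(lia))), (proj1 (Hg1 j ltac:(lia))).
        rewrite (Hc j Hj). simpl. fold x. ring. }
      assert (Cy : cont_at y (RtoC 0)).
      { eapply holo_cont; [exact Hyh|]. apply ball_at_center; auto. }
      assert (Ng : gap (p (S j)) <> RtoC 0).
      { apply Cmult_neq_0; [apply RtoC_neq0; lra|apply Cexp_neq0]. }
      destruct (minus0_U_open x Ux) as [d1 [P1 H1]].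
      destruct (Cy d1 P1) as [d2 [P2 H2]]. rewrite y0 in H2.
      destruct Clog_exists as [lg [Hlg [lg1 Elg]]].
      set (v := fun z => (f (y z) / gap (p (S j)))%C).
      set (r1 := Rmin r d2). assert (m1 := Rmin_l r d2). assert (m2 := Rmin_r r d2). fold r1 in m1, m2.
      assert (Pr1 : 0 < r1) by (apply Rmin_pos; auto).
      assert (Uy : forall z, Cmod z < r1 -> minus0 U (y z)).
      { intros z Hz. apply H1, H2. replace (z - 0)%C with z by ring. lra. }
      assert (Hv : holo (ball_at (RtoC 0) r1) v).
      { apply holo_div; [auto| |apply holo_const].
        apply (holo_comp _ U f); [|apply (holo_sub (ball_at (RtoC 0) r)); auto|exact f_holo].
        - intros z Hz. apply (proj1 (ball_at_0 _ _)) in Hz. apply Uy; auto.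
        - intros z Hz. unfold ball_at in *. lra. }
      assert (v0 : v (RtoC 0) = RtoC 1).
      { unfold v. rewrite y0, Fx. field. auto. }
      assert (Cv := holo_cont _ _ _ Hv (ball_at_center _ r1 Pr1)).
      destruct (Cv 1 ltac:(lra)) as [d3 [P3 H3]]. rewrite v0 in H3.
      (* Applying [f] to the desired [psi (S j) (w z) = y z] gives [gap (w z) = f (y z)], solved by
         the logarithm with [w 0 = p (S j)]. Local injectivity of [f] at [x] leads back from equal
         images to equal points. *)
      set (w := fun z => (p (S j) + lg (v z))%C).
      set (r2 := Rmin r1 d3). assert (m3 := Rmin_l r1 d3). assert (m4 := Rmin_r r1 d3). fold r2 in m3, m4.
      assert (Pr2 : 0 < r2) by (apply Rmin_pos; auto).
      assert (Bv : forall z, Cmod z < r2 -> ball_at (RtoC 1) 1 (v z)).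
      { intros z Hz. apply H3. replace (z - 0)%C with z by ring. lra. }
      assert (Hw : holo (ball_at (RtoC 0) r2) w).
      { apply holo_plus; [apply holo_const|]. apply (holo_comp _ (ball_at (RtoC 1) 1) lg); auto.
        - intros z Hz. apply Bv. apply (proj1 (ball_at_0 _ _)) in Hz. auto.
        - apply (holo_sub (ball_at (RtoC 0) r1)); auto. intros z Hz. unfold ball_at in *. lra. }
      assert (w0 : w (RtoC 0) = p (S j)) by (unfold w; rewrite v0, lg1; ring).
      assert (Cw := holo_cont _ _ _ Hw (ball_at_center _ r2 Pr2)).
      assert (Ew : forall z, Cmod z < r2 -> gap (w z) = f (y z)).
      { intros z Hz. unfold w, gap. rewrite Cexp_add, Elg by (apply Bv; auto).
        unfold v. fold (gap (p (S j))). unfold gap. field. split; [|apply RtoC_neq0; lra]. apply Cexp_neq0. }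
      destruct (covering_locally_injective f (minus0 U) (minus0 V) (F_covering _ _ _ hF) x Ux) as [d4 [P4 H4]].
      destruct (half_open _ (Hp (S j) Hj)) as [d5 [P5 H5]].
      assert (Cpw : cont_at (fun z => psi (S j) (w z)) (RtoC 0)).
      { apply (cont_comp (psi (S j)) w); auto. rewrite w0. apply cont_psi; auto. }
      destruct (Cpw d4 P4) as [d6 [P6 H6]]. rewrite w0 in H6. fold x in H6.
      destruct (Cy d4 P4) as [d7 [P7 H7]]. rewrite y0 in H7.
      destruct (Cw d5 P5) as [d8 [P8 H8]]. rewrite w0 in H8.
      set (r3 := Rmin r2 (Rmin d6 (Rmin d7 d8))).
      assert (n1 := Rmin_l r2 (Rmin d6 (Rmin d7 d8))). assert (n2 := Rmin_r r2 (Rmin d6 (Rmin d7 d8))).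
      assert (n3 := Rmin_l d6 (Rmin d7 d8)). assert (n4 := Rmin_r d6 (Rmin d7 d8)).
      assert (n5 := Rmin_l d7 d8). assert (n6 := Rmin_r d7 d8). fold r3 in n1, n2.
      exists r3, (fun z i => if Nat.eq_dec i (S j) then w z else g z i).
      split; [unfold r3; repeat apply Rmin_pos; auto|]. split.
      + intros i Hi. destruct (Nat.eq_dec i (S j)) as [E|E].
        * subst i. split; auto. apply (holo_sub (ball_at (RtoC 0) r2)); auto.
          intros z Hz. unfold ball_at in *. lra.
        * destruct (Hg1 i ltac:(lia)) as [A B]. split; auto. apply (holo_sub (ball_at (RtoC 0) r)); auto.
          intros z Hz. unfold ball_at in *. lra.
      + intros z Hz. destruct (Hg2 z ltac:(lra)) as [G1 [G2 G3]].
        specialize (H6 z). specialize (H7 z). specialize (H8 z).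
        replace (z - 0)%C with z in H6, H7, H8 by ring.
        specialize (H6 ltac:(lra)). specialize (H7 ltac:(lra)). specialize (H8 ltac:(lra)).
        assert (Hwz : half (w z)) by (apply H5; auto).
        split; [exact G1|split].
        * intros i Hi. destruct (Nat.eq_dec i (S j)); [exact Hwz|apply G2; lia].
        * intros i Hi. destruct (Nat.eq_dec i (S j)) as [E|E]; [lia|].
          destruct (Nat.eq_dec 0 (S j)) as [E'|_]; [lia|].
          destruct (Nat.eq_dec (S i) (S j)) as [E2|E2]; [|apply G3; lia].
          assert (i = j) by lia. subst i.
          assert (Ep : psi (S j) (w z) = y z).
          { apply H4; auto. rewrite gap_f by auto. apply Ew. lra. }
          rewrite Ep. unfold y. ring. }
  destruct (Q (N - 1)%nat ltac:(lia)) as [r [g [Pr [Hg1 Hg2]]]].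
  exists r, g. split; auto. split.
  - intros i Hi. apply Hg1. lia.
  - intros z Hz. destruct (Hg2 z Hz) as [A [B D]]. split; auto. split.
    + intros i Hi. apply B. lia.
    + intros i Hi. apply D. lia.
Qed.

(** Inductively the chain equations give both tuples the same point with index [S (S i)], hence the
    same [gap] at coordinate [S i]; coordinates closer than [1] with equal exponentials coincide. *)
Lemma chain_disc_unique p r g : in_half p -> disc_in (fun q => in_half q /\ chain q) p r g ->
  exists eta, 0 < eta <= r /\ forall q, in_half q -> chain q ->
    (forall i, (i < N)%nat -> Cmod (q i - p i) < eta) ->
    forall i, (i < N)%nat -> q i = g (q O - p O)%C i.
Proof.
  intros Hp [Pr [Hg1 Hg2]]. assert (Pd := diam_pos).
  destruct (finite_radius N (fun i z => (i < N)%nat -> Cmod (g z i - p i) < 1/2)) as [d [P1 H1]].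
  { intros i _. destruct (le_lt_dec N i) as [L|L]; [exists 1; split; [lra|intros; lia]|].
    destruct (Hg1 i L) as [A B].
    assert (Cc := holo_cont _ _ _ B (ball_at_center _ r Pr)). cbv beta in Cc.
    destruct (Cc (1/2)) as [d [P1 H1]]; [lra|]. rewrite A in H1. exists d. split; auto.
    intros z Hz _. apply H1. replace (z - 0)%C with z by ring. auto. }
  set (eta := Rmin (1/2) (Rmin d r)).
  assert (m1 := Rmin_l (1/2) (Rmin d r)). assert (m2 := Rmin_r (1/2) (Rmin d r)).
  assert (m3 := Rmin_l d r). assert (m4 := Rmin_r d r). fold eta in m1, m2.
  exists eta. split; [split; [unfold eta; repeat apply Rmin_pos; lra|lra]|].
  intros q Hq Cq Near i. set (l := (q O - p O)%C).
  assert (Hl : Cmod l < eta) by (apply Near; lia).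
  destruct (Hg2 l ltac:(lra)) as [G0 [Gh Gc]].
  assert (E0 : q O = g l O) by (rewrite G0; unfold l; ring).
  induction i as [|i IH]; intros Hi; [exact E0|].
  specialize (IH ltac:(lia)).
  apply Cexp_small_inj.
  - assert (T := Cmod_triangle3 (q (S i)) (p (S i)) (g l (S i))).
    rewrite (Cmod_sub_comm (p (S i)) (g l (S i))) in T.
    assert (T1 := Near (S i) Hi). assert (T2 := H1 (S i) l ltac:(lia) ltac:(lra) Hi). lra.
  - assert (Eq : gap (q (S i)) = gap (g l (S i))).
    { rewrite <- (gap_f (S i)), <- (gap_f (S i)) by (auto; apply Hq || apply Gh; auto).
      f_equal. assert (T1 := Cq i Hi). assert (T2 := Gc i Hi). simpl in T1, T2.
      rewrite <- IH, <- E0 in T2. rewrite T2 in T1.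
      replace (psi (S i) (q (S i))) with (psi (S i) (q (S i)) - psi 0 (q O) + psi 0 (q O))%C by ring.
      rewrite <- T1. ring. }
    unfold gap in Eq. 
    replace (Cexp (q (S i))) with (RtoC dlt * Cexp (q (S i)) / RtoC dlt)%C by (field; apply RtoC_neq0; lra).
    rewrite Eq. field. apply RtoC_neq0; lra.
Qed.

Lemma closing_holo p r g : disc_in (fun q => in_half q /\ chain q) p r g ->
  holo (ball_at (RtoC 0) r) (fun z => closing (g z)).
Proof.
  intros [Pr [Hg1 Hg2]].
  assert (Hpos : forall n, (n <= N)%nat -> holo (ball_at (RtoC 0) r) (fun z => pos (g z) n)).
  { intros n Hn. destruct n as [|i]; [exact (holo_const _ (RtoC 0))|]. simpl.
    apply (holo_comp _ half (psi i)); [|apply Hg1; lia|apply Hpsi; lia].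
    intros z Hz. apply (proj1 (ball_at_0 _ _)) in Hz. apply (Hg2 z Hz). lia. }
  unfold closing. apply holo_minus; [apply holo_minus; apply Hpos; lia|].
  apply (holo_comp _ (fun _ => True) gap); auto; [apply Hg1; lia|].
  apply holo_mult; [apply holo_const|]. intros z _. eexists; apply dC_Cexp.
Qed.

Lemma tends_unique u a b : tends u a -> tends u b -> a = b.
Proof.
  intros Ha Hb. apply Cmod_small_eq. intros e He.
  destruct (Ha (e/2)) as [n1 H1]; [lra|]. destruct (Hb (e/2)) as [n2 H2]; [lra|].
  specialize (H1 (n1 + n2)%nat ltac:(lia)). specialize (H2 (n1 + n2)%nat ltac:(lia)).
  assert (T := Cmod_triangle3 a (u (n1 + n2)%nat) b). rewrite (Cmod_sub_comm a (u (n1 + n2)%nat)) in T. lra.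
Qed.

Lemma tends_opp u a : tends u a -> tends (fun k => - u k)%C (- a)%C.
Proof. apply (tends_cont (fun z => - z)%C). apply cont_opp, cont_id. Qed.

Lemma pos_tends u t n : (n <= N)%nat -> (forall i, (i < N)%nat -> tends (fun k => u k i) (t i)) -> in_half t ->
  tends (fun k => pos (u k) n) (pos t n).
Proof.
  intros Hn H Ht. destruct n as [|i]; [exact (tends_const (RtoC 0))|]. simpl.
  apply (tends_cont (psi i) (fun k => u k i)); [|apply H; lia]. apply cont_psi; [lia|]. apply Ht. lia.
Qed.

Lemma Sigma_closed u t : (forall k : nat, Sigma (u k)) ->
  (forall i, (i < N)%nat -> tends (fun k => u k i) (t i)) -> in_half t -> Sigma t.
Proof.
  intros Hu H Ht.
  assert (P : forall n, (n <= N)%nat -> tends (fun k => pos (u k) n) (pos t n)).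
  { intros. apply pos_tends; auto. }
  assert (G : forall i, (i < N)%nat -> tends (fun k => gap (u k i)) (gap (t i))).
  { intros i Hi. apply (tends_cont gap (fun k => u k i)); [apply cont_gap|auto]. }
  split; [exact Ht|split].
  - intros i Hi. apply (tends_unique (fun k => gap (u k i))); [apply G; lia|].
    assert (T := tends_plus _ _ _ _ (P (S (S i)) ltac:(lia)) (tends_opp _ _ (P 1%nat ltac:(lia)))).
    intros e He. destruct (T e He) as [n Hn]. exists n. intros k Hk.
    destruct (Hu k) as [_ [Hc _]]. rewrite (Hc i Hi). apply Hn. exact Hk.
  - apply (tends_unique (fun k => closing (u k))).
    + unfold closing. apply (tends_plus (fun k => pos (u k) (nxt N) - pos (u k) 1)%C (fun k => - gap (u k (N - 1)%nat))%C).
      * apply (tends_plus (fun k => pos (u k) (nxt N)) (fun k => - pos (u k) 1)%C); [apply P; auto|].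
        apply tends_opp. apply P. lia.
      * apply tends_opp. apply G. lia.
    + intros e He. exists O. intros k _. destruct (Hu k) as [_ [_ Hcl]]. rewrite Hcl, Cmod_self. auto.
Qed.

Lemma disc_shift p r g z0 : disc_in Sigma p r g -> Cmod z0 < r -> Sigma0 (g z0).
Proof.
  intros [Pr [Hg1 Hg2]] Hz. split; [apply Hg2; auto|].
  exists (r - Cmod z0), (fun z => g (z0 + z)%C).
  assert (Hs : forall z, Cmod z < r - Cmod z0 -> Cmod (z0 + z) < r).
  { intros z Hz'. assert (T := Cmod_triangle z0 z). lra. }
  split; [lra|split].
  - intros i Hi. split; [f_equal; ring|]. destruct (Hg1 i Hi) as [_ B].
    apply (holo_comp _ (ball_at (RtoC 0) r) (fun z => g z i) (fun z => z0 + z)%C); auto.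
    + intros z Hz'. apply (proj1 (ball_at_0 _ _)) in Hz'. apply (proj2 (ball_at_0 _ _)). auto.
    + apply holo_plus; [apply holo_const|apply holo_id].
  - intros z Hz'. destruct (Hg2 _ (Hs z Hz')) as [A B]. split; auto.
    rewrite A. rewrite (proj1 (Hg2 z0 Hz)). ring.
Qed.

(** Some [u k] close to [t] has its own disc in [Sigma], and by uniqueness this disc lies on the
    chain disc through [t]. So [closing] vanishes on an open part of the latter, and then near its
    centre. *)
Lemma Sigma0_closed u t : (forall k : nat, Sigma0 (u k)) ->
  (forall i, (i < N)%nat -> tends (fun k => u k i) (t i)) -> in_half t -> Sigma0 t.
Proof.
  intros Hu H Ht.
  assert (St : Sigma t) by (apply (Sigma_closed u); auto; intros k; apply Hu).
  split; auto. destruct (chain_disc t Ht (proj1 (proj2 St))) as [r [g Hg]].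
  destruct (chain_disc_unique t r g Ht Hg) as [eta [He Uq]].
  assert (Ch := closing_holo t r g Hg). destruct Hg as [Pr [Hg1 Hg2]].
  assert (Nk : exists k, forall i, (i < N)%nat -> Cmod (u k i - t i) < eta / 4).
  { assert (Q : forall n, (n <= N)%nat -> exists K, forall k i, (K <= k)%nat -> (i < n)%nat -> Cmod (u k i - t i) < eta / 4).
    { induction n; intros Hn; [exists O; intros; lia|]. destruct IHn as [K1 H1]; [lia|].
      destruct (H n ltac:(lia) (eta / 4)) as [K2 H2]; [lra|]. exists (K1 + K2)%nat. intros k i Hk Hi.
      destruct (Nat.eq_dec i n) as [E|E]; [subst; apply H2; lia|apply H1; lia]. }
    destruct (Q N (le_n _)) as [K HK]. exists K. intros i Hi. apply HK; auto. }
  destruct Nk as [k Hk]. set (l := (u k O - t O)%C). assert (Hl : Cmod l < eta / 4) by (apply Hk; lia).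
  destruct (Hu k) as [_ [rk [gk [Prk [Hk1 Hk2]]]]].
  destruct (finite_radius N (fun i z => (i < N)%nat -> Cmod (gk z i - t i) < eta)) as [d [P1 H1]].
  { intros i _. destruct (le_lt_dec N i) as [L|L]; [exists 1; split; [lra|intros; lia]|].
    destruct (Hk1 i L) as [A B]. assert (Cc := holo_cont _ _ _ B (ball_at_center _ rk Prk)). cbv beta in Cc.
    destruct (Cc (eta / 2)) as [d [P1 H1]]; [lra|]. rewrite A in H1. exists d. split; auto.
    intros z Hz _. specialize (H1 z). replace (z - 0)%C with z in H1 by ring. specialize (H1 Hz).
    assert (T := Cmod_triangle3 (gk z i) (u k i) (t i)). specialize (Hk i L). lra. }
  (* The identity theorem is applied in a ball centred at [l], where the zeros are known. As
     [Cmod l < r / 4], this ball contains the ball of radius [r / 4] about [0]. *)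
  assert (Z : forall z, ball_at l (r / 2) z -> closing (g z) = RtoC 0).
  { apply (holo_identity (fun z => closing (g z)) l (r / 2) (Rmin d rk)); [lra| |apply Rmin_pos; auto|].
    - apply (holo_sub (ball_at (RtoC 0) r)); auto. intros z Hz. apply (proj2 (ball_at_0 _ _)).
      unfold ball_at in Hz. assert (T := Cmod_triangle (z - l) l). replace (z - l + l)%C with z in T by ring. lra.
    - intros z Hz. assert (m1 := Rmin_l d rk). assert (m2 := Rmin_r d rk).
      destruct (Hk2 (z - l)%C ltac:(lra)) as [A [S1 [S2 S3]]].
      assert (E := Uq (gk (z - l)%C) S1 S2 ltac:(intros i Hi; apply H1; [lia|lra|auto])).
      replace (gk (z - l)%C O - t O)%C with z in E by (rewrite A; unfold l; ring).
      rewrite <- S3. unfold closing. rewrite E by lia.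
      rewrite !(pos_ext (gk (z - l)%C) (g z)) by (auto; lia). reflexivity. }
  exists (r / 4), g. split; [lra|split].
  - intros i Hi. destruct (Hg1 i Hi) as [A B]. split; auto. apply (holo_sub (ball_at (RtoC 0) r)); auto.
    intros z Hz. unfold ball_at in *. lra.
  - intros z Hz. destruct (Hg2 z ltac:(lra)) as [A [B D]]. split; auto. split; [|split]; auto.
    apply Z. unfold ball_at. assert (T := Cmod_sub_le z l). lra.
Qed.

Lemma Cmod_gap t : Cmod (gap t) = dlt * exp (fst t).
Proof.
  unfold gap. rewrite Cmod_mult, Cmod_Cexp, Cmod_R, Rabs_pos_eq; auto. left; apply diam_pos.
Qed.

(* At the boundary some pair [z_(n+1), z_1] realises the diameter, so [z_1] leaves [U]. *)
Lemma Sigma_boundary u t : (forall k : nat, Sigma (u k)) ->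
  (forall i, (i < N)%nat -> tends (fun k => u k i) (t i)) ->
  (forall i, (i < N)%nat -> fst (t i) <= 0) -> (exists i, (i < N)%nat /\ fst (t i) = 0) -> fst (t O) = 0.
Proof.
  intros Hu H Ht [m [Hm Em]]. assert (Pd := diam_pos).
  destruct (Rle_lt_or_eq_dec _ _ (Ht O ltac:(lia))) as [L|E]; auto. exfalso.
  assert (Ux : U (psi 0 (t O))) by (apply (Hpsi 0%nat); [lia|exact L]).
  destruct (diam_gap _ Ux) as [gp [Pg Hgp]].
  assert (T1 := tends_cont (psi 0) _ _ (cont_psi 0 (t O) ltac:(lia) L) (H O ltac:(lia))).
  destruct (T1 (gp / 3)) as [n1 H1]; [lra|].
  assert (T2 := tends_cont gap _ _ (cont_gap (t m)) (H m Hm)).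
  destruct (T2 (gp / 3)) as [n2 H2]; [lra|].
  set (k := (n1 + n2)%nat). specialize (H1 k ltac:(unfold k; lia)). specialize (H2 k ltac:(unfold k; lia)).
  assert (Rl := Sigma_rel (u k) (S m) (Hu k) ltac:(lia)).
  replace (S m - 1)%nat with m in Rl by lia.
  assert (A := pos_adherent (u k) (nxt (S m)) (proj1 (Hu k)) ltac:(apply nxt_le; lia)).
  specialize (Hgp _ A).
  assert (Eg : Cmod (gap (t m)) = dlt) by (rewrite Cmod_gap, Em, exp_0; ring).
  assert (T3 := Cmod_rev_triangle (gap (t m)) (gap (u k m))). rewrite Cmod_sub_comm in T3.
  assert (T4 : Cmod (gap (u k m)) <= Cmod (psi 0 (t O) - pos (u k) (nxt (S m))) + Cmod (psi 0 (u k O) - psi 0 (t O))).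
  { rewrite Rl. simpl pos at 2.
    rewrite (Cmod_sub_comm (psi 0 (t O))), (Cmod_sub_comm (psi 0 (u k O))). apply Cmod_triangle3. }
  lra.
Qed.

(** Every point of a disc in [Sigma] is the centre of a smaller one, so the disc already lies in
    [Sigma0]. *)
Lemma Sigma0_tends_disc p : Sigma0 p -> exists r g, disc_in Sigma0 p r g.
Proof.
  intros [_ [r [g Hg]]]. exists r, g. assert (Hg' := Hg). destruct Hg' as [Pr [Hg1 Hg2]].
  split; [auto|split; [auto|]]. intros z Hz. split; [apply Hg2; auto|]. apply (disc_shift p r); auto.
Qed.

(** [F] is an inverse Blaschke factor: [- Cconj t] is the mirror image of [t], so the modulus is [1]
    on the imaginary axis and above [1] to its left, with a pole at [t]. If the first coordinate
    kept away from [t], [F] would be bounded and hence at most [1] in modulus. *)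
Lemma Sigma0_dense p0 : Sigma0 p0 -> forall t rho, half t -> 0 < rho ->
  exists p, Sigma0 p /\ Cmod (p O - t) < rho.
Proof.
  intros Sp0 t rho Ht Prho. apply NNPP. intros No.
  assert (Far : forall p, Sigma0 p -> rho <= Cmod (p O - t)).
  { intros p Sp. apply Rnot_lt_le. intros L. apply No. exists p. auto. }
  assert (Nz : forall p, Sigma0 p -> (p O - t)%C <> RtoC 0).
  { intros p Sp. apply Cmod_gt_0. specialize (Far p Sp). lra. }
  set (t' := Cconj t). assert (Et : fst t' = fst t /\ snd t' = - snd t) by (split; reflexivity).
  set (F := fun p : nat -> C => ((p O + t') / (p O - t))%C).
  assert (CF : forall p, Sigma0 p -> cont_at (fun z => (z + t') / (z - t))%C (p O)).
  { intros p Sp. apply (cont_div (fun z => z + t')%C (fun z => z - t)%C); [apply Nz; auto| |].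
    - apply cont_plus; [apply cont_id|apply cont_const].
    - apply cont_minus; [apply cont_id|apply cont_const]. }
  assert (MP : Cmod (F p0) <= 1).
  { apply (product_max_principle N Sigma0 F (1 + Cmod (t' + t) / rho)); auto.
    - intros p Sp i Hi. apply Sp; auto.
    - intros p Sp. destruct (Sigma0_tends_disc p Sp) as [r [g [Pr [Hg1 Hg2]]]].
      exists r, g. split; auto. split; [|split; [|split]].
      + intros z Hz. destruct (Hg2 z Hz); auto.
      + intros i Hi. destruct (Hg1 i Hi); auto.
      + unfold F. apply holo_div.
        * intros z Hz. apply (proj1 (ball_at_0 _ _)) in Hz. apply Nz. apply Hg2; auto.
        * apply holo_plus; [apply Hg1; lia|apply holo_const].
        * apply holo_minus; [apply Hg1; lia|apply holo_const].
      + unfold F. rewrite (proj1 (Hg1 O ltac:(lia))). reflexivity.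
    - intros p Sp. unfold F. specialize (Far p Sp).
      replace ((p O + t') / (p O - t))%C with (RtoC 1 + (t' + t) / (p O - t))%C by (field; apply Nz; auto).
      eapply Rle_trans; [apply Cmod_triangle|]. rewrite Cmod_1, Cmod_div by (apply Nz; auto).
      apply Rplus_le_compat_l. unfold Rdiv. apply Rmult_le_compat_l; [apply Cmod_ge_0|].
      apply Rinv_le_contravar; lra.
    - intros u s Hu Hs Hneg. assert (Ss : Sigma0 s) by (apply (Sigma0_closed u); auto).
      split; auto. unfold F. apply (tends_cont (fun z => (z + t') / (z - t))%C (fun k => u k O)); [|apply Hs; lia].
      apply CF; auto.
    - intros u s Hu Hs Hle Hex e He.
      assert (E0 : fst (s O) = 0) by (apply (Sigma_boundary u); auto; intros k; apply Hu).
      assert (Ns : (s O - t)%C <> RtoC 0).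
      { intros E. assert (T := f_equal fst E). simpl in T. unfold half in Ht. lra. }
      assert (Cs : cont_at (fun z => (z + t') / (z - t))%C (s O)).
      { apply (cont_div (fun z => z + t')%C (fun z => z - t)%C); auto.
        - apply cont_plus; [apply cont_id|apply cont_const].
        - apply cont_minus; [apply cont_id|apply cont_const]. }
      destruct (tends_cont _ _ _ Cs (Hs O ltac:(lia)) e He) as [n Hn]. exists n. intros k Hk.
      specialize (Hn k Hk).
      assert (T := Cmod_rev_triangle (F (u k)) ((s O + t') / (s O - t))). unfold F in *.
      assert (M1 : Cmod ((s O + t') / (s O - t)) = 1).
      { rewrite Cmod_div by auto. replace (Cmod (s O + t')) with (Cmod (s O - t)).
        - field. apply Rgt_not_eq, Cmod_gt_0; auto.
        - unfold Cmod. f_equal. simpl. destruct Et as [E1 E2]. simpl in E1, E2. rewrite E0. ring. }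
      lra. }
  assert (P0 := Far p0 Sp0).
  unfold F in MP. rewrite Cmod_div in MP by (apply Nz; auto).
  assert (LE : Cmod (p0 O + t') <= Cmod (p0 O - t)).
  { apply Rmult_le_reg_r with (/ Cmod (p0 O - t)); [apply Rinv_0_lt_compat; lra|].
    rewrite Rinv_r by lra. exact MP. }
  assert (Hp : fst (p0 O) < 0) by (apply Sp0; lia).
  assert (Q1 := dot_self (p0 O + t')). assert (Q2 := dot_self (p0 O - t)).
  unfold dot in Q1, Q2. simpl in Q1, Q2. unfold half in Ht.
  assert (Cmod (p0 O + t') * Cmod (p0 O + t') <= Cmod (p0 O - t) * Cmod (p0 O - t)).
  { assert (Xp := Cmod_ge_0 (p0 O + t')). nra. }
  nra.
Qed.

Lemma parallelogram (d u : C) :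
  Cmod (d + u) * Cmod (d + u) + Cmod (u - d) * Cmod (u - d) = 2 * (Cmod d * Cmod d) + 2 * (Cmod u * Cmod u).
Proof. rewrite <- !dot_self. unfold dot. simpl. ring. Qed.

Lemma gap_shift_pi t : gap (t + (0, PI)) = (- gap t)%C.
Proof.
  unfold gap. rewrite Cexp_add, Cexp_PI. replace (RtoC (-1)) with (- RtoC 1)%C by (rewrite <- RtoC_opp; reflexivity). ring.
Qed.

(* The pairs [(z_2, z_1)(p)] and [(z_1, z_2)(q)] have the same difference [u]; when [|u|] is
   the diameter the parallelogram law forces them to coincide. *)
Lemma opposite_pair p q : Sigma0 p -> Sigma0 q -> q O = (p O + (0, PI))%C ->
  psi 0 (q O) = (psi 0 (p O) + gap (p O))%C.
Proof.
  intros Sp Sq Epq. assert (Pd := diam_pos). assert (HN0 : (0 < N)%nat) by lia.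
  (* The two tuples are stored in one tuple of length [N + N], to which the maximum principle
     applies; fixing the offset of the two first coordinates leaves one common disc parameter. *)
  set (snd_half := fun P : nat -> C => fun i => P (N + i)%nat).
  set (S2 := fun P : nat -> C => Sigma0 P /\ Sigma0 (snd_half P) /\ P N = (P O + (0, PI))%C).
  set (d := fun P : nat -> C => (psi 0 (P O) - psi 0 (P N) + gap (P O))%C).
  assert (Sneg : forall P, S2 P -> forall i, (i < N + N)%nat -> half (P i)).
  { intros P [A [B _]] i Hi. destruct (le_lt_dec N i) as [L|L].
    - assert (T := proj1 (proj1 B) (i - N)%nat ltac:(lia)). unfold snd_half in T.
      replace (N + (i - N))%nat with i in T by lia. exact T.
    - apply A; auto. }
  assert (Key : forall P, S2 P -> Cmod (d P) * Cmod (d P) <= dlt * dlt - Cmod (gap (P O)) * Cmod (gap (P O))).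
  { intros P HP. assert (HP' := HP). destruct HP' as [A [B E]].
    assert (N1 := nxt_le 1 ltac:(lia)).
    assert (RA := Sigma_rel P 1 (proj1 A) ltac:(lia)). assert (RB := Sigma_rel (snd_half P) 1 (proj1 B) ltac:(lia)).
    simpl Nat.sub in RA, RB. unfold snd_half in RB at 1. rewrite Nat.add_0_r, E, gap_shift_pi in RB.
    fold (snd_half P) in RB.
    assert (Ea : pos P 1 = psi 0 (P O)) by reflexivity.
    assert (Eb : pos (snd_half P) 1 = psi 0 (P N)) by (simpl; unfold snd_half; rewrite Nat.add_0_r; reflexivity).
    set (u := gap (P O)) in *.
    assert (D1 : (d P + u)%C = (pos P (nxt 1) - pos (snd_half P) (nxt 1))%C).
    { unfold d. fold u. rewrite <- Ea, <- Eb.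
      replace (pos P (nxt 1)) with (pos P (nxt 1) - pos P 1 + pos P 1)%C by ring.
      replace (pos (snd_half P) (nxt 1)) with (pos (snd_half P) (nxt 1) - pos (snd_half P) 1 + pos (snd_half P) 1)%C by ring.
      rewrite <- RA, <- RB. ring. }
    assert (D2 : (u - d P)%C = (psi 0 (P N) - psi 0 (P O))%C) by (unfold d; fold u; ring).
    assert (L1 : Cmod (d P + u) <= dlt).
    { rewrite D1. apply diam_adherent; apply pos_adherent; auto; [apply A|apply B]. }
    assert (L2 : Cmod (u - d P) <= dlt).
    { rewrite D2. apply diam_le; apply (Hpsi 0%nat HN0).
      - apply Sneg; auto. lia.
      - apply Sneg; auto. lia. }
    assert (PL := parallelogram (d P) u).
    assert (X1 := Cmod_ge_0 (d P + u)). assert (X2 := Cmod_ge_0 (u - d P)).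
    assert (Cmod (d P + u) * Cmod (d P + u) <= dlt * dlt) by (apply Rmult_le_compat; auto).
    assert (Cmod (u - d P) * Cmod (u - d P) <= dlt * dlt) by (apply Rmult_le_compat; auto). lra. }
  assert (Cd : forall t s, half t -> half s -> forall u v, tends u t -> tends v s ->
    tends (fun k : nat => psi 0 (u k) - psi 0 (v k) + gap (u k))%C (psi 0 t - psi 0 s + gap t)%C).
  { intros t s Ht Hs u v Hu Hv. apply (tends_plus (fun k => psi 0 (u k) - psi 0 (v k))%C (fun k => gap (u k))).
    - apply (tends_plus (fun k => psi 0 (u k)) (fun k => - psi 0 (v k))%C).
      + apply (tends_cont (psi 0) u); auto. apply cont_psi; auto.
      + apply tends_opp. apply (tends_cont (psi 0) v); auto. apply cont_psi; auto.
    - apply (tends_cont gap u); auto. apply cont_gap. }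
  set (P0 := fun i => if le_lt_dec N i then q (i - N)%nat else p i).
  assert (SP0 : S2 P0).
  { assert (E1 : forall i, (i < N)%nat -> P0 i = p i).
    { intros i Hi. unfold P0. destruct (le_lt_dec N i); [lia|reflexivity]. }
    assert (E2 : forall i, snd_half P0 i = q i).
    { intros i. unfold snd_half, P0. destruct (le_lt_dec N (N + i)); [|lia]. f_equal. lia. }
    assert (Ext : forall a b, (forall i, (i < N)%nat -> a i = b i) -> Sigma0 b -> Sigma0 a).
    { intros a b Hab [Sb [r [g [Pr [Hg1 Hg2]]]]]. split; [apply (Sigma_ext b); auto; intros; symmetry; auto|].
      exists r, g. split; [auto|split].
      - intros i Hi. rewrite Hab by auto. apply Hg1; auto.
      - intros z Hz. rewrite Hab by lia. apply Hg2; auto. }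
    split; [|split].
    - apply (Ext P0 p); auto.
    - apply (Ext (snd_half P0) q); auto.
    - rewrite (E1 O) by lia. replace (P0 N) with (snd_half P0 O) by (unfold snd_half; f_equal; lia).
      rewrite E2. exact Epq. }
  (* [d] tends to zero at the boundary, so each multiple of it satisfies the boundary hypothesis;
     letting [K] grow gives [d P0 = 0]. *)
  assert (MP : forall K, 0 < K -> Cmod (RtoC K * d P0) <= 1).
  { intros K PK. apply (product_max_principle (N + N) S2 (fun P => RtoC K * d P)%C (K * dlt)); auto; [lia| | | |].
    - intros P SP. assert (SP' := SP). destruct SP' as [A [B E]].
      destruct (Sigma0_tends_disc P A) as [r1 [g1 [Pr1 [G1 G2]]]].
      destruct (Sigma0_tends_disc _ B) as [r2 [g2 [Pr2 [K1 K2]]]].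
      assert (m1 := Rmin_l r1 r2). assert (m2 := Rmin_r r1 r2).
      set (g := fun z i => if le_lt_dec N i then g2 z (i - N)%nat else g1 z i).
      assert (g_lo : forall z i, (i < N)%nat -> g z i = g1 z i).
      { intros z i Hi. unfold g. destruct (le_lt_dec N i); [lia|reflexivity]. }
      assert (g_hi : forall z i, g z (N + i)%nat = g2 z i).
      { intros z i. unfold g. destruct (le_lt_dec N (N + i)); [|lia]. f_equal. lia. }
      assert (gN : forall z, g z N = g2 z O) by (intros; rewrite <- g_hi; f_equal; lia).
      assert (Bsub1 : forall z, ball_at (RtoC 0) (Rmin r1 r2) z -> ball_at (RtoC 0) r1 z) by (intros z Hz; unfold ball_at in *; lra).
      assert (Bsub2 : forall z, ball_at (RtoC 0) (Rmin r1 r2) z -> ball_at (RtoC 0) r2 z) by (intros z Hz; unfold ball_at in *; lra).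
      assert (Hgh : forall i, (i < N + N)%nat -> holo (ball_at (RtoC 0) (Rmin r1 r2)) (fun z => g z i)).
      { intros i Hi. unfold g. destruct (le_lt_dec N i) as [L|L].
        - apply (holo_sub (ball_at (RtoC 0) r2)); auto. apply K1. lia.
        - apply (holo_sub (ball_at (RtoC 0) r1)); auto. apply G1. lia. }
      assert (Ext : forall a b, (forall i, (i < N)%nat -> a i = b i) -> Sigma0 b -> Sigma0 a).
      { intros a b Hab [Sb [r [h [Pr [Hh1 Hh2]]]]]. split; [apply (Sigma_ext b); auto; intros; symmetry; auto|].
        exists r, h. split; [auto|split].
        - intros i Hi. rewrite Hab by auto. apply Hh1; auto.
        - intros z Hz. rewrite Hab by lia. apply Hh2; auto. }
      assert (Sg : forall z, Cmod z < Rmin r1 r2 -> S2 (g z)).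
      { intros z Hz. split; [|split].
        - apply (Ext _ (g1 z)); [intros; apply g_lo; auto|]. apply G2. lra.
        - apply (Ext _ (g2 z)); [intros; apply g_hi|]. apply K2. lra.
        - rewrite gN, g_lo by lia. rewrite (proj1 (G2 z ltac:(lra))), (proj1 (K2 z ltac:(lra))).
          unfold snd_half. rewrite Nat.add_0_r, E. ring. }
      assert (g0 : forall i, (i < N + N)%nat -> g (RtoC 0) i = P i).
      { intros i Hi. unfold g. destruct (le_lt_dec N i) as [L|L].
        - rewrite (proj1 (K1 (i - N)%nat ltac:(lia))). unfold snd_half. f_equal. lia.
        - apply G1. auto. }
      exists (Rmin r1 r2), g. split; [apply Rmin_pos; auto|]. split; [|split; [|split]].
      + intros z Hz. split; auto. rewrite g_lo by lia. apply G2. lra.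
      + intros i Hi. auto.
      + apply holo_mult; [apply holo_const|]. unfold d.
        assert (Hb : forall i, (i < N + N)%nat -> forall z, ball_at (RtoC 0) (Rmin r1 r2) z -> half (g z i)).
        { intros i Hi z Hz. apply (proj1 (ball_at_0 _ _)) in Hz. apply Sneg; auto. }
        apply holo_plus; [apply holo_minus|].
        * apply (holo_comp _ half (psi 0)); [apply Hb; lia|apply Hgh; lia|apply Hpsi; auto].
        * apply (holo_comp _ half (psi 0)); [apply Hb; lia|apply Hgh; lia|apply Hpsi; auto].
        * apply (holo_comp _ (fun _ => True) gap); auto; [apply Hgh; lia|].
          apply holo_mult; [apply holo_const|]. intros z _. eexists; apply dC_Cexp.
      + unfold d. rewrite !g0 by lia. reflexivity.
    - intros P SP. rewrite Cmod_mult, Cmod_R, Rabs_pos_eq by lra. apply Rmult_le_compat_l; [lra|].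
      assert (T := Key P SP). assert (X1 := Cmod_ge_0 (d P)). assert (X2 := Cmod_ge_0 (gap (P O))). nra.
    - intros u t Hu Ht Hneg.
      assert (St : S2 t).
      { split; [|split].
        - apply (Sigma0_closed u); [intros k; apply Hu|intros; apply Ht; lia|intros i Hi; apply Hneg; lia].
        - apply (Sigma0_closed (fun k => snd_half (u k))); [intros k; apply Hu|intros; apply Ht; lia|].
          intros i Hi. apply Hneg. lia.
        - apply (tends_unique (fun k => u k N)); [apply Ht; lia|].
          intros e He. destruct (Ht O ltac:(lia) e He) as [n Hn]. exists n. intros k Hk.
          destruct (Hu k) as [_ [_ Ek]]. rewrite Ek.
          replace (u k O + (0, PI) - (t O + (0, PI)))%C with (u k O - t O)%C by ring. apply Hn; auto. }
      split; auto. apply (tends_mult (fun _ => RtoC K) (fun k => d (u k))); [apply tends_const|].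
      unfold d. apply (Cd (t O) (t N)); [apply Hneg; lia|apply Hneg; lia|apply Ht; lia|apply Ht; lia].
    - intros u t Hu Ht Hle [m [Hm Em]] e He.
      assert (EN : t N = (t O + (0, PI))%C).
      { apply (tends_unique (fun k => u k N)); [apply Ht; lia|].
        intros e' He'. destruct (Ht O ltac:(lia) e' He') as [n Hn]. exists n. intros k Hk.
        destruct (Hu k) as [_ [_ Ek]]. rewrite Ek.
        replace (u k O + (0, PI) - (t O + (0, PI)))%C with (u k O - t O)%C by ring. apply Hn; auto. }
      assert (E0 : fst (t O) = 0).
      { destruct (le_lt_dec N m) as [L|L].
        - assert (T : fst (snd_half t O) = 0).
          { apply (Sigma_boundary (fun k => snd_half (u k)) (snd_half t)).
            - intros k. apply Hu.
            - intros i Hi. apply Ht. lia.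
            - intros i Hi. apply Hle. lia.
            - exists (m - N)%nat. split; [lia|]. unfold snd_half. replace (N + (m - N))%nat with m by lia. auto. }
          unfold snd_half in T. rewrite Nat.add_0_r, EN in T. simpl in T. lra.
        - apply (Sigma_boundary u); [intros k; apply Hu|intros; apply Ht; lia|intros; apply Hle; lia|].
          exists m. auto. }
      (* A bound [a] on the square of [d] gives [(K * D) ^ 2 <= e], which is below [(1 + e) ^ 2]. *)
      set (a := e / (K * K) ). assert (Pa : 0 < a) by (apply Rdiv_lt_0_compat; nra).
      assert (Tg := tends_cont gap _ _ (cont_gap (t O)) (Ht O ltac:(lia))).
      destruct (Tg (a / (2 * dlt))) as [n Hn]; [apply Rdiv_lt_0_compat; lra|]. exists n. intros k Hk. specialize (Hn k Hk).
      assert (Eg : Cmod (gap (t O)) = dlt) by (rewrite Cmod_gap, E0, exp_0; ring).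
      assert (T3 := Cmod_rev_triangle (gap (t O)) (gap (u k O))). rewrite Cmod_sub_comm in T3.
      assert (T := Key (u k) (Hu k)). set (D := Cmod (d (u k))) in *. set (G := Cmod (gap (u k O))) in *.
      assert (PD : 0 <= D) by apply Cmod_ge_0. assert (PG : 0 <= G) by apply Cmod_ge_0.
      assert (GL : G <= dlt) by nra.
      assert (DD : D * D <= a).
      { assert (dlt - G < a / (2 * dlt)) by lra.
        assert ((dlt - G) * (dlt + G) <= a / (2 * dlt) * (2 * dlt)) by (apply Rmult_le_compat; lra).
        replace (a / (2 * dlt) * (2 * dlt)) with a in H0 by (field; lra). nra. }
      rewrite Cmod_mult, Cmod_R, Rabs_pos_eq by lra. fold D.
      assert ((K * D) * (K * D) <= e).
      { replace (K * D * (K * D)) with (K * K * (D * D)) by ring.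
        apply Rle_trans with (K * K * a); [apply Rmult_le_compat_l; nra|]. unfold a. right. field. lra. }
      assert (0 <= K * D) by nra. nra. }
  assert (D0 : d P0 = RtoC 0).
  { apply Cmod_small_eq. intros e He. replace (d P0 - 0)%C with (d P0) by ring.
    specialize (MP (/ e) ltac:(apply Rinv_0_lt_compat; auto)).
    rewrite Cmod_mult, Cmod_R, Rabs_pos_eq in MP by (left; apply Rinv_0_lt_compat; auto).
    apply Rmult_le_reg_l with (/ e); [apply Rinv_0_lt_compat; auto|]. rewrite Rinv_l by lra. exact MP. }
  unfold d, P0 in D0. destruct (le_lt_dec N 0) as [L|L]; [lia|]. destruct (le_lt_dec N N) as [L2|L2]; [|lia].
  rewrite Nat.sub_diag in D0.
  replace (psi 0 (p O) + gap (p O))%C with (psi 0 (p O) - psi 0 (q O) + gap (p O) + psi 0 (q O))%C by ring.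
  rewrite D0. ring.
Qed.

Lemma Sigma0_empty p0 : ~ Sigma0 p0.
Proof.
  intros Sp0. assert (Pd := diam_pos).
  (* After a further shift by at most [1/8] the real part is still at least [-1/2], where [2 * exp]
     exceeds [1]. *)
  destruct (Sigma0_dense p0 Sp0 (-1/4, 0) (1/8)) as [p [Sp Hp]]; [unfold half; simpl; lra|lra|].
  destruct (Sigma0_tends_disc p Sp) as [r [g [Pr [G1 G2]]]].
  assert (m1 := Rmin_l r (1/8)). assert (m2 := Rmin_r r (1/8)).
  assert (Hp1 : half (p O)) by (apply Sp; lia).
  destruct (Sigma0_dense p0 Sp0 (p O + (0, PI))%C (Rmin r (1/8))) as [q [Sq Hq]].
  { unfold half in *. simpl. lra. }
  { apply Rmin_pos; lra. }
  set (z := (q O - (p O + (0, PI)))%C) in *.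
  (* Density yields [q] only near the opposite of [p]; sliding [p] along its disc makes the offset
     exactly [i PI]. *)
  destruct (G2 z ltac:(lra)) as [Ez Sz]. set (p' := g z) in *.
  assert (E : q O = (p' O + (0, PI))%C) by (rewrite Ez; unfold z; ring).
  assert (Op := opposite_pair p' q Sz Sq E).
  assert (Hq1 : half (q O)) by (apply Sq; lia). assert (Hp1' : half (p' O)) by (apply Sz; lia).
  assert (Fq : f (psi 0 (q O)) = (- gap (p' O))%C).
  { rewrite gap_f by (auto; lia). rewrite E, gap_shift_pi. reflexivity. }
  assert (Rel1 := Sigma_rel p' 1 (proj1 Sz) ltac:(lia)). simpl Nat.sub in Rel1.
  assert (Eb : psi 0 (q O) = pos p' (nxt 1)).
  { rewrite Op, Rel1. simpl pos at 2. simpl pos at 1. ring. }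
  assert (Uq : minus0 U (psi 0 (q O))) by (apply (Hpsi 0%nat); [lia|auto]).
  destruct (Nat.eq_dec N 1) as [N1|N1].
  - assert (Z : nxt 1 = O).
    { assert (T := nxt_neq1 1 ltac:(lia)). assert (T' := nxt_le 1 ltac:(lia)). lia. }
    rewrite Z in Eb. simpl in Eb. apply (proj2 Uq). exact Eb.
  - rewrite nxt_S in Eb by lia. simpl in Eb.
    assert (Rel2 := Sigma_rel p' 2 (proj1 Sz) ltac:(lia)). simpl Nat.sub in Rel2.
    rewrite <- (gap_f 1) in Rel2 by (try lia; apply Sz; lia).
    rewrite <- Eb, Fq in Rel2.
    assert (A1 := pos_adherent p' (nxt 2) (proj1 (proj1 Sz)) ltac:(apply nxt_le; lia)).
    assert (D := diam_adherent _ _ A1 (adherent_self _ (proj1 Uq))).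
    (* With [u = gap (p' 0)], the point shared by both tuples is [z_1 + u], and its image [- u]
       under [f] puts the next marked point at [z_1 - u]. *)
    assert (E2 : (pos p' (nxt 2) - psi 0 (q O))%C = (RtoC (-2) * gap (p' O))%C).
    { rewrite Op. replace (pos p' (nxt 2)) with (pos p' (nxt 2) - pos p' 1 + pos p' 1)%C by ring.
      rewrite <- Rel2. simpl pos.
      replace (RtoC (-2)) with (- RtoC 1 - RtoC 1)%C by (unfold RtoC, Cminus, Cplus, Copp; simpl; f_equal; ring). ring. }
    rewrite E2, Cmod_mult, Cmod_R, Cmod_gap, Rabs_left in D by lra.
    assert (X1 := re_le_Cmod (p O - (-1/4, 0))). simpl in X1.
    assert (X2 := re_le_Cmod z).
    assert (Ef : fst (p' O) = fst (p O) + fst z) by (rewrite Ez; reflexivity).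
    assert (Y1 := Rle_abs (- (fst (p O) + - (-1/4)))). rewrite Rabs_Ropp in Y1.
    assert (Y2 := Rle_abs (- fst z)). rewrite Rabs_Ropp in Y2. unfold Re in X2.
    assert (L : -1/2 <= fst (p' O)) by lra.
    assert (EX := exp_ineq1_le (fst (p' O))).
    assert (1/2 < exp (fst (p' O))).
    { destruct (Req_dec (fst (p' O)) 0) as [Z|Z]; [rewrite Z, exp_0; lra|]. assert (T := exp_ineq1 _ Z). lra. }
    nra.
Qed.

(** Along the chain disc through the base tuple, [pos (g z) n] is the orbit [orb n w] of
    [w = psi 0 (g z 0)], and [closing (g z)] is [relation w] up to sign. *)
Lemma flat_Sigma0 rho : 0 < rho -> (forall w, ball_at (X 1%nat) rho w -> relation w = RtoC 0) -> Sigma0 t0.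
Proof.
  intros Pr Hflat.
  assert (Hh : in_half t0) by (intros i Hi; apply Hpsi; auto).
  assert (Ep : forall n, (n <= N)%nat -> pos t0 n = X n).
  { intros n Hn. destruct n as [|i]; [symmetry; exact X0|]. simpl. apply Hpsi. lia. }
  assert (Hr : forall i, (i < N)%nat -> gap (t0 i) = (pos t0 (nxt (S i)) - pos t0 1)%C).
  { intros i Hi. rewrite !Ep by (try apply nxt_le; lia). rewrite <- HfX by lia.
    rewrite <- (proj1 (proj2 (Hpsi i Hi))). symmetry. apply gap_f; auto. }
  assert (Hc : chain t0).
  { intros i Hi. rewrite Hr by lia. rewrite nxt_S by lia. reflexivity. }
  destruct (chain_disc t0 Hh Hc) as [r [g Hg]]. destruct Hg as [Prr [G1 G2]].
  assert (Cp : cont_at (fun z => psi 0 (g z O)) (RtoC 0)).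
  { apply (cont_comp (psi 0) (fun z => g z O)).
    - eapply holo_cont; [apply G1; lia|]. apply ball_at_center; auto.
    - rewrite (proj1 (G1 O ltac:(lia))). apply cont_psi; [lia|]. apply Hh; lia. }
  destruct (Cp rho Pr) as [d [Pd Hd]]. rewrite (proj1 (G1 O ltac:(lia))) in Hd.
  rewrite (proj1 (proj2 (Hpsi 0%nat ltac:(lia)))) in Hd.
  assert (m1 := Rmin_l r d). assert (m2 := Rmin_r r d).
  split.
  - split; [exact Hh|split; [exact Hc|]]. unfold closing. rewrite Hr by lia.
    replace (S (N - 1)) with N by lia. ring.
  - exists (Rmin r d), g. split; [apply Rmin_pos; auto|split].
    + intros i Hi. destruct (G1 i Hi) as [A B]. split; auto. apply (holo_sub (ball_at (RtoC 0) r)); auto.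
      intros z Hz. unfold ball_at in *. lra.
    + intros z Hz. destruct (G2 z ltac:(lra)) as [A [B D]]. split; auto. split; [auto|split; auto].
      set (w := psi 0 (g z O)).
      assert (Hw : ball_at (X 1%nat) rho w) by (apply Hd; replace (z - 0)%C with z by ring; lra).
      assert (Or : forall n, (1 <= n <= N)%nat -> pos (g z) n = orb n w).
      { induction n as [|n IH]; intros Hn; [lia|]. destruct (Nat.eq_dec n 0) as [E|E]; [subst; reflexivity|].
        rewrite orb_SS, <- IH by lia. destruct n as [|i]; [lia|].
        replace (pos (g z) (S i)) with (psi i (g z i)) by reflexivity.
        rewrite gap_f by (try lia; apply B; lia). rewrite (D i) by lia. simpl. fold w. ring. }
      specialize (Hflat w Hw). unfold relation in Hflat. rewrite orb_SS, <- (Or N) in Hflat by lia.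
      assert (On : pos (g z) (nxt N) = orb (nxt N) w).
      { destruct (idx_nxt N ltac:(lia)) as [I|[I _]]; [apply Or; auto|rewrite I; reflexivity]. }
      unfold closing. rewrite On. simpl pos. fold w.
      replace (gap (g z (N - 1)%nat)) with (f (pos (g z) N)).
      * replace (orb (nxt N) w) with (f (pos (g z) N) + w - (f (pos (g z) N) + w - orb (nxt N) w))%C by ring.
        rewrite Hflat. ring.
      * replace (pos (g z) N) with (pos (g z) (S (N - 1))) by (f_equal; lia). simpl.
        apply gap_f; [lia|]. apply B; lia.
Qed.
End LogCoordinates.

Lemma relation_transversal : dorb 1 (S N) <> dorb 1 (nxt N).
Proof.
  destruct transversal_or_flat as [T|[rho [Pr Hflat]]]; auto. exfalso.
  destruct half_lifts_exist as [psi [t0 Hpsi]].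
  exact (Sigma0_empty psi t0 Hpsi t0 (flat_Sigma0 psi t0 Hpsi rho Pr Hflat)).
Qed.

(** * Positivity *)

Fixpoint rprod (d : nat -> R) (n : nat) : R :=
  match n with O => 1 | S m => rprod d m * d (S m) end.

(** With [d] the real multipliers, unfolding the recursion shows that [x ^ n * dorb (1 / x) (S n)]
    is [rprod d n * rsum d x (S n)]; the form on the right makes sense at [x = 0] too. *)
Fixpoint rsum (d : nat -> R) (x : R) (n : nat) : R :=
  match n with O => 0 | S m => rsum d x m + x ^ m / rprod d m end.

Definition rrel (d : nat -> R) (x : R) : R :=
  rsum d x (S N) - match nxt N with
                   | O => 0
                   | S j => x ^ (N - j) * (rprod d j / rprod d N) * rsum d x (S j)
                   end.

Lemma rsum_continuity d n : continuity (fun x => rsum d x n).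
Proof.
  induction n; simpl.
  - apply continuity_const. intros x y. reflexivity.
  - apply (continuity_plus (fun x => rsum d x n) (fun x => x ^ n / rprod d n)); auto.
    unfold Rdiv. apply (continuity_mult (fun x => x ^ n) (fun _ => / rprod d n)).
    + apply derivable_continuous, derivable_pow.
    + apply continuity_const. intros x y. reflexivity.
Qed.

Lemma rrel_continuity d : continuity (rrel d).
Proof.
  unfold rrel. apply (continuity_minus (fun x => rsum d x (S N))); [apply rsum_continuity|].
  destruct (nxt N) as [|j]; [apply continuity_const; intros x y; reflexivity|].
  apply (continuity_mult (fun x => x ^ (N - j) * (rprod d j / rprod d N)) (fun x => rsum d x (S j)));
    [|apply rsum_continuity].
  apply (continuity_mult (fun x => x ^ (N - j)) (fun _ => rprod d j / rprod d N)).
  - apply derivable_continuous, derivable_pow.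
  - apply continuity_const. intros x y. reflexivity.
Qed.

Lemma rsum_at_0 d n : rsum d 0 (S n) = 1.
Proof.
  induction n; simpl; [field|]. simpl in IHn. rewrite IHn. unfold Rdiv. ring.
Qed.

Lemma dorb_rsum d x n : (forall n, (1 <= n <= N)%nat -> df n = RtoC (d n)) ->
  (forall n, (n <= N)%nat -> rprod d n <> 0) -> x <> 0 -> (n <= N)%nat ->
  (RtoC (x ^ n) * dorb (/ x) (S n))%C = RtoC (rprod d n * rsum d x (S n)).
Proof.
  intros Hd Np Nx. induction n as [|n IH]; intros Hn.
  - simpl. rewrite <- RtoC_mult. f_equal. field.
  - rewrite dorb_SS by lia. rewrite Hd by lia.
    replace (RtoC (x ^ S n) * (RtoC (/ x) * RtoC (d (S n)) * dorb (/ x) (S n) + RtoC 1))%C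
      with (RtoC (x ^ S n * / x * d (S n)) * dorb (/ x) (S n) + RtoC (x ^ S n))%C
      by (rewrite !RtoC_mult; ring).
    replace (x ^ S n * / x * d (S n)) with (d (S n) * x ^ n) by (simpl; field; auto).
    rewrite RtoC_mult, <- Cmult_assoc, IH, <- RtoC_mult, <- RtoC_plus by lia.
    f_equal. assert (P := Np (S n) Hn). simpl in P |- *.
    assert (rprod d n <> 0 /\ d (S n) <> 0) as [P1 P2].
    { split; intros E; apply P; rewrite E; ring. }
    field. auto.
Qed.

(* [rrel d x] is, up to a nonzero factor, the relation at multiplier scale [s = 1/x]; it is [1] at
   [x = 0] and has no zero on (0, 1], so it is positive at [x = 1]. *)
Lemma relation_positive d : (forall n, (1 <= n <= N)%nat -> df n = RtoC (d n)) ->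
  exists t, 0 < t /\ (dorb 1 (S N) - dorb 1 (nxt N))%C = RtoC (rprod d N * t) /\ rprod d N <> 0.
Proof.
  intros Hd.
  assert (Np : forall n, (n <= N)%nat -> rprod d n <> 0).
  { induction n as [|n IH]; intros Hn; simpl; [lra|]. apply Rmult_integral_contrapositive_currified.
    - apply IH. lia.
    - intros E. apply (df_neq0 (S n)); [lia|]. rewrite Hd, E by lia. reflexivity. }
  assert (Key : forall x, x <> 0 ->
    (RtoC (x ^ N) * (dorb (/ x) (S N) - dorb (/ x) (nxt N)))%C = RtoC (rprod d N * rrel d x)).
  { intros x Nx. assert (P := Np N (le_n _)).
    replace (RtoC (x ^ N) * (dorb (/ x) (S N) - dorb (/ x) (nxt N)))%C
      with (RtoC (x ^ N) * dorb (/ x) (S N) - RtoC (x ^ N) * dorb (/ x) (nxt N))%C by ring.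
    rewrite (dorb_rsum d) by auto. unfold rrel. case_eq (nxt N); [|intros j]; intros Ej.
    - simpl dorb. rewrite Rminus_0_r. ring.
    - replace (RtoC (x ^ N) * dorb (/ x) (S j))%C with (RtoC (x ^ (N - j) * (rprod d j * rsum d x (S j)))).
      2:{ rewrite RtoC_mult, <- (dorb_rsum d), Cmult_assoc, <- RtoC_mult, <- pow_add by (auto; lia).
          replace (N - j + j)%nat with N by lia. reflexivity. }
      rewrite <- RtoC_minus.
      f_equal. field. exact P. }
  assert (N1 : rrel d 1 <> 0).
  { intros E. assert (T := Key 1 ltac:(lra)). rewrite E, pow1, Rinv_1, Rmult_0_r, Cmult_1_l in T.
    apply relation_transversal. replace (dorb 1 (nxt N)) with (dorb 1 (nxt N) + RtoC 0)%C by ring.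
    rewrite <- T. ring. }
  (* When [nxt N = S j], the bound [nxt N <= N] makes the exponent [N - j] positive, so the second
     term vanishes at [0]. *)
  assert (E0 : rrel d 0 = 1).
  { unfold rrel. rewrite rsum_at_0. case_eq (nxt N); [|intros j]; intros Ej; [ring|].
    rewrite pow_i by lia. ring. }
  exists (rrel d 1). split; [|split; [|apply Np; auto]].
  - destruct (Rle_lt_dec (rrel d 1) 0) as [L|L]; auto. exfalso.
    (* The root lies strictly between [0] and [1], since transversality excludes [1]; so [s = 1 / z]
       would be an expanding scale at which the relation closes up. *)
    destruct (IVT_cor (rrel d) 0 1 (rrel_continuity d)) as [z [Hz Ez]]; [lra|rewrite E0; lra|].
    assert (z <> 0) by (intros E; rewrite E in Ez; lra).
    assert (z <> 1) by (intros E; rewrite E in Ez; lra).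
    apply (no_expanding_relation (/ z)).
    + rewrite <- Rinv_1. apply Rinv_lt_contravar; lra.
    + assert (T := Key z H). rewrite Ez, Rmult_0_r in T.
      assert (Nz : RtoC (z ^ N) <> RtoC 0) by (apply RtoC_neq0, pow_nonzero; auto).
      replace (dorb (/ z) (S N)) with
        (RtoC (z ^ N) * (dorb (/ z) (S N) - dorb (/ z) (nxt N)) / RtoC (z ^ N) + dorb (/ z) (nxt N))%C by (field; auto).
      rewrite T. field. auto.
  - rewrite <- Key by lra. rewrite pow1, Rinv_1. ring.
Qed.
End ClassF.

(** * The additive family *)

Section AdditiveFamily.
Variables (U V : C -> Prop) (f : C -> C).
Hypothesis hF : class_F U V f.
Variables (c1 : C) (g : C -> C) (N : nat).
Hypothesis hc1 : U c1.
Hypothesis hg : forall z, U z -> z <> RtoC 0 -> g z = (f z + c1)%C.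
Hypothesis hg0 : g (RtoC 0) = c1.
Hypothesis HN : (1 <= N)%nat.

Definition mark (n : nat) : C :=
  match n with O => RtoC 0 | S i => Nat.iter i g c1 end.

Variable k : nat.
Hypothesis Hk : (k <= N)%nat.
Hypothesis Hcq : Nat.iter N g c1 = mark k.
Hypothesis HX : forall n, (1 <= n <= N)%nat -> minus0 U (mark n).
Hypothesis Xinj : forall m n, (m <= N)%nat -> (n <= N)%nat -> mark m = mark n -> m = n.

Definition next (n : nat) : nat := if Nat.eq_dec n N then k else S n.

Lemma next_N : next N = k.
Proof. unfold next. destruct (Nat.eq_dec N N); [reflexivity|congruence]. Qed.

Lemma next_S n : (1 <= n < N)%nat -> next n = S n.
Proof. intros Hn. unfold next. destruct (Nat.eq_dec n N); [lia|reflexivity]. Qed.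

Lemma next_N_le : (next N <= N)%nat.
Proof. rewrite next_N. exact Hk. Qed.

#[local] Hint Resolve next_S next_N_le : core.

Lemma g_minus0 z : minus0 U z -> g z = (f z + c1)%C.
Proof. intros [A B]. apply hg; auto. Qed.

Lemma g_mark n : (1 <= n <= N)%nat -> g (mark n) = mark (next n).
Proof.
  intros Hn. destruct n as [|i]; [lia|]. simpl mark at 1.
  change (g (Nat.iter i g c1)) with (Nat.iter (S i) g c1).
  destruct (Nat.eq_dec (S i) N) as [E|E].
  - rewrite E, next_N. exact Hcq.
  - rewrite next_S by lia. reflexivity.
Qed.

Lemma f_mark n : (1 <= n <= N)%nat -> f (mark n) = (mark (next n) - mark 1)%C.
Proof.
  intros Hn. rewrite <- g_mark, g_minus0 by (auto; apply HX; auto). simpl. ring.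
Qed.

Let D := additive_deformation U g c1 (S N).

Lemma marked_iff x : d_P D x <-> exists n, (n <= N)%nat /\ x = mark n.
Proof.
  unfold D. simpl. split.
  - intros [E|[n [Hn E]]]; [exists O; split; [lia|auto]|].
    exists n. split; [lia|]. destruct n as [|i]; [lia|]. simpl in *. rewrite Nat.sub_0_r in E. exact E.
  - intros [[|i] [Hn E]]; [left; exact E|right]. exists (S i). split; [lia|].
    simpl in *. rewrite Nat.sub_0_r. exact E.
Qed.

(** [c_1] is the image of the critical point, the later [c_n] are images of their predecessors, and
    [0] can only be reached as the image of [c_N]. *)
Lemma image_iff y : d_gP D y <-> exists n, idx N next n /\ y = mark n.
Proof.
  unfold d_gP. split.
  - intros [x [Hx E]]. apply marked_iff in Hx. destruct Hx as [n [Hn Ex]]. subst x.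
    change (d_g D) with g in E. destruct (Nat.eq_dec n 0) as [E0|E0].
    + subst n. simpl in E. rewrite hg0 in E. exists 1%nat. split; [left; lia|exact E].
    + rewrite g_mark in E by lia. exists (next n). split; auto.
      apply idx_nxt; auto. lia.
  - intros [n [[Hn|[Hn Zn]] E]].
    + destruct (Nat.eq_dec n 1) as [E1|E1].
      * exists (RtoC 0). split; [apply marked_iff; exists O; split; [lia|reflexivity]|].
        change (d_g D) with g. rewrite hg0, E, E1. reflexivity.
      * exists (mark (n - 1)). split; [apply marked_iff; exists (n - 1)%nat; split; [lia|reflexivity]|].
        change (d_g D) with g. rewrite g_mark, next_S by lia. rewrite E. f_equal. lia.
    + exists (mark N). split; [apply marked_iff; exists N; auto|].
      change (d_g D) with g. rewrite g_mark, Zn, E, Hn by lia. reflexivity.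
Qed.

(** An inverse of [mark] on [g(P)]: the required motions are functions of points, while the
    constructed ones are indexed by orbit position. *)
Definition index_of (x : C) : nat := epsilon (inhabits O) (fun n => idx N next n /\ x = mark n).

Lemma index_of_mark n : idx N next n -> index_of (mark n) = n.
Proof.
  intros Hn. assert (T := epsilon_spec (inhabits O) (fun m => idx N next m /\ mark n = mark m)
    (ex_intro _ n (conj Hn eq_refl))).
  fold (index_of (mark n)) in T. destruct T as [T1 T2]. symmetry.
  apply Xinj; auto; apply (idx_le N next); auto.
Qed.

Lemma lifting_additive : lifting_property D.
Proof.
  intros h0 [M0 [Mi Mh]].
  assert (I1 : idx N next 1) by (left; lia).
  assert (Img : forall n, idx N next n -> d_gP D (mark n)) by (intros n Hn; apply image_iff; exists n; auto).
  destruct (lift_sequence U V f hF c1 hc1 N mark next HN eq_refl HX Xinj next_S next_N_le f_mark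
    (fun n z => h0 z (mark n))) as [e [M [h [He [PM [H0 [Hm [Hl HM]]]]]]]].
  { split; [|split].
    - intros n Hn. apply M0. auto.
    - intros z Hz m n Hm Hn E. apply Xinj; try (apply (idx_le N next); auto).
      apply (Mi z); auto.
    - intros n Hn. apply (holo_sub (Defs.disc 1)).
      + intros z Hz. apply (proj1 (ball_at_0 1 z)). exact Hz.
      + apply holomorphic_on_holo. apply Mh. auto. }
  (* Stage [0] has to be [h0] itself, including its values off [g(P)], so only later stages are
     translated back from indices. *)
  set (H := fun j => match j with O => h0 | S _ => fun l x => h j (index_of x) l end).
  assert (EH : forall j n l, idx N next n -> H j l (mark n) = h j n l).
  { intros j n l Hn. destruct j; simpl; [rewrite H0; reflexivity|]. rewrite index_of_mark by auto. reflexivity. }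
  exists e, M. split; [exact He|split; [exact PM|]]. exists H. split; [reflexivity|split; [|split]].
  - intros j _. destruct (Hm j) as [A [B E]]. split; [|split].
    + intros x Hx. apply image_iff in Hx. destruct Hx as [n [Hn Ex]]. subst x. rewrite EH by auto. apply A; auto.
    + intros l x y Hl' Hx Hy Exy. apply image_iff in Hx. apply image_iff in Hy.
      destruct Hx as [m [Hm' Ex]]. destruct Hy as [n [Hn Ey]]. subst x y.
      rewrite !EH in Exy by auto. f_equal. apply (B l); auto.
    + intros x Hx. apply image_iff in Hx. destruct Hx as [n [Hn Ex]]. subst x.
      apply holomorphic_on_holo. intros l Hl'. destruct (E n Hn l (proj2 (ball_at_0 e l) Hl')) as [d Hd].
      exists d. apply (dC_ext (h j n)); auto. intros w. symmetry. apply EH; auto.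
  - intros j l Hl'. destruct (Hl j l Hl') as [L0 L1].
    change (d_c1 D) with (mark 1). change (d_c0 D) with (mark 0). rewrite EH by auto.
    split; [exact I|split].
    + intros G0. apply image_iff in G0. destruct G0 as [n [Hn E]].
      assert (n = O).
      { symmetry. apply Xinj; auto; [lia|]. apply (idx_le N next); auto. }
      subst n. rewrite EH by auto. apply L0. destruct Hn as [Hn|[_ Hn]]; [lia|exact Hn].
    + intros x Hx Nx. apply image_iff in Hx. destruct Hx as [n [Hn E]]. subst x.
      assert (Hn1 : (1 <= n <= N)%nat).
      { destruct Hn as [Hn|[Hn _]]; auto. subst n. exfalso. apply Nx. reflexivity. }
      destruct (L1 n Hn1) as [Um Fm]. rewrite EH by auto. split; [exact Um|].
      change (d_g D (mark n)) with (g (mark n)). rewrite g_mark, EH by (auto; apply idx_nxt; auto).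
      change (g (h (S j) n l) + (h j 1%nat l - c1) = h j (next n) l)%C.
      rewrite g_minus0, Fm by auto. ring.
  - intros j l x Hl' Hx. apply image_iff in Hx. destruct Hx as [n [Hn E]]. subst x.
    rewrite EH by auto. apply HM; auto.
Qed.

Lemma derivatives_exist : exists df : nat -> C, forall n, (1 <= n <= N)%nat -> dC f (mark n) (df n).
Proof.
  assert (Q : forall n, exists l, (1 <= n <= N)%nat -> dC f (mark n) l).
  { intros n. destruct (classic (1 <= n <= N)%nat) as [Hn|Hn]; [|exists (RtoC 0); tauto].
    destruct (f_holo U V f hF (mark n) (proj1 (HX n Hn))) as [l Hl]. exists l. auto. }
  exists (fun n => proj1_sig (constructive_indefinite_description _ (Q n))).
  intros n. exact (proj2_sig (constructive_indefinite_description _ (Q n))).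
Qed.

(** In iterates of [G_w] the index drops by one, as [c_(j+1)] is the iterate number [j]; [k = 0] is
    the relation with the critical point, where [p] is zero. *)
Definition rel_fun (w : C) : C :=
  (Nat.iter N (d_G D w) w - match k with O => RtoC 0 | S j => Nat.iter j (d_G D w) w end)%C.

Lemma rel_fun_deriv df : (forall n, (1 <= n <= N)%nat -> dC f (mark n) (df n)) ->
  C_is_derive rel_fun c1 (dorb df 1 (S N) - dorb df 1 (next N))%C.
Proof.
  intros Hdf. apply C_is_derive_dC.
  destruct (orb_holo U V f hF N mark next HN HX next_S next_N_le f_mark) as [rho [Pr [_ HU]]].
  (* Near [c_1] the orbit stays in [U] minus [0], where [g = f + c1] and therefore [G_w = f + w]. *)
  assert (It : forall n w, (n <= N)%nat -> ball_at c1 rho w -> Nat.iter n (d_G D w) w = orb f (S n) w).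
  { induction n as [|n IH]; intros w Hn Hw; [reflexivity|].
    change (Nat.iter (S n) (d_G D w) w) with (g (Nat.iter n (d_G D w) w) + (w - c1))%C.
    rewrite IH by (auto; lia). rewrite g_minus0 by (apply HU; auto; lia).
    rewrite (orb_SS f (S n)) by lia. ring. }
  apply (dC_ext_loc (relation f N next) rel_fun c1 _ rho Pr).
  - intros w Hw. unfold relation, rel_fun. rewrite next_N, It by auto. f_equal. f_equal.
    destruct k as [|j]; [reflexivity|]. rewrite It by (auto; lia). reflexivity.
  - apply dC_minus; apply (orb_deriv f N mark next HN next_S next_N_le f_mark df Hdf); auto.
Qed.

Lemma rel_fun_relation : relation_function D (S N) rel_fun.
Proof.
  unfold relation_function, c_. simpl (S N - 1)%nat. rewrite Nat.sub_0_r.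
  unfold rel_fun. destruct k as [|j] eqn:Ek.
  - left. split; [exact Hcq|reflexivity].
  - right. exists (S j). split; [lia|]. simpl (S j - 1)%nat. rewrite Nat.sub_0_r.
    split; [exact Hcq|reflexivity].
Qed.

Lemma transversal_additive : transversality D (S N).
Proof.
  destruct derivatives_exist as [df Hdf].
  exists rel_fun, (dorb df 1 (S N) - dorb df 1 (next N))%C.
  split; [exact rel_fun_relation|split; [apply rel_fun_deriv; auto|]].
  intros E.
  apply (relation_transversal U V f hF c1 hc1 N mark next HN eq_refl HX Xinj next_S next_N_le f_mark df Hdf).
  replace (dorb df 1 (S N)) with (dorb df 1 (S N) - dorb df 1 (next N) + dorb df 1 (next N))%C by ring.
  rewrite E. ring.
Qed.

Lemma g_deriv df n : (forall n, (1 <= n <= N)%nat -> dC f (mark n) (df n)) -> (1 <= n <= N)%nat ->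
  dC g (mark n) (df n).
Proof.
  intros Hdf Hn. destruct (minus0_U_open U V f hF (mark n) (HX n Hn)) as [d [Pd Hd]].
  apply (dC_ext_loc (fun z => f z + c1)%C g _ _ d Pd).
  - intros w Hw. symmetry. apply g_minus0. auto.
  - replace (df n) with (df n + RtoC 0)%C by ring. apply dC_plus; [auto|apply dC_const].
Qed.

(** Along real increments [h] has real differences, so the imaginary part of [l] appears entirely in
    the remainder, which is allowed only half its size. *)
Lemma real_derivative (h : C -> C) x l d : 0 < d -> snd x = 0 ->
  (forall t, Rabs t < d -> snd (h (x + RtoC t)%C) = 0) -> dC h x l -> snd l = 0.
Proof.
  intros Pd Hx Hr Hl. apply NNPP. intros Nl.
  assert (Pl : 0 < Rabs (snd l)) by (apply Rabs_pos_lt; auto).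
  destruct (Hl (Rabs (snd l) / 2)) as [d2 [P2 H2]]; [lra|].
  set (t := Rmin d d2 / 2). assert (m1 := Rmin_l d d2). assert (m2 := Rmin_r d d2).
  assert (Pt : 0 < t) by (unfold t; assert (0 < Rmin d d2) by (apply Rmin_pos; auto); lra).
  assert (Et : Cmod (x + RtoC t - x) = t).
  { replace (x + RtoC t - x)%C with (RtoC t) by ring. rewrite Cmod_R, Rabs_pos_eq; lra. }
  specialize (H2 (x + RtoC t)%C). rewrite Et in H2. specialize (H2 ltac:(unfold t; lra)).
  assert (T := Rle_trans _ _ _ (Rmax_r _ _) (Rmax_Cmod (h (x + RtoC t) - h x - l * (x + RtoC t - x))%C)).
  assert (E1 := Hr t ltac:(rewrite Rabs_pos_eq by lra; unfold t; lra)).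
  assert (E0 := Hr 0 ltac:(rewrite Rabs_R0; lra)). rewrite Cplus_0_r in E0.
  simpl in T. simpl in E1. rewrite E1, E0 in T.
  replace (0 + - 0 + - (fst l * (snd x + 0 + - snd x) + snd l * (fst x + t + - fst x))) with (- (snd l * t)) in T by ring.
  rewrite Rabs_Ropp, Rabs_mult, (Rabs_pos_eq t) in T by lra. nra.
Qed.

Lemma positive_additive : real_deformation D -> positively_oriented_transversality D (S N).
Proof.
  intros [HP [Hdom [Hg _]]].
  destruct derivatives_exist as [df Hdf].
  assert (Xr : forall n, (n <= N)%nat -> snd (mark n) = 0).
  { intros n Hn. apply HP. apply marked_iff. exists n. auto. }
  (* Conjugation symmetry makes [g] real on the real axis near [c_n], and [f] differs from [g] there
     by a constant. *)
  assert (Dr : forall n, (1 <= n <= N)%nat -> df n = RtoC (fst (df n))).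
  { intros n Hn. destruct (minus0_U_open U V f hF (mark n) (HX n Hn)) as [d [Pd Hd]].
    assert (E : snd (df n) = 0).
    { apply (real_derivative g (mark n) (df n) d Pd); [apply Xr; lia| |apply g_deriv; auto].
      intros t Ht. set (x := (mark n + RtoC t)%C).
      assert (Ux : minus0 U x).
      { apply Hd. unfold x. replace (mark n + RtoC t - mark n)%C with (RtoC t) by ring.
        rewrite Cmod_R. exact Ht. }
      assert (Cx : Cconj x = x).
      { unfold x, Cconj. simpl. rewrite (Xr n) by lia. unfold Cplus, RtoC. simpl. rewrite (Xr n) by lia.
        f_equal. ring. }
      assert (Eg := Hg x Ux). change (d_g D) with g in Eg. rewrite Cx in Eg.
      assert (T := f_equal snd Eg). simpl in T. lra. }
    destruct (df n) as [a b]. simpl in *. subst b. reflexivity. }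
  destruct (relation_positive U V f hF c1 hc1 N mark next HN eq_refl HX Xinj next_S next_N_le f_mark df Hdf
    (fun n => fst (df n)) Dr) as [t [Pt [Et Np]]].
  exists rel_fun, (dorb df 1 (S N) - dorb df 1 (next N))%C, (RtoC (rprod (fun n => fst (df n)) N)).
  split; [exact rel_fun_relation|split; [apply rel_fun_deriv; auto|split; [|split]]].
  - apply C_is_derive_dC. simpl (S N - 1)%nat. rewrite Nat.sub_0_r. change (d_g D) with g. change (d_c1 D) with c1.
    assert (Q : forall n, (n <= N)%nat -> dC (Nat.iter n g) c1 (RtoC (rprod (fun n => fst (df n)) n))).
    { induction n as [|n IH]; intros Hn; [apply dC_id|].
      simpl rprod. rewrite RtoC_mult, <- Dr, Cmult_comm by lia.
      apply (dC_comp g (Nat.iter n g)); [apply IH; lia|].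
      change (Nat.iter n g c1) with (mark (S n)). apply g_deriv; auto. lia. }
    apply Q. auto.
  - apply RtoC_neq0. exact Np.
  - exists t. split; [exact Pt|]. rewrite Et, RtoC_mult. field. apply RtoC_neq0. exact Np.
Qed.
End AdditiveFamily.

(* For [q = 1] the critical point is fixed and the only marked point is [0]. *)
Lemma fixed_critical_point (U : C -> Prop) (g : C -> C) : g (RtoC 0) = RtoC 0 ->
  let D := additive_deformation U g (RtoC 0) 1 in
  (lifting_property D /\ transversality D 1) /\ positively_oriented_transversality D 1.
Proof.
  intros hg0 D.
  assert (GP : forall y, d_gP D y <-> y = RtoC 0).
  { intros y. split.
    - intros [x [[E|[n [Hn _]]] Ey]]; [|lia]. rewrite E in Ey. rewrite Ey. exact hg0.
    - intros E. exists (RtoC 0). split; [left; reflexivity|]. rewrite E. symmetry. exact hg0. }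
  assert (Dr : C_is_derive (fun w => w - RtoC 0)%C (RtoC 0) (RtoC 1)).
  { apply C_is_derive_dC. replace (RtoC 1) with (RtoC 1 - RtoC 0)%C by ring.
    apply dC_minus; [apply dC_id|apply dC_const]. }
  assert (Rf : relation_function D 1 (fun w => w - RtoC 0)%C) by (left; split; reflexivity).
  split; [split|].
  - intros h0 [M0 [Mi Mh]].
    assert (G0 : d_gP D (RtoC 0)) by (apply GP; reflexivity).
    assert (Hh : holo (Defs.disc 1) (fun l => h0 l (RtoC 0))) by (apply holomorphic_on_holo; auto).
    assert (C0 : cont_at (fun l => h0 l (RtoC 0)) (RtoC 0)).
    { eapply holo_cont; [exact Hh|]. unfold Defs.disc. rewrite Cmod_0. lra. }
    destruct (C0 1 ltac:(lra)) as [d [Pd Hd]]. rewrite (M0 _ G0) in Hd.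
    assert (m1 := Rmin_l d 1). assert (m2 := Rmin_r d 1).
    (* The lifts are identically [0] because [p = 0]; the radius only has to keep the initial motion
       below the bound [1]. *)
    exists (Rmin d 1), 1. split; [split; [apply Rmin_pos; lra|lra]|]. split; [lra|].
    exists (fun j => match j with O => h0 | S _ => fun _ _ => RtoC 0 end).
    split; [reflexivity|split; [|split]].
    + intros [|j] Hj; [lia|]. split; [|split].
      * intros x Hx. symmetry. apply GP. exact Hx.
      * intros l x y _ Hx Hy _. apply GP in Hx. apply GP in Hy. congruence.
      * intros x _. apply holomorphic_on_holo. apply holo_const.
    + intros j l Hl. split; [exact I|split].
      * intros _. reflexivity.
      * intros x Hx Nx. exfalso. apply Nx. apply GP. exact Hx.
    + intros [|j] l x Hl Hx.
      * apply GP in Hx. subst x. specialize (Hd l). replace (l - 0)%C with l in Hd by ring.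
        replace (h0 l 0 - 0)%C with (h0 l (RtoC 0)) in Hd by ring. left. apply Hd. unfold Defs.disc in Hl. lra.
      * rewrite Cmod_0. lra.
  - exists (fun w => w - RtoC 0)%C, (RtoC 1). split; [exact Rf|split; [exact Dr|exact C1_nz]].
  - exists (fun w => w - RtoC 0)%C, (RtoC 1), (RtoC 1). split; [exact Rf|split; [exact Dr|split; [|split]]].
    + apply C_is_derive_dC. apply dC_id.
    + exact C1_nz.
    + exists 1. split; [lra|]. field.
Qed.

Theorem theorem2p1
  (U V : C -> Prop) (f : C -> C) (hF : class_F U V f)
  (c1 : C) (hc1 : U c1)
  (g : C -> C)
  (hg : forall z, U z -> z <> RtoC 0 -> g z = Cplus (f z) c1)
  (hg0 : g (RtoC 0) = c1)
  (q : nat) (hq : (1 <= q)%nat)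
  (hU : forall n, (1 <= n < q)%nat -> U (Nat.iter (n - 1) g c1))
  (hcq : Nat.iter (q - 1) g c1 = RtoC 0 \/
         exists l, (1 <= l < q)%nat /\
           Nat.iter (q - 1) g c1 = Nat.iter (l - 1) g c1)
  (hdistinct : forall n, (0 < n < q)%nat ->
     Nat.iter (n - 1) g c1 <> RtoC 0 /\
     forall m, (1 <= m < n)%nat ->
       Nat.iter (n - 1) g c1 <> Nat.iter (m - 1) g c1) :
  let D := additive_deformation U g c1 q in
  (lifting_property D /\ transversality D q) /\
  (real_deformation D -> positively_oriented_transversality D q).
Proof.
  destruct q as [|N]; [lia|]. simpl (S N - 1)%nat in hcq. rewrite Nat.sub_0_r in hcq.
  (* [N = q - 1] counts the marked points other than [0]. For [N = 0] no index [l] is available, so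
     the relation can only be [c_1 = 0]. *)
  destruct (Nat.eq_dec N 0) as [E|E].
  - subst N. assert (E : c1 = RtoC 0) by (destruct hcq as [H|[l [Hl _]]]; [exact H|lia]). rewrite E in hg0 |- *.
    destruct (fixed_critical_point U g hg0) as [A B]. split; auto.
  - assert (HN : (1 <= N)%nat) by lia.
    assert (HX : forall n, (1 <= n <= N)%nat -> minus0 U (mark c1 g n)).
    { intros [|i] Hn; [lia|]. specialize (hU (S i) ltac:(lia)). destruct (hdistinct (S i) ltac:(lia)) as [A _].
      simpl in *. rewrite Nat.sub_0_r in *. split; auto. }
    assert (Lt : forall m n, (m < n <= N)%nat -> mark c1 g n <> mark c1 g m).
    { intros m n Hn. destruct m as [|i]; [apply HX; lia|]. destruct n as [|j]; [lia|].
      destruct (hdistinct (S j) ltac:(lia)) as [_ A]. specialize (A (S i) ltac:(lia)).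
      simpl in *. rewrite !Nat.sub_0_r in A. exact A. }
    assert (Xinj : forall m n, (m <= N)%nat -> (n <= N)%nat -> mark c1 g m = mark c1 g n -> m = n).
    { intros m n Hm Hn Emn. destruct (Nat.lt_total m n) as [L|[L|L]]; auto; exfalso.
      - apply (Lt m n); auto.
      - apply (Lt n m); auto. }
    assert (Hk : exists k, (k <= N)%nat /\ Nat.iter N g c1 = mark c1 g k).
    { destruct hcq as [H|[l [Hl H]]]; [exists O; split; [lia|exact H]|].
      exists l. split; [lia|]. destruct l as [|j]; [lia|]. simpl in *. rewrite Nat.sub_0_r in H. exact H. }
    destruct Hk as [k [Hk Hcq]].
    split; [split|].
    + exact (lifting_additive U V f hF c1 g N hc1 hg hg0 HN k Hk Hcq HX Xinj).
    + exact (transversal_additive U V f hF c1 g N hc1 hg HN k Hk Hcq HX Xinj).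
    + exact (positive_additive U V f hF c1 g N hc1 hg HN k Hk Hcq HX Xinj).
Qed.
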